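(* Let $\mathcal{X}\subset\operatorname{Gr}(m,\mathbb{P}^N)$ be a closed subvariety, let $\gamma:\mathcal{X}\dashrightarrow\operatorname{Gr}(m^+,\mathbb{P}^N)$ be its expanding map, let $\mathcal{Y}$ be the closure of the image of $\gamma$, let $\gamma^*\bar\pi:\gamma^*V_{\mathcal{Y}}\to(\mathbb{P}^N)^\vee$ be the generalized conormal morphism, and let $Y\subset(\mathbb{P}^N)^\vee$ be its image. Let $v\in\gamma^*V_{\mathcal{Y}}$ be a general point, and let $x\in\mathcal{X}$ be the image of $v$ under $\gamma^*V_{\mathcal{Y}}\to\mathcal{X}$. Then the following hold: (a) $\operatorname{rk}d_v\gamma^*\bar\pi-(N-m^+-1)\leq\operatorname{rk}d_x\gamma$ and $\operatorname{rk}d_v\gamma^*\bar\pi-(N-m^+-1)\leq\operatorname{rk}\Psi_x$. (b) If $\operatorname{rk}d_v\gamma^*\bar\pi=N-m^+-1$, then $\operatorname{rk}d_x\gamma=0$. (c) If $\gamma^*\bar\pi$ is separable, then $\mathbb{T}_{\gamma^*\bar\pi(v)}Y\subset x^*$ in $(\mathbb{P}^N)^\vee$.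
   Context: Everything is over an algebraically closed field of arbitrary characteristic. $\operatorname{Gr}(m,\mathbb{P}^N)$ is the Grassmann variety of $m$-planes (i.e. $m$-dimensional linear subvarieties) in $\mathbb{P}^N$; $(\mathbb{P}^N)^\vee=\operatorname{Gr}(N-1,\mathbb{P}^N)$ is the space of hyperplanes. On $\operatorname{Gr}(m,\mathbb{P}^N)$ let $0\to\mathscr{S}\to H^0(\mathbb{P}^N,\mathscr{O}(1))\otimes\mathscr{O}\to\mathscr{Q}\to0$ be the universal sequence, $\operatorname{rk}\mathscr{Q}=m+1$, $\operatorname{rk}\mathscr{S}=N-m$; the fiber of $\mathscr{S}$ at $x$ is the space of linear forms vanishing on $x$. The tangent bundle is $\mathscr{H}om(\mathscr{S},\mathscr{Q})=\mathscr{H}om(\mathscr{Q}^\vee,\mathscr{S}^\vee)$. Write $\mathscr{Q}_{\mathcal{Y}},\mathscr{S}_{\mathcal{Y}}$ for the restrictions to $\mathcal{Y}$ of the universal bundles of $\operatorname{Gr}(m^+,\mathbb{P}^N)$. Expanding map: on the smooth locus $\mathcal{X}^{sm}$ let $\phi:\mathscr{S}|_{\mathcal{X}^{sm}}\to\mathscr{H}om(T_{\mathcal{X}^{sm}},\mathscr{Q}|_{\mathcal{X}^{sm}})$, $s\mapsto(t\mapsto t(s))$, a tangent vector being regarded as a homomorphism $\mathscr{S}\to\mathscr{Q}$. Let $m^+$ be the integer with $\dim(\ker\phi\otimes k(x))=N-m^+$ for general $x$. On a nonempty open subset $\mathcal{X}^\circ$, $\ker\phi$ is a rank $N-m^+$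 subbundle of $H^0(\mathbb{P}^N,\mathscr{O}(1))\otimes\mathscr{O}$ and induces $\gamma:\mathcal{X}^\circ\to\operatorname{Gr}(m^+,\mathbb{P}^N)$ with $\gamma^*\mathscr{S}_{\operatorname{Gr}(m^+,\mathbb{P}^N)}=\ker\phi$; $\gamma(x)$ is the $m^+$-plane cut out by the linear forms in $\ker\phi$ at $x$. Generalized conormal morphism: $V_{\mathcal{Y}}\subset\mathcal{Y}\times(\mathbb{P}^N)^\vee$ is the set of $(y,H)$ with $H\supset y$ (the projectivization of $\mathscr{S}_{\mathcal{Y}}$), $\gamma^*V_{\mathcal{Y}}\subset\mathcal{X}\times(\mathbb{P}^N)^\vee$ is the closure of its pull-back $\{(x,H): x\in\mathcal{X}^\circ,\ \gamma(x)\subset H\}$, and $\gamma^*\bar\pi$ is the projection to $(\mathbb{P}^N)^\vee$. $\Psi:\gamma^*\mathscr{Q}_{\mathcal{Y}}^\vee\to\mathscr{H}om(T_{\mathcal{X}},\gamma^*\mathscr{S}_{\mathcal{Y}}^\vee)$ (on the open subset of the smooth locus of $\mathcal{X}$ where $\gamma$ is defined) is $q\mapsto(t\mapsto d\gamma(t)(q))$, where $d\gamma:T_{\mathcal{X}}\to\gamma^*T_{\operatorname{Gr}(m^+,\mathbb{P}^N)}=\mathscr{H}om(\gamma^*\mathscr{Q}_{\mathcal{Y}}^\vee,\gamma^*\mathscr{S}_{\mathcal{Y}}^\vee)$; $\Psi_x$ is the induced linear map on fibers at $x$. $d_xf$ denotes the linear map of Zariski tangent spaces at $x$ induced by $f$,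 and $\operatorname{rk}$ its rank. $\mathbb{T}_yY$ is the embedded tangent space of $Y$ in $(\mathbb{P}^N)^\vee$ at $y$; for a linear subvariety $A\subset\mathbb{P}^N$, $A^*\subset(\mathbb{P}^N)^\vee$ is the set of hyperplanes containing $A$. A rational map $f:A\dashrightarrow B$ of varieties is separable if $K(A)/K(f(A))$ is separably generated. *)

(* Defs.v *)
From HB Require Import structures.
From mathcomp Require Import all_boot all_order all_algebra separable.
From mathcomp Require Import boolp classical_sets functions.
From mathcomp Require Import mpoly.

Set Implicit Arguments.
Unset Strict Implicit.
Unset Printing Implicit Defensive.

Import GRing.Theory.
Local Open Scope classical_set_scope.
Local Open Scope ring_scope.

(* Classical varieties over an algebraically closed field [K] are sets of      *)
(* closed points inside an ambient space whose points have "homogeneous"       *)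
(* coordinates: [coords u x] says that [u] is a coordinate vector of [x].      *)
(* Every point has coordinate vectors, a coordinate vector determines its      *)
(* point, and the ambient variety carries the quotient structure: a set is     *)
(* closed, resp. a function is regular, iff it is so in the coordinates.  For  *)
(* the spaces below the coordinate vectors of all points form an open subset   *)
(* of affine space which is a locally trivial bundle over the variety.         *)
Record space (K : closedFieldType) := Space {
  point :> Type;
  ncoord : nat;
  coords : 'rV[K]_ncoord -> point -> Prop }.

Section Zariski.
Variables (K : closedFieldType) (T : space K).
Implicit Types (A U Z : set T) (f g : T -> K).

Definition zclosed A : Prop :=
  exists F : set {mpoly K[ncoord T]},
    forall u x, coords u x -> (A x <-> forall p, F p -> p.@[u ord0] = 0).

Definition zopen U : Prop := zclosed (~` U).

Definition zclosure A : set T := [set x | forall B, zclosed B -> A `<=` B -> B x].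

Definition zirreducible Z : Prop :=
  Z !=set0 /\ forall A B, zclosed A -> zclosed B ->
    Z `<=` A `|` B -> Z `<=` A \/ Z `<=` B.

Definition generally Z (P : T -> Prop) : Prop :=
  exists U, [/\ zopen U,
    forall W, zopen W -> W `&` Z !=set0 -> W `&` U `&` Z !=set0
    & forall z, U z -> Z z -> P z].

Definition locally Z (z : T) (P : T -> Prop) : Prop :=
  exists U, [/\ zopen U, U z & forall y, U y -> Z y -> P y].

(* The strictly increasing chains of irreducible closed subsets of [Z] have    *)
(* maximal length [d].                                                         *)
Definition irr_chain Z (d : nat) : Prop :=
  exists C : nat -> set T,
    (forall i, (i <= d)%N ->
       zirreducible (C i) /\ exists2 A, zclosed A & C i = Z `&` A) /\
    (forall i, (i < d)%N -> C i `<` C i.+1).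

Definition has_dim Z (d : nat) : Prop := irr_chain Z d /\ ~ irr_chain Z d.+1.

(* Only the values of [f] on [Z] near [z] matter. *)
Definition regular_at Z f (z : T) : Prop :=
  exists (p q : {mpoly K[ncoord T]}) (u : 'rV[K]_(ncoord T)),
    [/\ coords u z, q.@[u ord0] != 0
      & forall u' z', coords u' z' -> Z z' -> q.@[u' ord0] != 0 ->
          f z' = p.@[u' ord0] / q.@[u' ord0]].

(* The Zariski tangent space of [Z] at [z], as the space of point derivations  *)
(* of the local ring.  A germ is represented by any globally defined function  *)
(* inducing it; the value [0] on functions that are not regular at [z] makes   *)
(* the representation of a derivation unique.                                  *)
Record tangent Z (z : T) (D : (T -> K) -> K^o) : Prop := Tangent {
  tangent_out : forall f, ~ regular_at Z f z -> D f = 0;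
  tangent_germ : forall f g, regular_at Z f z -> regular_at Z g z ->
    locally Z z (fun y => f y = g y) -> D f = D g;
  tangent_linear : forall (a : K) f g,
    regular_at Z f z -> regular_at Z g z ->
    D (fun y => a * f y + g y) = a * D f + D g;
  tangent_leibniz : forall f g, regular_at Z f z -> regular_at Z g z ->
    D (fun y => f y * g y) = f z * D g + g z * D f }.

End Zariski.

Section Rank.
Variables (K : fieldType) (E : Type) (E' : lmodType K).

(* [L @` A] has a basis with [r] elements. *)
Definition has_rank (A : set E) (L : E -> E') (r : nat) : Prop :=
  exists e : 'I_r -> E,
    [/\ forall i, A (e i),
        forall c : 'I_r -> K, \sum_i c i *: L (e i) = 0 -> forall i, c i = 0
      & forall a, A a -> exists c : 'I_r -> K, L a = \sum_i c i *: L (e i)].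

(* The rank of [L], linear on the space [A] ([0] if the rank is infinite). *)
Definition rk (A : set E) (L : E -> E') : nat := xget 0%N (has_rank A L).

End Rank.

Definition smooth_at (K : closedFieldType) (T : space K) (Z : set T) (z : T) :=
  has_dim Z (rk (tangent Z z) id).

(* The differential at [z] of [f], with values in the tangent space of [Z'] at *)
(* [f z]: the derivation [D] is sent to [g |-> D (g \o f)].                    *)
Definition differential (K : closedFieldType) (T T' : space K) (Z' : set T')
    (f : T -> T') (z : T) (D : (T -> K) -> K^o) : (T' -> K) -> K^o :=
  fun g => if `[< regular_at Z' g (f z) >] then D (g \o f) else 0.

Section Separable.
Variables (K : closedFieldType) (T : space K).

Definition rational (Z : set T) (f : T -> K) : Prop :=
  generally Z (regular_at Z f).

(* [L] is the function field of the irreducible [Z], and [cl] maps a rational  *)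
(* function on [Z] to its class; [L] and [cl] are unique up to a unique        *)
(* isomorphism.                                                                *)
Record function_field (Z : set T) (L : fieldType) (cl : (T -> K) -> L) : Prop :=
  FunctionField {
    ff_surj : forall l : L, exists2 f, rational Z f & cl f = l;
    ff_eq : forall f g, rational Z f -> rational Z g ->
      (cl f = cl g <-> generally Z (fun z => f z = g z));
    ff_one : cl (fun=> 1) = 1;
    ff_add : forall f g, rational Z f -> rational Z g ->
      cl (fun z => f z + g z) = cl f + cl g;
    ff_mul : forall f g, rational Z f -> rational Z g ->
      cl (fun z => f z * g z) = cl f * cl g }.

End Separable.

Section SeparablyGenerated.
Variables (L : fieldType) (F : set L).

Definition coef_in (E : set L) (r : nat) (p : {mpoly L[r]}) : Prop :=
  forall mon, E p@_mon.

Definition alg_independent (r : nat) (b : 'I_r -> L) : Prop :=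
  forall p : {mpoly L[r]}, coef_in F p -> p.@[b] = 0 -> p = 0.

Definition adjoin (r : nat) (b : 'I_r -> L) : set L :=
  [set l | exists p q : {mpoly L[r]},
    [/\ coef_in F p, coef_in F q, q.@[b] != 0 & l = p.@[b] / q.@[b]]].

Definition separable_over (E : set L) (l : L) : Prop :=
  exists p : {poly L},
    [/\ forall i, E p`_i, separable_poly p & root p l].

(* Here [L] has finite transcendence degree over the subfield [F], so that a   *)
(* separating transcendence basis is a finite family.                          *)
Definition separably_generated : Prop :=
  exists (r : nat) (b : 'I_r -> L),
    alg_independent b /\ forall l, separable_over (adjoin b) l.

End SeparablyGenerated.

Definition separable_map (K : closedFieldType) (T T' : space K) (Z : set T)
    (f : T -> T') : Prop :=
  exists (L : fieldType) (cl : (T -> K) -> L),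
    function_field Z cl /\
    separably_generated
      [set cl (g \o f) | g in rational (zclosure (f @` Z))].

Section Grassmannian.
Variables (K : closedFieldType) (N : nat).

(* Linear subvarieties of P^N are subspaces of the space of column vectors of  *)
(* size N + 1, of dimension one more; linear forms are row vectors.            *)

Definition cut_out_by (c : nat) (M : 'M[K]_(c, N.+1))
    (E : {vspace 'cV[K]_N.+1}) : Prop :=
  forall p, (p \in E) = (M *m p == 0).

(* The fibre at [E] of the universal bundle S.  The fibre of Q is the quotient *)
(* of the space of all linear forms by it, i.e. the dual of [E] itself.        *)
Definition vanishing (E : {vspace 'cV[K]_N.+1}) : set 'rV[K]_N.+1 :=
  [set s | forall p, p \in E -> s *m p = 0].

(* Coordinates of an m-plane: the entries of the matrix of a system of N - m   *)
(* linear equations defining it.                                               *)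
Definition Gr (m : nat) : space K :=
  @Space K {E : {vspace 'cV[K]_N.+1} | \dim E == m.+1} ((N - m) * N.+1)%N
    (fun u x => cut_out_by (vec_mx u) (val x)).

(* (P^N)^vee; the coordinates of a hyperplane are those of an equation. *)
Definition dualP : space K :=
  @Space K {E : {vspace 'cV[K]_N.+1} | \dim E == N} N.+1
    (fun h H => cut_out_by h (val H)).

Definition prod_space (T T' : space K) : space K :=
  @Space K (T * T') (ncoord T + ncoord T')%N
    (fun u v => coords (lsubmx u) v.1 /\ coords (rsubmx u) v.2).

(* The hyperplanes containing a plane. *)
Definition star (m : nat) (x : Gr m) : set dualP :=
  [set H : dualP | (val x <= val H)%VS].

Definition embedded_tangent (Y : set dualP) (y : dualP) : set dualP :=
  [set H : dualP | forall (h k : 'rV[K]_N.+1), coords (s := dualP) h y ->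
    coords (s := dualP) k H ->
    forall (d : nat) (p : {mpoly K[N.+1]}), p \is d.-homog ->
      (forall h' y', coords (s := dualP) h' y' -> Y y' -> p.@[h' ord0] = 0) ->
      \sum_i p^`M(i).@[h ord0] * k ord0 i = 0].

Section Hom.
Variables (m : nat) (Z : set (Gr m)).

Definition local_section (z : Gr m) (sigma : Gr m -> 'rV[K]_N.+1) : Prop :=
  (forall i, regular_at Z (fun y => sigma y ord0 i) z) /\
  locally Z z (fun y => vanishing (val y) (sigma y)).

(* The identification of a tangent vector [D] at [z] with a homomorphism from  *)
(* S_z to Q_z: [s] in S_z is extended to a local section of S, whose           *)
(* derivative along [D] is well defined modulo S_z.  The value below is a      *)
(* representative, in the space of linear forms, of this element of Q_z.       *)
Definition hom_of_tangent (z : Gr m) (D : (Gr m -> K) -> K^o)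
    (s : 'rV[K]_N.+1) : 'rV[K]_N.+1 :=
  let sigma := xget (fun=> 0)
    [set sigma | local_section z sigma /\ sigma z = s] in
  \row_i D (fun y => sigma y ord0 i).

(* The kernel of phi_x : S_x -> Hom(T_x, Q_x), s |-> (t |-> t(s)). *)
Definition ker_phi (x : Gr m) : set 'rV[K]_N.+1 :=
  [set s | vanishing (val x) s /\
    forall D, tangent Z x D -> vanishing (val x) (hom_of_tangent x D s)].

End Hom.

Section Expanding.
Variables (m mp : nat) (X Xo : set (Gr m)) (gamma : Gr m -> Gr mp).

(* [gamma] is the expanding map of [X] on the nonempty open subset [Xo].  As   *)
(* the forms vanishing on an mp-plane have dimension N - mp, the last clause   *)
(* also says that mp is the integer m^+.                                       *)
Definition expanding_map : Prop :=
  [/\ exists2 U, zopen U & Xo = X `&` U,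
      Xo !=set0,
      forall x, Xo x -> smooth_at X x
    & forall x, Xo x -> vanishing (val (gamma x)) = ker_phi X x].

Definition expanded_image : set (Gr mp) := zclosure (gamma @` Xo).

Definition conormal (Z : set (Gr mp)) : set (prod_space (Gr mp) dualP) :=
  [set v | Z v.1 /\ star v.1 v.2].

Definition gen_conormal : set (prod_space (Gr m) dualP) :=
  zclosure [set v : prod_space (Gr m) dualP |
    Xo v.1 /\ conormal expanded_image (gamma v.1, v.2)].

Definition dgamma (x : Gr m) :
    ((Gr m -> K) -> K^o) -> ((Gr mp -> K) -> K^o) :=
  differential expanded_image gamma x.

(* Psi_x sends [q] in the dual of Q at [gamma x], i.e. in the plane [gamma x], *)
(* to t |-> (s |-> <dgamma(t)(s), q>), with s in S at [gamma x].               *)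
Definition Psi (x : Gr m) (q : 'cV[K]_N.+1) :
    {t | tangent X x t} -> {s | vanishing (val (gamma x)) s} -> K^o :=
  fun t s => (hom_of_tangent expanded_image (gamma x)
                (dgamma x (proj1_sig t)) (proj1_sig s) *m q) ord0 ord0.

End Expanding.

Definition pibar (m : nat) : prod_space (Gr m) dualP -> dualP := fun v => v.2.

End Grassmannian.

(* Main.v *)
(* Let [G] be a local matrix of equations of [gamma x], normalized by [G A = 1].  Over [Xo] the    *)
(* variety [V] is the projective bundle of the row spaces of [G], and at [v = (x, [h])] the image  *)
(* of its tangent space in the space of linear forms is, modulo [h], the set of forms [k] whose    *)
(* restriction to the plane [gamma x] is the pairing [h A dG(t)] of [h] with some tangent vector   *)
(* [t] of [X] at [x].  Its rank is thus N - mp - 1 plus the rank of [t |-> h A dG(t)], which is    *)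
(* bounded by the ranks of [dgamma] and of [Psi], and which is nonzero for general [h] as soon as  *)
(* [dG] is; this gives (a) and (b).  That [gamma] is a morphism on [Xo] follows from smoothness:   *)
(* tangent spaces of locally constant dimension are cut out by finitely many gradients of constant *)
(* rank, so the tangent bundle, and then [ker phi], have regular frames.                           *)
(*   For (c), an embedded tangent vector of [Y] at the generic point of [V] is a derivation        *)
(* K(Y) -> K(V), which by separability extends to K(V).  It is then tangent to [X], so that        *)
(* differentiating [h = h B M], with [M] normalized equations of [x], kills the term in [dM]       *)
(* because [h] is in [ker phi]; the derivative of [h] therefore vanishes on [x].  The conclusion   *)
(* specializes to general points of [V].                                                           *)

Require Import Defs.
From mathcomp Require Import all_boot all_order all_algebra.
From mathcomp Require Import boolp classical_sets functions.
From mathcomp Require Import mpoly.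
From mathcomp Require Import ring.
From mathcomp Require separable.

Set Implicit Arguments.
Unset Strict Implicit.
Unset Printing Implicit Defensive.

Import GRing.Theory.
Local Open Scope classical_set_scope.
Local Open Scope ring_scope.

(** * Ranks of families of vectors *)

(** Ranks. Over [Xo] the conormal variety is the bundle of hyperplanes through [gamma x]. With
    normalized equations [G] of [gamma x], [G A = 1], a point [(x, [h])] of it satisfies
    [h = h A G], so a tangent vector over [t] has [dh = (dh A) G + h A dG(t)]. Modulo the forms
    vanishing on [gamma x] only [h A dG(t)] survives; this is [conormal_pairing], and
    [tangent_conormal] is the computation. Conversely every form in the row space of [G] compatible
    with the normalization [h a = 1] is realized by moving [h] in its fibre ([vertical_tangent]),
    and every [t] lifts along a local section ([lift_tangent]). Hence [rk_conormal]: the rank of the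
    differential is [N - mp - 1] plus the rank of the pairing. For (a), the pairing is a linear
    function of [dgamma(t)], and its value on a vector [q] of the plane [gamma x] is [Psi q]
    evaluated at [(t, h)]; see [rk_pairing_dgamma] and [rk_pairing_Psi]. For (b), nonvanishing of
    the pairing is an open condition ([pairing_near]) on the irreducible [V]
    ([gen_conormal_irreducible]). Either it holds generally, and then the rank is not minimal, or
    the pairing vanishes at all points over [Xo]; letting [h] run through the rows of [G] then gives
    [dG = 0] ([rank_minimal]). For (c), a form tangent to [Y] at the generic point of [V] defines a
    derivation K(Y) -> K(V). By [deriv_extension] separability extends it to the coordinates of [x].
    Differentiating [h = h B M], with [M] normalized equations of [x], the term [h B dM] is zero
    because [h] lies in the kernel of phi, and what remains says that [dh] vanishes on [x]
    ([tangent_form_vanishing]). This is a matrix identity over K(V), so it specializes to general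
    points ([embedded_tangent_star]). Two foundations support this. Point derivations of a local
    ring correspond to vectors killed by the gradients of the equations in a chart ([tangent_chart],
    [tangent_exists], [tangent_eq0]). And [gamma] is a morphism on [Xo] ([gamma_lift],
    [gamma_morphism]): smoothness makes the tangent spaces of constant dimension, so they have
    regular frames, and the kernel of phi is then the kernel of a regular matrix of constant
    rank. *)

Section RankLemmas.
Variable K : fieldType.

Lemma row_free_combP k n (M : 'M[K]_(k, n)) :
  reflect (forall c : 'I_k -> K, \sum_i c i *: row i M = 0 -> forall i, c i = 0)
          (row_free M).
Proof.
apply: (iffP idP) => [Mf c c0 i|cM].
  have : (\row_i c i) *m M = 0.
    by rewrite mulmx_sum_row -[RHS]c0; apply: eq_bigr => j _; rewrite mxE.
  by move/eqP; rewrite mulmx_free_eq0 // => /eqP/rowP/(_ i); rewrite !mxE.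
rewrite -kermx_eq0; apply/eqP/row_matrixP => i; rewrite row0.
apply/rowP => j; rewrite [RHS]mxE; move: j; apply: (cM (fun j => row i (kermx M) ord0 j)).
by rewrite -mulmx_sum_row -row_mul mulmx_ker row0.
Qed.

Lemma sub_combP k n (w : 'rV[K]_n) (M : 'M[K]_(k, n)) :
  (w <= M)%MS <-> exists c : 'I_k -> K, w = \sum_i c i *: row i M.
Proof.
split=> [/submxP [c ->]|[c ->]].
  by exists (fun i => c ord0 i); rewrite mulmx_sum_row.
by apply: summx_sub => i _; apply: scalemx_sub; apply: row_sub.
Qed.

(** A free family taken from [B] has at most [n] members, so a longest one exists, and a vector of
    [B] outside its span would lengthen it. This turns tangent spaces and sets of gradients, given
    only as sets, into matrices. *)
Lemma finite_span n (B : set 'rV[K]_n) :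
  exists (r : nat) (M : 'M[K]_(r, n)),
    [/\ row_free M, forall i, B (row i M) & forall b, B b -> (b <= M)%MS].
Proof.
pose P r := `[< exists M : 'M[K]_(r, n), row_free M /\ forall i, B (row i M) >].
have P0 : exists r, P r.
  exists 0%N; apply/asboolP; exists 0; split; last by case.
  by rewrite /row_free mxrank0.
have Pn r : P r -> (r <= n)%N.
  by move=> /asboolP[M [/eqP rM _]]; have := rank_leq_col M; rewrite rM.
case: (ex_maxnP P0 Pn) => r /asboolP [M [Mf MB]] rmax.
exists r, M; split=> // b Bb; apply: contraT => bM.
suff /rmax : P r.+1 by rewrite ltnn.
apply/asboolP; rewrite -[r.+1]add1n; exists (col_mx b M); split.
  have b0 : b != 0 by apply: contraNneq bM => ->; apply: sub0mx.
  (* The span of [b] has dimension one, so it either lies in the span of [M] or meets it in zero. *)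
  have bM0 : (b :&: M)%MS = 0.
    apply/eqP; rewrite -mxrank_eq0 -leqn0 -ltnS.
    rewrite (leq_trans _ (rank_leq_row b)) //.
    rewrite ltn_neqAle mxrankS ?capmxSl // andbT.
    apply: contraNneq bM => rb.
    have /eqmxP : (b :&: M == b)%MS by rewrite -mxrank_leqif_eq ?capmxSl ?rb.
    by move=> <-; apply: capmxSr.
  have := mxrank_sum_cap b M; rewrite bM0 mxrank0 addn0 addsmxE => e.
  by rewrite /row_free e rank_rV b0 (eqP Mf).
move=> i; case: (splitP i) => j ij.
  have -> : i = lshift r j by apply: val_inj.
  by rewrite rowKu (ord1 j) row_id.
have -> : i = rshift 1 j by apply: val_inj.
by rewrite rowKd.
Qed.

Section Families.
Variables (E : Type) (E' : lmodType K) (A : set E) (L : E -> E').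

Definition indep k (e : 'I_k -> E) :=
  (forall i, A (e i)) /\
  forall c : 'I_k -> K, \sum_i c i *: L (e i) = 0 -> forall i, c i = 0.

Lemma indep_leq_rank r k (e : 'I_k -> E) :
  has_rank A L r -> indep e -> (k <= r)%N.
Proof.
move=> [f [fA _ fgen]] [eA eind].
have /choice [M Me] : forall i, exists c : 'I_r -> K, L (e i) = \sum_j c j *: L (f j).
  by move=> i; apply: fgen.
pose M' := \matrix_(i, j) M i j.
suff /eqP rM : row_free M' by have := rank_leq_col M'; rewrite rM.
apply/row_free_combP => c c0; apply: eind.
under eq_bigr => i _ do rewrite Me scaler_sumr.
rewrite exchange_big big1 //= => j _.
under eq_bigr => i _ do rewrite scalerA.
rewrite -scaler_suml.
have := congr1 (fun u : 'rV_r => u ord0 j) c0; rewrite summxE [in RHS]mxE => c0j.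
rewrite (_ : \sum_i _ = 0) ?scale0r //; rewrite -[RHS]c0j.
by apply: eq_bigr => i _; rewrite !mxE.
Qed.

Lemma has_rank_indep r : has_rank A L r -> exists e : 'I_r -> E, indep e.
Proof. by move=> [e [eA eind _]]; exists e. Qed.

Lemma rkE r : has_rank A L r -> rk A L = r.
Proof.
move=> h; apply/eqP; rewrite eqn_leq.
have h' : has_rank A L (rk A L) by apply: (xgetPex 0%N); exists r.
have [e1 i1] := has_rank_indep h; have [e2 i2] := has_rank_indep h'.
by rewrite (indep_leq_rank h i2) (indep_leq_rank h' i1).
Qed.

(** [rk] takes the default value 0 when no basis exists. A bound on independent families excludes
    this: a longest one is a basis. *)
Lemma has_rank_bounded n :
  (forall k (e : 'I_k -> E), indep e -> (k <= n)%N) -> has_rank A L (rk A L).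
Proof.
move=> bnd; suff [r h] : exists r, has_rank A L r by rewrite (rkE h).
pose P r := `[< exists e : 'I_r -> E, indep e >].
have P0 : exists r, P r.
  exists 0%N; apply/asboolP.
  by exists (fun i : 'I_0 => match notF (ltn_ord i) with end); split=> [[]|c _ []].
have Pn r : P r -> (r <= n)%N by move=> /asboolP[e /bnd].
case: (ex_maxnP P0 Pn) => r /asboolP [e [eA eind]] rmax.
exists r, e; split=> // a Aa; apply: contrapT => na.
suff /rmax : P r.+1 by rewrite ltnn.
apply/asboolP; exists (fun i => oapp e a (unlift ord0 i)); split.
  by move=> i; case: unliftP => [j|] _ /=.
move=> c; rewrite big_ord_recl unlift_none /=.
under eq_bigr => i _ do rewrite liftK /=.
move=> c0; have c00 : c ord0 = 0.
  apply: contrapT => /eqP cn0; apply: na.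
  exists (fun i => - (c ord0)^-1 * c (lift ord0 i)).
  under eq_bigr => i _ do rewrite -scalerA.
  rewrite -scaler_sumr scaleNr; apply/eqP; rewrite -subr_eq0 opprK.
  rewrite -[X in X + _]scale1r -(mulVf cn0) -scalerA -scalerDr.
  by rewrite c0 scaler0.
move: c0; rewrite c00 scale0r add0r => /eind h i.
by case: (unliftP ord0 i) => [j|] ->.
Qed.

End Families.

(** If the first map has no finite rank its [rk] is the default 0, so only the second rank has to be
    genuine. *)
Lemma rk_leq (E1 E2 : Type) (F1 F2 : lmodType K) (A1 : set E1) (A2 : set E2)
    (L1 : E1 -> F1) (L2 : E2 -> F2) :
  has_rank A2 L2 (rk A2 L2) ->
  (forall k (e : 'I_k -> E1), indep A1 L1 e -> exists e' : 'I_k -> E2, indep A2 L2 e') ->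
  (rk A1 L1 <= rk A2 L2)%N.
Proof.
move=> h2 h; have [->//|r0] := eqVneq (rk A1 L1) 0%N.
have h1 : has_rank A1 L1 (rk A1 L1).
  apply: (xgetPex 0%N); apply: contrapT => nr; move/eqP: r0; apply.
  by apply: xgetPN => r hr; apply: nr; exists r.
have [e /h [e' ie']] := has_rank_indep h1.
exact: indep_leq_rank h2 ie'.
Qed.

Lemma has_rank_rV (E : Type) n (A : set E) (L : E -> 'rV[K]_n) :
  has_rank A L (rk A L).
Proof.
apply: (@has_rank_bounded _ _ A L n) => k e [_ eind].
suff /eqP rM : row_free (\matrix_i L (e i)).
  by have := rank_leq_col (\matrix_i L (e i)); rewrite rM.
apply/row_free_combP => c c0; apply: eind; rewrite -[RHS]c0.
by apply: eq_bigr => i _; rewrite rowK.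
Qed.

Lemma rk_rV (E : Type) n k (A : set E) (L : E -> 'rV[K]_n) (S : 'M[K]_(k, n)) :
  (forall a, A a -> (L a <= S)%MS) ->
  (forall w, (w <= S)%MS -> exists2 a, A a & L a = w) -> rk A L = \rank S.
Proof.
move=> AS SA; apply: rkE.
have /choice [e eP] : forall i, exists a, A a /\ L a = row i (row_base S).
  move=> i; have [|a Aa La] := SA (row i (row_base S)); last by exists a.
  by rewrite -(eq_row_base S) row_sub.
exists e; split=> [i|c|a Aa]; first by case: (eP i).
  under eq_bigr => i _ do rewrite (proj2 (eP i)).
  by apply/row_free_combP/row_base_free.
have := AS a Aa; rewrite -(eq_row_base S) => /sub_combP [c ->]; exists c.
by apply: eq_bigr => i _; rewrite (proj2 (eP i)).
Qed.

(** Rank depends only on the linear relations among the values. Ranks of maps into function spaces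
    are computed through this in row vectors. *)
Lemma rk_mirror (E1 : Type) n (F2 : lmodType K) (A : set E1)
    (L1 : E1 -> 'rV[K]_n) (L2 : E1 -> F2) :
  (forall k (e : 'I_k -> E1) (c : 'I_k -> K), (forall i, A (e i)) ->
     \sum_i c i *: L1 (e i) = 0 <-> \sum_i c i *: L2 (e i) = 0) ->
  rk A L2 = rk A L1.
Proof.
move=> m12.
have i12 k (e : 'I_k -> E1) : indep A L1 e <-> indep A L2 e.
  by split=> -[eA ei]; split=> // c /(m12 _ _ _ eA); apply: ei.
have h1 := has_rank_rV A L1.
have h2 : has_rank A L2 (rk A L2).
  apply: (@has_rank_bounded _ _ A L2 (rk A L1)) => k e /i12.
  exact: indep_leq_rank.
by apply/eqP; rewrite eqn_leq !rk_leq // => k e /i12 h; exists e.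
Qed.

End RankLemmas.

(** * Gradients and restriction to lines *)

Lemma mpoly_ring_ind (R : comNzRingType) n (P : {mpoly R[n]} -> Prop) :
  (forall c, P c%:MP) -> (forall i, P 'X_i) ->
  (forall p q, P p -> P q -> P (p + q)) ->
  (forall p q, P p -> P q -> P (p * q)) -> forall p, P p.
Proof.
move=> PC PX PD PM; apply: mpolyind => [|c m p _ _ Pp]; first by rewrite -mpolyC0.
apply: PD => //; rewrite -mul_mpolyC; apply: (PM) => //.
rewrite mpolyXE_id; have P1 : P 1 by have := PC 1; rewrite mpolyC1.
apply: big_ind => [|p1 q1|i _]; [exact: P1|exact: PM|].
elim: (m i) => [|k Pk]; first by rewrite expr0.
by rewrite exprS; apply: (PM).
Qed.

Section Gradient.
Variables (R : comNzRingType) (n : nat).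
Implicit Types (p q : {mpoly R[n]}) (u w : 'rV[R]_n).

Definition grad p u w : R := \sum_i p^`M(i).@[u ord0] * w ord0 i.

Lemma gradC c u w : grad c%:MP u w = 0.
Proof. by rewrite /grad big1 // => i _; rewrite mderivC meval0 mul0r. Qed.

Lemma gradX i u w : grad 'X_i u w = w ord0 i.
Proof.
rewrite /grad (bigD1 i) //= big1 => [|j ji].
  rewrite mderivX mnm1E eqxx scale1r.
  have -> : (U_(i) - U_(i) = 0)%MM by apply/mnmP => j; rewrite mnmBE mnm0E subnn.
  by rewrite mpolyX0 meval1 mul1r addr0.
by rewrite mderivX mnm1E eq_sym (negPf ji) scale0r meval0 mul0r.
Qed.

Lemma gradD p q u w : grad (p + q) u w = grad p u w + grad q u w.
Proof.
rewrite /grad -big_split; apply: eq_bigr => i _ /=.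
by rewrite mderivD mevalD mulrDl.
Qed.

Lemma gradZ c p u w : grad (c *: p) u w = c * grad p u w.
Proof.
rewrite /grad mulr_sumr; apply: eq_bigr => i _ /=.
by rewrite mderivZ mevalZ mulrA.
Qed.

Lemma gradN p u w : grad (- p) u w = - grad p u w.
Proof. by rewrite -scaleN1r gradZ mulN1r. Qed.

Lemma gradM p q u w :
  grad (p * q) u w = p.@[u ord0] * grad q u w + q.@[u ord0] * grad p u w.
Proof.
rewrite /grad !mulr_sumr -big_split; apply: eq_bigr => i _ /=.
by rewrite mderivM mevalD !mevalM; ring.
Qed.

Lemma grad_comb p u a w w' : grad p u (a *: w + w') = a * grad p u w + grad p u w'.
Proof.
rewrite /grad mulr_sumr -big_split; apply: eq_bigr => i _ /=.
by rewrite !mxE; ring.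
Qed.

End Gradient.

Section Line.
Variable K : closedFieldType.

Lemma closed_poly0 (q : {poly K}) : (forall c, q.[c] = 0) -> q = 0.
Proof.
move=> q0; apply/eqP; apply: contraT => /closed_nonrootP [c].
by rewrite /root q0 eqxx.
Qed.

(** Restricting [p] to the line through [u] in direction [w] gives a univariate polynomial, whose
    derivative at 0 is the directional derivative. The field being infinite, pointwise vanishing on
    the line will kill this polynomial, hence the gradient. *)
Lemma line_poly n (p : {mpoly K[n]}) (u w : 'rV[K]_n) :
  exists q : {poly K}, (forall c, q.[c] = p.@[(u + c *: w) ord0]) /\
    q^`().[0] = grad p u w.
Proof.
elim/mpoly_ring_ind: p => [c|i|p q [f [fE f']] [g [gE g']]|p q [f [fE f']] [g [gE g']]].
- by exists c%:P; split=> [x|]; rewrite ?derivC ?gradC ?mevalC hornerE.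
- exists ((u ord0 i)%:P + (w ord0 i)%:P * 'X); split=> [x|].
    by rewrite mevalXU !mxE !hornerE mulrC.
  by rewrite gradX derivD derivC derivM derivC derivX !hornerE.
- exists (f + g); split=> [x|]; first by rewrite hornerD fE gE mevalD.
  by rewrite derivD hornerD f' g' gradD.
exists (f * g); split=> [x|]; first by rewrite hornerM fE gE mevalM.
rewrite derivM hornerD !hornerM f' g' fE gE scale0r addr0 gradM; ring.
Qed.

Lemma grad_line0 n (p : {mpoly K[n]}) (u w : 'rV[K]_n) :
  (forall c, p.@[(u + c *: w) ord0] = 0) -> grad p u w = 0.
Proof.
move=> p0; have [q [qE <-]] := line_poly p u w.
have -> : q = 0 by apply: closed_poly0 => c; rewrite qE.
by rewrite deriv0 horner0.
Qed.

(** Two nonempty open subsets of a line meet. This gives the irreducibility of the fibres of the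
    conormal variety. *)
Lemma segment_neq0 n (p q : {mpoly K[n]}) (u w : 'rV[K]_n) :
  p.@[u ord0] != 0 -> q.@[w ord0] != 0 ->
  exists c, p.@[((1 - c) *: u + c *: w) ord0] != 0 /\
            q.@[((1 - c) *: u + c *: w) ord0] != 0.
Proof.
move=> pu qw; have [f [fE _]] := line_poly p u (w - u).
have [g [gE _]] := line_poly q u (w - u).
have f0 : f != 0.
  apply: contraNneq pu => f0; have := fE 0.
  by rewrite f0 horner0 scale0r addr0 => <-.
have g0 : g != 0.
  apply: contraNneq qw => g0; have := gE 1.
  by rewrite g0 horner0 scale1r addrC subrK => <-.
have /closed_nonrootP [c] : f * g != 0 by rewrite mulf_neq0.
rewrite rootM negb_or => /andP[fc gc]; exists c.
have -> : (1 - c) *: u + c *: w = u + c *: (w - u).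
  by rewrite scalerBl scale1r scalerBr addrAC addrA.
by rewrite -fE -gE.
Qed.

End Line.

(** Clearing denominators: the exponent [e] depends on [p] only, so one formula serves at all points
    where [Q] does not vanish. *)
Lemma meval_fraction (K : fieldType) n k (P : 'I_k -> {mpoly K[n]}) (Q : {mpoly K[n]})
    (p : {mpoly K[k]}) :
  exists (r : {mpoly K[n]}) (e : nat), forall u : 'rV[K]_n, Q.@[u ord0] != 0 ->
    p.@[(\row_i ((P i).@[u ord0] / Q.@[u ord0])) ord0] = r.@[u ord0] / Q.@[u ord0] ^+ e.
Proof.
elim/mpoly_ring_ind: p => [c|i|p q [f [d fE]] [g [e gE]]|p q [f [d fE]] [g [e gE]]].
- by exists c%:MP, 0%N => u Qu; rewrite !mevalC expr0 divr1.
- by exists (P i), 1%N => u Qu; rewrite mevalXU mxE expr1.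
- exists (f * Q ^+ e + g * Q ^+ d), (d + e)%N => u Qu.
  rewrite mevalD fE // gE // mevalD !mevalM !rmorphXn /= exprD.
  by field; rewrite !expf_neq0.
exists (f * g), (d + e)%N => u Qu.
rewrite mevalM fE // gE // mevalM exprD.
by field; rewrite !expf_neq0.
Qed.

(** * Extension of derivations *)

Section DerivationExtension.
Variable L : fieldType.
Implicit Types (E F : set L) (D : L -> L).

Definition subring E :=
  [/\ E 1, forall a b, E a -> E b -> E (a - b) & forall a b, E a -> E b -> E (a * b)].

Definition deriv_on E D :=
  (forall a b, E a -> E b -> D (a - b) = D a - D b) /\
  (forall a b, E a -> E b -> D (a * b) = a * D b + b * D a).

Lemma subring0 E : subring E -> E 0.
Proof. by case=> E1 EB _; rewrite -(subrr 1); apply: EB. Qed.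

Lemma subringN E : subring E -> forall a, E a -> E (- a).
Proof. by move=> Er a Ea; have [_ EB _] := Er; rewrite -sub0r; apply: EB => //; apply: subring0. Qed.

Lemma subringD E : subring E -> forall a b, E a -> E b -> E (a + b).
Proof.
move=> Er a b Ea Eb; rewrite -[b]opprK; have [_ EB _] := Er.
by apply: EB => //; apply: subringN.
Qed.

Lemma subring_sum E (I : Type) (r : seq I) (P : pred I) (f : I -> L) :
  subring E -> (forall i, E (f i)) -> E (\sum_(i <- r | P i) f i).
Proof.
move=> Er Ef; apply: (big_ind E) => [|a b|//]; first exact: subring0.
exact: subringD.
Qed.

Lemma der0 E D : subring E -> deriv_on E D -> D 0 = 0.
Proof.
move=> Er [DB _]; have := DB 0 0 (subring0 Er) (subring0 Er).
by rewrite !subrr.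
Qed.

Lemma der1 E D : subring E -> deriv_on E D -> D 1 = 0.
Proof.
move=> [E1 _ _] [_ DM]; have := DM 1 1 E1 E1.
by rewrite !mul1r => /eqP; rewrite -subr_eq0 opprD addrA subrr sub0r oppr_eq0 => /eqP.
Qed.

Lemma derD E D : subring E -> deriv_on E D ->
  forall a b, E a -> E b -> D (a + b) = D a + D b.
Proof.
move=> Er Dd a b Ea Eb; have [DB _] := Dd.
have EN := subringN Er Eb.
rewrite -{1}[b]opprK DB // -[- b]sub0r DB //; last exact: subring0.
by rewrite (der0 Er Dd) sub0r opprK.
Qed.

Lemma der_sum E D (I : Type) (r : seq I) (f : I -> L) :
  subring E -> deriv_on E D -> (forall i, E (f i)) ->
  D (\sum_(i <- r) f i) = \sum_(i <- r) D (f i).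
Proof.
move=> Er Dd Ef; elim: r => [|i r IH]; first by rewrite !big_nil (der0 Er Dd).
by rewrite !big_cons (derD Er Dd) ?IH //; apply: subring_sum.
Qed.

(** A derivation along [ev] descends to the image of [ev] as soon as it kills the kernel; the value
    at [l] is computed on an arbitrary preimage. All derivations below are built in this way, except
    the quotient rule. *)
Lemma deriv_image (R : pzRingType) (A : set R) (ev d : R -> L) :
  (forall p q, A p -> A q -> A (p - q) /\ A (p * q)) ->
  (forall p q, A p -> A q -> ev (p - q) = ev p - ev q) ->
  (forall p q, A p -> A q -> ev (p * q) = ev p * ev q) ->
  (forall p q, A p -> A q -> d (p - q) = d p - d q) ->
  (forall p q, A p -> A q -> d (p * q) = ev p * d q + ev q * d p) ->
  (forall p, A p -> ev p = 0 -> d p = 0) ->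
  exists D, deriv_on (ev @` A) D /\ forall p, A p -> D (ev p) = d p.
Proof.
move=> AR evB evM dB dM d0.
pose D l := d (xget 0 [set p | A p /\ ev p = l]).
have DE p : A p -> D (ev p) = d p.
  move=> Ap; rewrite /D; have [Aq eq] : [set q | A q /\ ev q = ev p] (xget 0 [set q | A q /\ ev q = ev p]).
    by apply: xgetPex; exists p.
  move: (xget _ _) Aq eq => q Aq eq; apply/eqP; rewrite -subr_eq0 -dB //.
  by apply/eqP/d0; [case: (AR q p) | rewrite evB // eq subrr].
exists D; split=> //; split=> _ _ [p Ap <-] [q Aq <-].
  by rewrite -evB // !DE ?dB //; case: (AR p q).
by rewrite -evM // !DE ?dM //; case: (AR p q).
Qed.

Definition fracset E : set L := [set l | exists a b, [/\ E a, E b, b != 0 & l = a / b]].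

Definition subfield E := subring E /\ forall a, E a -> E a^-1.

Lemma sub_frac E : subring E -> E `<=` fracset E.
Proof. by case=> E1 _ _ a Ea; exists a, 1; rewrite oner_eq0 divr1. Qed.

Lemma frac_subfield E : subring E -> subfield (fracset E).
Proof.
move=> Er; have [E1 EB EM] := Er; split; first split.
- exact: sub_frac.
- move=> _ _ [a [b [Ea Eb b0 ->]]] [c [d [Ec Ed d0 ->]]].
  exists (a * d - c * b), (b * d); split; rewrite ?mulf_neq0 //.
  - by apply: (EB); apply: (EM).
  - exact: EM.
  - by field; rewrite b0 d0.
- move=> _ _ [a [b [Ea Eb b0 ->]]] [c [d [Ec Ed d0 ->]]].
  exists (a * c), (b * d); split; rewrite ?mulf_neq0 //; try exact: EM.
  by field; rewrite b0 d0.
- move=> _ [a [b [Ea Eb b0 ->]]]; have [->|a0] := eqVneq a 0.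
    rewrite mul0r invr0; apply: sub_frac => //; exact: subring0.
  by exists b, a; split=> //; rewrite invf_div.
Qed.

(** The extension is the quotient rule; differentiating [a d = c b] shows that it does not depend on
    the fraction chosen. *)
Lemma deriv_frac E D : subring E -> deriv_on E D ->
  exists D', deriv_on (fracset E) D' /\ forall a, E a -> D' a = D a.
Proof.
move=> Er Dd; have [E1 EB EM] := Er; have [DB DM] := Dd.
pose rel l x := exists a b, [/\ E a, E b, b != 0, l = a / b & x = (D a * b - a * D b) / b ^+ 2].
pose D' l := xget 0 [set x | rel l x].
have D'E a b : E a -> E b -> b != 0 -> D' (a / b) = (D a * b - a * D b) / b ^+ 2.
  move=> Ea Eb b0; rewrite /D'.
  have : rel (a / b) (xget 0 [set x | rel (a / b) x]).
    by apply: (xgetPex 0 (P := [set x | rel (a / b) x])); eexists; exists a, b.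
  case=> c [d [Ec Ed d0 abcd ->]].
  have adcb : a * d = c * b.
    by rewrite -[a in LHS](divfK b0) abcd mulrAC divfK.
  have : D (a * d) = D (c * b) by rewrite adcb.
  rewrite !DM // => e.
  apply/eqP; rewrite eqr_div ?expf_neq0 //; apply/eqP.
  have -> : (D c * d - c * D d) * b ^+ 2 = b * d * (b * D c) - (c * b) * b * D d by ring.
  have -> : b * D c = a * D d + d * D a - c * D b by rewrite e; ring.
  rewrite -adcb.
  have -> : b * d * (a * D d + d * D a - c * D b) - a * d * b * D d =
            (d * D a - c * D b) * b * d by ring.
  have -> : (d * D a - c * D b) * b * d = d * D a * b * d - (c * b) * D b * d by ring.
  by rewrite -adcb; ring.
exists D'; split; last first.
  move=> a Ea; rewrite -[a in LHS]divr1 D'E ?oner_eq0 // (der1 Er Dd).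
  by rewrite expr1n mulr0 subr0 mulr1 divr1.
split=> _ _ [a [b [Ea Eb b0 ->]]] [c [d [Ec Ed d0 ->]]].
  have -> : a / b - c / d = (a * d - c * b) / (b * d) by field; rewrite b0 d0.
  rewrite !D'E ?mulf_neq0 //; try exact: EM; last by apply: (EB); apply: (EM).
  rewrite !DB ?DM //; try exact: EM.
  by field; rewrite b0 d0.
have -> : (a / b) * (c / d) = (a * c) / (b * d) by field; rewrite b0 d0.
rewrite !D'E ?mulf_neq0 //; try exact: EM.
by rewrite !DM //; field; rewrite b0 d0.
Qed.

Section Polynomials.
Variables (E : set L) (D : L -> L).
Hypotheses (Er : subring E) (Dd : deriv_on E D).

Let D0 : D 0 = 0 := der0 Er Dd.

(** * Extending a derivation to algebraically independent elements *)

Section Transcendental.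
Variables (r : nat) (b : 'I_r -> L).

Lemma coef_in_ring (p q : {mpoly L[r]}) : coef_in E p -> coef_in E q ->
  coef_in E (p - q) /\ coef_in E (p * q).
Proof.
move=> Ep Eq; have [_ EB EM] := Er; split=> m; first by rewrite mcoeffB; apply: EB.
rewrite mcoeffM; apply: subring_sum => // i; exact: EM.
Qed.

Lemma coef_inC c : E c -> coef_in E (c%:MP : {mpoly L[r]}).
Proof.
move=> Ec m; rewrite mcoeffC; case: (m == _); rewrite ?mulr1 ?mulr0 //.
exact: subring0.
Qed.

(** The candidate extension for which every [b i] is a constant: [D] acts on the coefficients
    only. *)
Let mder (p : {mpoly L[r]}) := \sum_(m <- msupp p) D p@_m * \prod_i b i ^+ m i.

Let mderE (s : seq 'X_{1..r}) (p : {mpoly L[r]}) : uniq s -> {subset msupp p <= s} ->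
  mder p = \sum_(m <- s) D p@_m * \prod_i b i ^+ m i.
Proof.
move=> us ps; rewrite [RHS](bigID (mem (msupp p))) /= [X in _ + X]big1 ?addr0.
  rewrite -big_filter; apply: perm_big; apply: uniq_perm; rewrite ?msupp_uniq ?filter_uniq //.
  by move=> m; rewrite mem_filter; case: (boolP (m \in msupp p)) => // /ps ->.
by move=> m /memN_msupp_eq0 ->; rewrite D0 mul0r.
Qed.

Let mderB (p q : {mpoly L[r]}) : coef_in E p -> coef_in E q -> mder (p - q) = mder p - mder q.
Proof.
move=> Ep Eq; pose s := undup (msupp p ++ msupp q ++ msupp (p - q)).
rewrite !(@mderE s) ?undup_uniq // => [|m|m|m]; rewrite ?mem_undup ?mem_cat;
  try by move=> ->; rewrite ?orbT.
rewrite -sumrB; apply: eq_bigr => m _; rewrite mcoeffB (proj1 Dd) //.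
exact: mulrBl.
Qed.

Let mderD (p q : {mpoly L[r]}) : coef_in E p -> coef_in E q -> mder (p + q) = mder p + mder q.
Proof.
have E0 : coef_in E (0 : {mpoly L[r]}) by rewrite -mpolyC0; apply: coef_inC; apply: subring0.
move=> Ep Eq; rewrite -{1}[q]opprK mderB //; last first.
  by rewrite -sub0r; case: (coef_in_ring E0 Eq).
rewrite -[- q]sub0r mderB //; have -> : mder 0 = 0 by rewrite /mder msupp0 big_nil.
by rewrite sub0r opprK.
Qed.

Let mder_sum (I : Type) (s : seq I) (f : I -> {mpoly L[r]}) : (forall i, coef_in E (f i)) ->
  mder (\sum_(i <- s) f i) = \sum_(i <- s) mder (f i) /\ coef_in E (\sum_(i <- s) f i).
Proof.
move=> Ef; elim: s => [|i s [IH1 IH2]].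
  rewrite !big_nil /mder msupp0 big_nil; split=> // m; rewrite mcoeff0; exact: subring0.
rewrite !big_cons mderD // IH1; split=> // m; rewrite mcoeffD.
by apply: (subringD Er); [apply: Ef | apply: IH2].
Qed.

Let mderZX c m : E c -> mder (c *: 'X_[m]) = D c * \prod_i b i ^+ m i.
Proof.
move=> Ec; rewrite (@mderE [:: m]) // => [|k].
  by rewrite big_seq1 mcoeffZ mcoeffX eqxx mulr1.
by move/msuppZ_le; rewrite msuppX.
Qed.

Let coefZX c m : E c -> coef_in E (c *: 'X_[m] : {mpoly L[r]}).
Proof.
move=> Ec k; rewrite mcoeffZ mcoeffX; case: eqP; rewrite ?mulr1 ?mulr0 // => _.
exact: subring0.
Qed.

Let mderM (p q : {mpoly L[r]}) : coef_in E p -> coef_in E q ->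
  mder (p * q) = p.@[b] * mder q + q.@[b] * mder p.
Proof.
move=> Ep Eq; have [_ _ EM] := Er.
have pqE : p * q = \sum_(m <- msupp p) \sum_(k <- msupp q) (p@_m * q@_k) *: 'X_[m + k].
  rewrite {1}[p]mpolyE {1}[q]mpolyE mulr_suml; apply: eq_bigr => m _.
  rewrite mulr_sumr; apply: eq_bigr => k _.
  by rewrite mpolyXD -scalerAl -scalerAr scalerA.
have ex m : forall k, coef_in E ((p@_m * q@_k) *: 'X_[m + k]) by move=> k; apply/coefZX/EM.
rewrite pqE (proj1 (mder_sum _ _)); last by move=> m; apply: (proj2 (mder_sum _ _)).
transitivity (\sum_(m <- msupp p) (\sum_(k <- msupp q)
    p@_m * D q@_k * (\prod_i b i ^+ m i * \prod_i b i ^+ k i) +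
  \sum_(k <- msupp q) q@_k * D p@_m * (\prod_i b i ^+ m i * \prod_i b i ^+ k i))).
  apply: eq_bigr => m _; rewrite (proj1 (mder_sum _ (ex m))) -big_split.
  apply: eq_bigr => k _; rewrite mderZX; last exact: EM.
  rewrite (proj2 Dd) // /= -mulrDl -big_split /=; congr (_ * _).
  by apply: eq_bigr => i _; rewrite mnmDE exprD.
rewrite big_split /=; congr (_ + _).
  rewrite mevalE mulr_suml; apply: eq_bigr => m _.
  by rewrite /mder mulr_sumr; apply: eq_bigr => k _; ring.
rewrite exchange_big mevalE mulr_suml; apply: eq_bigr => m _.
by rewrite /mder mulr_sumr; apply: eq_bigr => k _; ring.
Qed.

Definition mpoly_values : set L := [set p.@[b] | p in coef_in E (r := r)].

Lemma mpoly_values_subring : subring mpoly_values.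
Proof.
have [E1 _ _] := Er; split; first by exists 1%:MP; rewrite ?mevalC //; apply: coef_inC.
  move=> _ _ [p Ep <-] [q Eq <-]; exists (p - q); rewrite ?mevalB //.
  by case: (coef_in_ring Ep Eq).
move=> _ _ [p Ep <-] [q Eq <-]; exists (p * q); rewrite ?mevalM //.
by case: (coef_in_ring Ep Eq).
Qed.

Lemma mpoly_valuesC : E `<=` mpoly_values.
Proof. by move=> c Ec; exists c%:MP; rewrite ?mevalC //; apply: coef_inC. Qed.

Lemma frac_mpoly_values : fracset mpoly_values = adjoin E b.
Proof.
apply/seteqP; split=> [l [_ [_ [[p Ep <-] [q Eq <-] q0 ->]]]|l [p [q [Ep Eq q0 ->]]]].
  by exists p, q.
by exists p.@[b], q.@[b]; split=> //; [exists p|exists q].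
Qed.

(** Algebraic independence makes evaluation at [b] injective on polynomials over [E], so [mder]
    trivially respects its kernel and descends. *)
Lemma deriv_transcendental : alg_independent E b ->
  exists D', deriv_on mpoly_values D' /\ forall a, E a -> D' a = D a.
Proof.
move=> bind; have [|||||p Ep p0|D' [D'd D'E]] := @deriv_image _ (coef_in E (r := r)) (meval b) mder.
- exact: coef_in_ring.
- by move=> p q _ _; apply: mevalB.
- by move=> p q _ _; apply: mevalM.
- exact: mderB.
- exact: mderM.
- by rewrite (bind p Ep p0) /mder msupp0 big_nil.
exists D'; split=> // a Ea; have := D'E a%:MP (coef_inC Ea).
rewrite mevalC => ->; have [->|a0] := eqVneq a 0.
  by rewrite mpolyC0 /mder msupp0 big_nil D0.
rewrite /mder msuppC (negPf a0) big_seq1 mcoeffC eqxx mulr1.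
by rewrite big1 ?mulr1 // => i _; rewrite mnm0E expr0.
Qed.

End Transcendental.
End Polynomials.

(** * Extending a derivation to a separable algebraic element *)

Section Algebraic.
Variables (l : L).

Definition poly_over E (g : {poly L}) : Prop := forall i, E g`_i.

Definition poly_values E : set L := [set g.[l] | g in poly_over E].

Lemma poly_over_ring E (g h : {poly L}) : subring E -> poly_over E g -> poly_over E h ->
  poly_over E (g - h) /\ poly_over E (g * h).
Proof.
move=> Er Eg Eh; have [_ EB EM] := Er; split=> i; first by rewrite coefB; apply: EB.
rewrite coefM; apply: subring_sum => // j; exact: EM.
Qed.

Lemma poly_overCX E (c : L) n : subring E -> E c -> poly_over E (c%:P * 'X^n).
Proof.
move=> Er Ec i; rewrite coefCM coefXn; case: (_ == _); rewrite ?mulr1 ?mulr0 //.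
exact: subring0.
Qed.

Lemma poly_values_subring E : subring E -> subring (poly_values E).
Proof.
move=> Er; have [E1 _ _] := Er; split.
- exists (1%:P * 'X^0); first exact: poly_overCX.
  by rewrite expr0 mulr1 hornerC.
- move=> _ _ [g Eg <-] [h Eh <-]; exists (g - h); last by rewrite hornerD hornerN.
  by case: (poly_over_ring Er Eg Eh).
- move=> _ _ [g Eg <-] [h Eh <-]; exists (g * h); last by rewrite hornerM.
  by case: (poly_over_ring Er Eg Eh).
Qed.

Lemma poly_valuesC E : subring E -> E `<=` poly_values E.
Proof.
move=> Er c Ec; exists (c%:P * 'X^0); first exact: poly_overCX.
by rewrite expr0 mulr1 hornerC.
Qed.

Lemma poly_valuesX E : subring E -> poly_values E l.
Proof.
move=> Er; exists (1%:P * 'X^1); last by rewrite mul1r expr1 hornerX.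
by apply: poly_overCX => //; case: Er.
Qed.

Lemma poly_over_map_deriv E D (g h : {poly L}) : subring E -> deriv_on E D ->
  poly_over E g -> poly_over E h ->
  map_poly D (g - h) = map_poly D g - map_poly D h /\
  map_poly D (g * h) = g * map_poly D h + h * map_poly D g.
Proof.
move=> Er Dd Eg Eh; have D0 := der0 Er Dd; have [_ _ EM] := Er.
split; apply/polyP => i; first by rewrite coefB !coef_map_id0 // coefB (proj1 Dd).
rewrite [h * _]mulrC coefD !coefM coef_map_id0 // coefM.
rewrite (der_sum _ Er Dd) => [|j]; last exact: EM.
rewrite -big_split; apply: eq_bigr => j _ /=.
by rewrite (proj2 Dd) // !coef_map_id0 // [h`_ _ * _]mulrC.
Qed.

(* The value at [l] of the derivation of [E[X]] extending [D] with [X |-> w]. *)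
Definition poly_der D (w : L) (g : {poly L}) : L := (map_poly D g).[l] + g^`().[l] * w.

Lemma poly_derB E D w (g h : {poly L}) : subring E -> deriv_on E D ->
  poly_over E g -> poly_over E h -> poly_der D w (g - h) = poly_der D w g - poly_der D w h.
Proof.
move=> Er Dd Eg Eh; rewrite /poly_der (proj1 (poly_over_map_deriv Er Dd Eg Eh)).
by rewrite derivB !hornerD !hornerN; ring.
Qed.

Lemma poly_derM E D w (g h : {poly L}) : subring E -> deriv_on E D ->
  poly_over E g -> poly_over E h ->
  poly_der D w (g * h) = g.[l] * poly_der D w h + h.[l] * poly_der D w g.
Proof.
move=> Er Dd Eg Eh; rewrite /poly_der (proj2 (poly_over_map_deriv Er Dd Eg Eh)).
by rewrite derivM !hornerD !hornerM; ring.
Qed.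

Lemma size_sub_lead (g h : {poly L}) : size h = size g -> lead_coef h = lead_coef g ->
  g != 0 -> (size (g - h)%R < size g)%N.
Proof.
move=> hs hl; rewrite -size_poly_gt0 => g1; rewrite -(prednK g1) ltnS.
apply/leq_sizeP => j; rewrite leq_eqVlt => /predU1P [<-|].
  by move: hl; rewrite coefB /lead_coef hs => ->; rewrite subrr.
by rewrite (prednK g1) => gj; rewrite coefB !nth_default ?subrr // hs.
Qed.

(** Relations satisfied by [l] are multiples of the minimal polynomial [f], and by Leibniz a
    derivation killing [f] kills its multiples at the root [l]. The Euclidean division is carried
    out as an induction on the size of [g]. *)
Lemma poly_der_eq0 E D w (f : {poly L}) : subfield E -> deriv_on E D ->
  poly_over E f -> root f l -> f != 0 ->
  (forall g : {poly L}, poly_over E g -> root g l -> g != 0 -> (size f <= size g)%N) ->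
  poly_der D w f = 0 ->
  forall g : {poly L}, poly_over E g -> g.[l] = 0 -> poly_der D w g = 0.
Proof.
move=> [Er EV] Dd Ef rf f0 fmin df g; have [_ EB EM] := Er.
have [s] := ubnP (size g); elim: s g => // s IH g /ltnSE gs Eg gl.
have [->|g0] := eqVneq g 0.
  by rewrite /poly_der map_poly0 deriv0 !horner0 mul0r addr0.
have fg : (size f <= size g)%N by apply: fmin => //; apply/eqP.
(* One step of long division: [q * f] has the leading term of [g]. *)
pose q : {poly L} := (lead_coef g / lead_coef f)%:P * 'X^(size g - size f).
have Eq : poly_over E q.
  by apply: poly_overCX => //; apply: EM; [apply: Eg | apply: EV; apply: Ef].
have [_ Eqf] := poly_over_ring Er Eq Ef.
have [Egq _] := poly_over_ring Er Eg Eqf.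
have := poly_derB w Er Dd Eg Eqf.
rewrite (poly_derM w Er Dd Eq Ef) df mulr0 (eqP rf) mul0r addr0 subr0 => <-.
apply: IH => //; last by rewrite hornerD hornerN hornerM (eqP rf) gl mulr0 subr0.
apply: leq_trans gs; apply: size_sub_lead => //.
  by rewrite -mulrA mul_polyC size_scale ?mulf_neq0 ?invr_eq0 ?lead_coef_eq0 //
             mulrC size_mulXn // subnK.
by rewrite !lead_coefM lead_coefC lead_coefXn mulr1 divfK ?lead_coef_eq0.
Qed.

(* A separable polynomial killing [l] has nonzero derivative at [l]; so does the minimal one, by *)
(* the previous lemma applied to [D = 0]. *)
Lemma deriv_separable E D : subfield E -> deriv_on E D -> separable_over E l ->
  exists D', deriv_on (poly_values E) D' /\ forall a, E a -> D' a = D a.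
Proof.
move=> [Er EV] Dd [p [Ep psep pl]].
have p0 := separable.separable_poly_neq0 psep; move: psep; rewrite separable.separable_poly.unlock => psep.
pose P n := `[< exists g : {poly L}, [/\ poly_over E g, root g l, g != 0 & size g = n] >].
have exP : exists n, P n by exists (size p); apply/asboolP; exists p.
case: (ex_minnP exP) => _ /asboolP [f [Ef fl f0 <-]] fmin'.
have fmin (g : {poly L}) : poly_over E g -> root g l -> g != 0 -> (size f <= size g)%N.
  by move=> Eg gl g0; apply: fmin'; apply/asboolP; exists g.
have fl' : f^`().[l] != 0.
  apply/eqP => fl'.
  have D0 : deriv_on E (fun=> 0) by split=> a b _ _; rewrite ?subrr // !mulr0 addr0.
  have map0 (g : {poly L}) : map_poly (fun=> 0 : L) g = 0.
    by apply/polyP => i; rewrite coef_map_id0 // coef0.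
  (* With zero derivation and [w = 1], [poly_der] is the formal derivative at [l]. If it killed [f]
     it would kill [p], making [l] a common root of [p] and its derivative. *)
  have := poly_der_eq0 (conj Er EV) D0 Ef fl f0 fmin (w := 1).
  rewrite /poly_der map0 horner0 add0r fl' mul0r => /(_ erefl p Ep (eqP pl)).
  rewrite map0 horner0 add0r mulr1 => pl'.
  by have := coprimep_root psep pl; rewrite pl' eqxx.
(* The only possible value of the extension at [l], found by differentiating [f.[l] = 0]. *)
pose w := - (map_poly D f).[l] / f^`().[l].
have df : poly_der D w f = 0 by rewrite /poly_der /w mulrC divfK // subrr.
have [|||||g Eg gl|D' [D'd D'E]] := @deriv_image _ (poly_over E) (fun g => g.[l]) (poly_der D w).
- by move=> g h; apply: poly_over_ring.
- by move=> g h _ _; rewrite hornerD hornerN.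
- by move=> g h _ _; rewrite hornerM.
- by move=> g h; apply: poly_derB.
- by move=> g h; apply: poly_derM.
- exact: (poly_der_eq0 (conj Er EV) Dd Ef fl f0 fmin df Eg gl).
exists D'; split=> // a Ea; have := D'E _ (poly_overCX 0 Er Ea).
rewrite expr0 mulr1 hornerC => ->; rewrite /poly_der derivC horner0 mul0r addr0.
have -> : map_poly D a%:P = (D a)%:P.
  by apply/polyP => i; rewrite coef_map_id0 ?(der0 Er Dd) // !coefC; case: eqP => // _; apply: der0 Dd.
by rewrite hornerC.
Qed.

End Algebraic.

(** Only finitely many elements are ever differentiated, so no limit over the whole of [L] is taken:
    the separating transcendence basis is adjoined first, then the members of [s] one at a time,
    each separable over the larger field. *)
Lemma deriv_extension F D r (b : 'I_r -> L) (s : seq L) :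
  subring F -> deriv_on F D -> alg_independent F b ->
  (forall l, separable_over (adjoin F b) l) ->
  exists E D', [/\ subring E, deriv_on E D', F `<=` E, (forall y, y \in s -> E y)
                & forall a, F a -> D' a = D a].
Proof.
move=> Fr Dd bind bsep.
suff [E [D' [[Er EV] D'd EF Es D'E]]] : exists E D', [/\ subfield E, deriv_on E D',
    adjoin F b `<=` E, (forall y, y \in s -> E y) & forall a, F a -> D' a = D a].
  exists E, D'; split=> // a Fa; apply: EF; rewrite -frac_mpoly_values.
  by apply: sub_frac; [exact: mpoly_values_subring | exact: mpoly_valuesC].
elim: s => [|l s [E [D1 [Ef D1d EF Es D1E]]]].
  have [D1 [D1d D1E]] := deriv_transcendental Fr Dd bind.
  have [D2 [D2d D2E]] := deriv_frac (mpoly_values_subring Fr b) D1d.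
  rewrite -frac_mpoly_values; exists (fracset (mpoly_values F b)), D2; split=> //.
    by apply: frac_subfield; apply: mpoly_values_subring.
  by move=> a Fa; rewrite D2E ?D1E //; apply: mpoly_valuesC.
have [p [pE psep pl]] := bsep l.
have lsep : separable_over E l by exists p; split=> // i; apply/EF/pE.
have [Er _] := Ef; have [D2 [D2d D2E]] := deriv_separable Ef D1d lsep.
have Vr := poly_values_subring l Er.
have [D3 [D3d D3E]] := deriv_frac Vr D2d.
have EV : E `<=` fracset (poly_values l E).
  by move=> a Ea; apply: sub_frac => //; apply: poly_valuesC.
exists (fracset (poly_values l E)), D3; split=> //.
- exact: frac_subfield.
- by move=> a /EF /EV.
- move=> y; rewrite inE => /predU1P [->|/Es /EV //].
  by apply: sub_frac => //; apply: poly_valuesX.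
move=> a Fa; have Ea : E a.
  apply: EF; rewrite -frac_mpoly_values.
  by apply: sub_frac; [exact: mpoly_values_subring | exact: mpoly_valuesC].
by rewrite D3E ?D2E ?D1E //; apply: poly_valuesC.
Qed.

End DerivationExtension.

(** * Zariski topology, charts and regular functions *)

Section Topology.
Variables (K : closedFieldType) (T : Defs.space K).
Implicit Types (A U Z : set T) (z : T).

Lemma zopen_nbhd U z u : zopen U -> U z -> coords u z ->
  exists r : {mpoly K[ncoord T]}, r.@[u ord0] != 0 /\
    forall u' z', coords u' z' -> r.@[u' ord0] != 0 -> U z'.
Proof.
move=> [F FU] Uz uz.
have [r [Fr ru]] : exists r, F r /\ r.@[u ord0] != 0.
  apply: contrapT => nF; have /(_ uz)[_] := FU u z; apply=> // p Fp.
  by apply: contrapT => /eqP pu; apply: nF; exists p.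
exists r; split=> // u' z' uz' ru'; apply: contrapT => /(FU u' z' uz').1 /(_ r Fr).
by apply/eqP.
Qed.

Lemma zopen_fam (F : set {mpoly K[ncoord T]}) U :
  (forall u z, coords u z -> U z <-> exists2 p, F p & p.@[u ord0] != 0) -> zopen U.
Proof.
move=> FU; exists F => u z uz; split=> [nU p Fp|F0 /(FU u z uz) [p /F0 ->]].
  by apply: contrapT => /eqP pu; apply/nU/(FU u z uz); exists p.
by rewrite eqxx.
Qed.

Lemma zopenT : zopen [set: T].
Proof.
apply: (@zopen_fam [set 1]) => u z _; split=> // _.
by exists 1; rewrite // meval1 oner_eq0.
Qed.

Lemma zopenI U1 U2 : zopen U1 -> zopen U2 -> zopen (U1 `&` U2).
Proof.
move=> U1o U2o.
apply: (@zopen_fam [set p | forall u z, coords u z -> p.@[u ord0] != 0 -> U1 z /\ U2 z]).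
move=> u z uz; split=> [[U1z U2z]|[p Fp /(Fp u z uz)] //].
have [r [ru rU]] := zopen_nbhd U1o U1z uz; have [s [su sU]] := zopen_nbhd U2o U2z uz.
exists (r * s) => [u' z' uz'|]; rewrite mevalM mulf_eq0 negb_or; last by rewrite ru su.
by move=> /andP[/(rU u' z' uz') ? /(sU u' z' uz')].
Qed.

Lemma zclosed_setC A : zclosed A -> zopen (~` A).
Proof. by rewrite /zopen setCK. Qed.

Lemma zclosure_sub A : A `<=` zclosure A.
Proof. by move=> a Aa B _; apply. Qed.

Lemma zclosure_meets A U z : zclosure A z -> zopen U -> U z -> exists2 y, A y & U y.
Proof.
move=> Az Uo Uz; apply: contrapT => nU; apply: (Az (~` U)) => //.
by move=> a Aa Ua; apply: nU; exists a.
Qed.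

Lemma irreducible_meets Z U1 U2 : zirreducible Z -> zopen U1 -> zopen U2 ->
  U1 `&` Z !=set0 -> U2 `&` Z !=set0 -> exists z, [/\ Z z, U1 z & U2 z].
Proof.
move=> [_ irr] U1o U2o [a [U1a Za]] [b [U2b Zb]]; apply: contrapT => nz.
have [z Zz|/(_ a Za)//|/(_ b Zb)//] := irr (~` U1) (~` U2) U1o U2o.
by apply: contrapT => /not_orP [/contrapT ? /contrapT ?]; apply: nz; exists z.
Qed.

Lemma generally_impl Z (P Q : T -> Prop) :
  generally Z P -> (forall z, Z z -> P z -> Q z) -> generally Z Q.
Proof. by move=> [U [Uo Ud UP]] PQ; exists U; split=> // z Uz Zz; apply/PQ/UP. Qed.

Lemma generallyT Z (P : T -> Prop) : (forall z, Z z -> P z) -> generally Z P.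
Proof.
move=> ZP; exists setT; split=> [|W _ [z [Wz Zz]]|z _]; [exact: zopenT| |exact: ZP].
by exists z.
Qed.

Lemma generally_and Z (P Q : T -> Prop) : generally Z P -> generally Z Q ->
  generally Z (fun z => P z /\ Q z).
Proof.
move=> [U1 [U1o U1d U1P]] [U2 [U2o U2d U2Q]]; exists (U1 `&` U2); split.
- exact: zopenI.
- move=> W Wo WZ; rewrite setIA; apply: U2d; last exact: U1d.
  exact: zopenI.
- by move=> z [U1z U2z] Zz; split; [apply: U1P | apply: U2Q].
Qed.

Lemma generally_fin Z n (P : 'I_n -> T -> Prop) : (forall i, generally Z (P i)) ->
  generally Z (fun z => forall i, P i z).
Proof.
elim: n P => [|n IH] P PP; first by apply: generallyT => z _ [].
have := generally_and (PP ord0) (IH (fun i => P (lift ord0 i)) (fun i => PP _)).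
move=> /generally_impl; apply=> z _ [P0 PS] i.
by case: (unliftP ord0 i) => [j|] ->.
Qed.

Lemma generally_ex Z (P : T -> Prop) : Z !=set0 -> generally Z P -> exists2 z, Z z & P z.
Proof.
move=> [z Zz] [U [Uo Ud UP]].
have [|y [[_ Uy] Zy]] := Ud setT zopenT; first by exists z.
by exists y => //; apply: UP.
Qed.

Lemma locally_and Z z (P Q : T -> Prop) : locally Z z P -> locally Z z Q ->
  locally Z z (fun y => P y /\ Q y).
Proof.
move=> [U [Uo Uz UP]] [V [Vo Vz VQ]]; exists (U `&` V); split=> //; first exact: zopenI.
by move=> y [Uy Vy] Zy; split; [apply: UP | apply: VQ].
Qed.

Lemma locally_impl Z z (P Q : T -> Prop) : locally Z z P ->
  (forall y, Z y -> P y -> Q y) -> locally Z z Q.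
Proof. by move=> [U [Uo Uz UP]] PQ; exists U; split=> // y Uy Zy; apply/PQ/UP. Qed.

Lemma locally_at Z z (P : T -> Prop) : locally Z z P -> Z z -> P z.
Proof. by move=> [U [_ Uz UP]]; apply: UP. Qed.

Lemma locallyT Z z (P : T -> Prop) : (forall y, Z y -> P y) -> locally Z z P.
Proof. by move=> ZP; exists setT; split=> [||y _]; [exact: zopenT | | exact: ZP]. Qed.

Lemma locally_open Z z U : zopen U -> U z -> locally Z z U.
Proof. by move=> Uo Uz; exists U; split. Qed.

Lemma locally_fin Z z n (P : 'I_n -> T -> Prop) : (forall i, locally Z z (P i)) ->
  locally Z z (fun y => forall i, P i y).
Proof.
elim: n P => [|n IH] P PP; first by apply: locallyT => y _ [].
have := locally_and (PP ord0) (IH (fun i => P (lift ord0 i)) (fun i => PP _)).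
move=> /locally_impl; apply=> y _ [P0 PS] i.
by case: (unliftP ord0 i) => [j|] ->.
Qed.

Lemma irreducible_generally Z z (P : T -> Prop) : zirreducible Z -> Z z ->
  locally Z z P -> generally Z P.
Proof.
move=> Zi Zz [U [Uo Uz UP]]; exists U; split=> // W Wo WZ.
have [|y [Zy Wy Uy]] := irreducible_meets Zi Wo Uo WZ; first by exists z.
by exists y.
Qed.

Lemma has_dim_uniq Z d d' : has_dim Z d -> has_dim Z d' -> d = d'.
Proof.
have chain_le e e' : (e <= e')%N -> irr_chain Z e' -> irr_chain Z e.
  move=> ee' [C [C1 C2]]; exists C; split=> i ie; [apply: C1|apply: C2].
    exact: leq_trans ie ee'.
  exact: leq_trans ie ee'.
move=> [d1 d2] [d1' d2']; case: (ltngtP d d') => // h.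
  by case: d2; apply: chain_le d1'.
by case: d2'; apply: chain_le d1.
Qed.

(* A chart of [T]: a normalized coordinate vector [nu z] of each point [z] of the open set on *)
(* which [Q] does not vanish, depending rationally on the coordinates. *)
Definition chart (nu : T -> 'rV[K]_(ncoord T)) (Q : {mpoly K[ncoord T]}) :=
  [/\ forall u z, coords u z -> Q.@[u ord0] != 0 -> coords (nu z) z,
      exists P : 'I_(ncoord T) -> {mpoly K[ncoord T]}, forall u z,
        coords u z -> Q.@[u ord0] != 0 -> nu z = \row_i ((P i).@[u ord0] / Q.@[u ord0])
    & forall u u' z, coords u z -> coords u' z -> Q.@[u ord0] != 0 -> Q.@[u' ord0] != 0].

Definition chart_dom (Q : {mpoly K[ncoord T]}) : set T :=
  [set z | exists2 u, coords u z & Q.@[u ord0] != 0].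

(** The second clause allows a chart through any prescribed coordinate vector. It is what transports
    a local fraction given at one coordinate vector of [z] to every other one. *)
Definition charted :=
  (forall z, exists u, coords u z) /\
  (forall u z, coords u z -> exists nu Q, [/\ chart nu Q, Q.@[u ord0] != 0 & nu z = u]).

Section Charts.
Variables (nu : T -> 'rV[K]_(ncoord T)) (Q : {mpoly K[ncoord T]}).
Hypothesis nuQ : chart nu Q.

Lemma chart_coords z : chart_dom Q z -> coords (nu z) z.
Proof. by case: nuQ => h _ _ [u uz Qu]; apply: h uz Qu. Qed.

Lemma chart_neq0 z u : chart_dom Q z -> coords u z -> Q.@[u ord0] != 0.
Proof. by case: nuQ => _ _ h [u' uz' Qu'] uz; apply: h uz' uz Qu'. Qed.

Lemma chart_fraction p : exists (r : {mpoly K[ncoord T]}) e, forall u z, coords u z ->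
  Q.@[u ord0] != 0 -> p.@[nu z ord0] = r.@[u ord0] / Q.@[u ord0] ^+ e.
Proof.
case: nuQ => _ [P PE] _; have [r [e re]] := meval_fraction P Q p.
by exists r, e => u z uz Qu; rewrite (PE u z uz Qu) re.
Qed.

Lemma zopen_chart q : zopen [set z | chart_dom Q z /\ q.@[nu z ord0] != 0].
Proof.
have [r [e re]] := chart_fraction q.
apply: (@zopen_fam [set Q * r]) => u z uz; split.
  move=> [zQ qz]; exists (Q * r) => //; have Qu := chart_neq0 zQ uz.
  rewrite mevalM mulf_neq0 //; move: qz; rewrite (re u z uz Qu).
  by apply: contraNneq => ->; rewrite mul0r.
move=> [_ -> ]; rewrite mevalM mulf_eq0 negb_or => /andP[Qu ru].
by split; [exists u | rewrite (re u z uz Qu) mulf_neq0 // invr_neq0 // expf_neq0].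
Qed.

Lemma zopen_chart_dom : zopen (chart_dom Q).
Proof.
have := zopen_chart 1; congr zopen; apply/seteqP; split=> z /=; first by case.
by split=> //; rewrite meval1 oner_eq0.
Qed.

End Charts.

(** * Regular functions and regular matrices *)

Section Regular.
Hypothesis Tc : charted.
Implicit Types (f g : T -> K).

(** [regular_at] supplies a fraction at one coordinate vector only. Composing it with a chart
    through that vector gives an expression in the point itself, which is again a fraction in any
    coordinates. *)
Lemma regular_coord Z f z u : regular_at Z f z -> coords u z ->
  exists p q : {mpoly K[ncoord T]}, q.@[u ord0] != 0 /\
    forall u' z', coords u' z' -> Z z' -> q.@[u' ord0] != 0 ->
      f z' = p.@[u' ord0] / q.@[u' ord0].
Proof.
move=> [p [q [u1 [uz1 qu1 fE]]]] uz.
have [nu [Q [nuQ Qu1 nuz]]] := Tc.2 u1 z uz1.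
have zQ : chart_dom Q z by exists u1.
have [r [d rE]] := chart_fraction nuQ p; have [s [e sE]] := chart_fraction nuQ q.
have Qu := chart_neq0 nuQ zQ uz.
(* The exponents are one larger than cross-multiplication requires, so that a nonzero denominator
   forces [Q] to be nonzero even when [d = 0]. *)
exists (r * Q ^+ e.+1), (s * Q ^+ d.+1); split.
  rewrite mevalM rmorphXn /= mulf_neq0 ?expf_neq0 //.
  have := sE u z uz Qu; rewrite nuz => e1; move: qu1; rewrite e1.
  by apply: contraNneq => ->; rewrite mul0r.
move=> u' z' uz' Zz'; rewrite !mevalM !rmorphXn /= mulf_eq0 negb_or => /andP[su Qd].
have Qu' : Q.@[u' ord0] != 0 by move: Qd; rewrite expf_eq0.
have zQ' : chart_dom Q z' by exists u'.
rewrite (fE (nu z') z') //; last 2 first.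
- exact: chart_coords zQ'.
- by rewrite (sE u' z') // mulf_neq0 // invr_neq0 // expf_neq0.
rewrite (rE u' z') // (sE u' z') // !exprS; field.
by rewrite su Qu' !expf_neq0.
Qed.

(** Regularity becomes a statement about one fixed chart, where fractions can be differentiated and
    compared near [z]. *)
Lemma regular_nu nu Q Z f z : chart nu Q -> chart_dom Q z ->
  regular_at Z f z <->
  exists p q : {mpoly K[ncoord T]}, q.@[nu z ord0] != 0 /\
    locally Z z (fun y => [/\ chart_dom Q y, q.@[nu y ord0] != 0
                            & f y = p.@[nu y ord0] / q.@[nu y ord0]]).
Proof.
move=> nuQ zQ; split=> [fz|[p [q [qz [U [Uo Uz UE]]]]]].
  have [p [q [qz pqE]]] := regular_coord fz (chart_coords nuQ zQ).
  exists p, q; split=> //.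
  exists [set y | chart_dom Q y /\ q.@[nu y ord0] != 0]; split=> //.
    exact: zopen_chart nuQ q.
  by move=> y [yQ qy] Zy; split=> //; apply: pqE => //; apply: chart_coords yQ.
have nuz := chart_coords nuQ zQ.
have [r [rz rU]] := zopen_nbhd Uo Uz nuz.
have [a [d aE]] := chart_fraction nuQ p; have [b [e bE]] := chart_fraction nuQ q.
have Qz := chart_neq0 nuQ zQ nuz.
(* The factor [r] confines the fraction to the neighbourhood on which the local formula is valid. *)
exists (a * Q ^+ e.+1 * r), (b * Q ^+ d.+1 * r), (nu z); split=> //.
  rewrite !mevalM rmorphXn /= !mulf_neq0 ?expf_neq0 //.
  by move: qz; rewrite (bE _ _ nuz Qz); apply: contraNneq => ->; rewrite mul0r.
move=> u' z' uz' Zz'; rewrite !mevalM !rmorphXn /= !mulf_eq0 !negb_or.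
move=> /andP[/andP[bu Qd] ru].
have Qu' : Q.@[u' ord0] != 0 by move: Qd; rewrite expf_eq0.
have [_ _ ->] := UE z' (rU _ _ uz' ru) Zz'.
rewrite (aE u' z') // (bE u' z') // !exprS; field.
by rewrite bu Qu' ru !expf_neq0.
Qed.

Lemma regular_cst Z c z : regular_at Z (fun=> c) z.
Proof.
have [u uz] := Tc.1 z; exists c%:MP, 1, u; split=> //; first by rewrite meval1 oner_eq0.
by move=> u' z' _ _ _; rewrite mevalC meval1 divr1.
Qed.

Lemma regular_ext Z f g z : locally Z z (fun y => f y = g y) ->
  regular_at Z f z -> regular_at Z g z.
Proof.
move=> [U [Uo Uz fg]] fz; have [u uz] := Tc.1 z.
have [p [q [qz pqE]]] := regular_coord fz uz.
have [r [rz rU]] := zopen_nbhd Uo Uz uz.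
exists (p * r), (q * r), u; split=> //; first by rewrite mevalM mulf_neq0.
move=> u' z' uz' Zz'; rewrite !mevalM mulf_eq0 negb_or => /andP[qu ru].
rewrite -fg //; last exact: rU uz' ru.
by rewrite (pqE u' z') //; field; rewrite qu ru.
Qed.

Lemma regularD Z f g z : regular_at Z f z -> regular_at Z g z ->
  regular_at Z (fun y => f y + g y) z.
Proof.
move=> fz gz; have [u uz] := Tc.1 z.
have [p [q [qz pqE]]] := regular_coord fz uz.
have [r [s [sz rsE]]] := regular_coord gz uz.
exists (p * s + r * q), (q * s), u; split=> //; first by rewrite mevalM mulf_neq0.
move=> u' z' uz' Zz'; rewrite mevalD !mevalM mulf_eq0 negb_or => /andP[qu su].
by rewrite (pqE u' z') // (rsE u' z') //; field; rewrite qu su.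
Qed.

Lemma regularM Z f g z : regular_at Z f z -> regular_at Z g z ->
  regular_at Z (fun y => f y * g y) z.
Proof.
move=> fz gz; have [u uz] := Tc.1 z.
have [p [q [qz pqE]]] := regular_coord fz uz.
have [r [s [sz rsE]]] := regular_coord gz uz.
exists (p * r), (q * s), u; split=> //; first by rewrite mevalM mulf_neq0.
move=> u' z' uz' Zz'; rewrite !mevalM mulf_eq0 negb_or => /andP[qu su].
by rewrite (pqE u' z') // (rsE u' z') //; field; rewrite qu su.
Qed.

Lemma regularV Z f z : Z z -> regular_at Z f z -> f z != 0 ->
  regular_at Z (fun y => (f y)^-1) z.
Proof.
move=> Zz fz f0; have [u uz] := Tc.1 z.
have [p [q [qz pqE]]] := regular_coord fz uz.
exists (q * q), (p * q), u; split=> //.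
  rewrite mevalM mulf_neq0 //; move: f0; rewrite (pqE u z) //.
  by apply: contraNneq => ->; rewrite mul0r.
move=> u' z' uz' Zz'; rewrite !mevalM mulf_eq0 negb_or => /andP[pu qu].
by rewrite (pqE u' z') //; field; rewrite pu qu.
Qed.

Lemma regular_neq0 Z f z : Z z -> regular_at Z f z -> f z != 0 ->
  locally Z z (fun y => f y != 0).
Proof.
move=> Zz fz f0; have [u uz] := Tc.1 z; have [nu [Q [nuQ Qu nuz]]] := Tc.2 u z uz.
have zQ : chart_dom Q z by exists u.
have [p [q [qz loc]]] := (regular_nu Z f nuQ zQ).1 fz.
have [_ _ fE] := locally_at loc Zz.
have pz : p.@[nu z ord0] != 0.
  by move: f0; rewrite fE; apply: contraNneq => ->; rewrite mul0r.
have := locally_and loc (locally_open Z (zopen_chart nuQ p) (conj zQ pz)).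
by move=> /locally_impl; apply=> y _ [[_ qy ->] [_ py]]; rewrite mulf_neq0 ?invr_neq0.
Qed.

Lemma regular_sum Z (I : Type) (r : seq I) (P : pred I) (F : I -> T -> K) z :
  (forall i, regular_at Z (F i) z) -> regular_at Z (fun y => \sum_(i <- r | P i) F i y) z.
Proof.
move=> Fz; elim: r => [|i r IH].
  by rewrite (_ : (fun y => _) = (fun=> 0)); [apply: regular_cst | apply/funext => y; rewrite big_nil].
case Pi: (P i); last first.
  by rewrite (_ : (fun y => _) = (fun y => \sum_(j <- r | P j) F j y)) //;
     apply/funext => y; rewrite big_cons Pi.
rewrite (_ : (fun y => _) = (fun y => F i y + \sum_(j <- r | P j) F j y)); last first.
  by apply/funext => y; rewrite big_cons Pi.
exact: regularD.
Qed.

Lemma regular_prod Z (I : Type) (r : seq I) (F : I -> T -> K) z :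
  (forall i, regular_at Z (F i) z) -> regular_at Z (fun y => \prod_(i <- r) F i y) z.
Proof.
move=> Fz; elim: r => [|i r IH].
  by rewrite (_ : (fun y => _) = (fun=> 1)); [apply: regular_cst | apply/funext => y; rewrite big_nil].
rewrite (_ : (fun y => _) = (fun y => F i y * \prod_(j <- r) F j y)); last first.
  by apply/funext => y; rewrite big_cons.
exact: regularM.
Qed.

Lemma regular_poly Z n (p : {mpoly K[n]}) (F : T -> 'rV[K]_n) z :
  (forall i, regular_at Z (fun y => F y ord0 i) z) ->
  regular_at Z (fun y => p.@[F y ord0]) z.
Proof.
move=> Fz; elim/mpoly_ring_ind: p => [c|i|p q pz qz|p q pz qz].
- rewrite (_ : (fun y => _) = (fun=> c)); first exact: regular_cst.
  by apply/funext => y; rewrite mevalC.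
- rewrite (_ : (fun y => _) = (fun y => F y ord0 i)) //.
  by apply/funext => y; rewrite mevalXU.
- rewrite (_ : (fun y => _) = (fun y => p.@[F y ord0] + q.@[F y ord0])); first exact: regularD.
  by apply/funext => y; rewrite mevalD.
rewrite (_ : (fun y => _) = (fun y => p.@[F y ord0] * q.@[F y ord0])); first exact: regularM.
by apply/funext => y; rewrite mevalM.
Qed.

Definition regular_mx Z a b (F : T -> 'M[K]_(a, b)) z :=
  forall i j, regular_at Z (fun y => F y i j) z.

Lemma regular_mx_ext Z a b (F G : T -> 'M[K]_(a, b)) z :
  locally Z z (fun y => F y = G y) -> regular_mx Z F z -> regular_mx Z G z.
Proof.
move=> FG Fz i j; apply: regular_ext (Fz i j).
by apply: locally_impl FG _ => y _ ->.
Qed.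

Lemma regular_mx_cst Z a b (M : 'M[K]_(a, b)) z : regular_mx Z (fun=> M) z.
Proof. by move=> i j; apply: regular_cst. Qed.

Lemma regular_mxD Z a b (F G : T -> 'M[K]_(a, b)) z :
  regular_mx Z F z -> regular_mx Z G z -> regular_mx Z (fun y => F y + G y) z.
Proof.
move=> Fz Gz i j; rewrite (_ : (fun y => _) = (fun y => F y i j + G y i j)).
  exact: regularD.
by apply/funext => y; rewrite mxE.
Qed.

Lemma regular_mxZ Z a b (f : T -> K) (G : T -> 'M[K]_(a, b)) z :
  regular_at Z f z -> regular_mx Z G z -> regular_mx Z (fun y => f y *: G y) z.
Proof.
move=> fz Gz i j; rewrite (_ : (fun y => _) = (fun y => f y * G y i j)).
  exact: regularM.
by apply/funext => y; rewrite mxE.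
Qed.

Lemma regular_mxB Z a b (F G : T -> 'M[K]_(a, b)) z :
  regular_mx Z F z -> regular_mx Z G z -> regular_mx Z (fun y => F y - G y) z.
Proof.
move=> Fz Gz; apply: regular_mxD => //.
rewrite (_ : (fun y => _) = (fun y => (-1) *: G y)).
  by apply: regular_mxZ => //; apply: regular_cst.
by apply/funext => y; rewrite scaleN1r.
Qed.

Lemma regular_mxM Z a b c (F : T -> 'M[K]_(a, b)) (G : T -> 'M[K]_(b, c)) z :
  regular_mx Z F z -> regular_mx Z G z -> regular_mx Z (fun y => F y *m G y) z.
Proof.
move=> Fz Gz i j; rewrite (_ : (fun y => _) = (fun y => \sum_k F y i k * G y k j)).
  by apply: regular_sum => k; apply: regularM.
by apply/funext => y; rewrite mxE.
Qed.

Lemma regular_det Z a (F : T -> 'M[K]_a) z :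
  regular_mx Z F z -> regular_at Z (fun y => \det (F y)) z.
Proof.
move=> Fz; apply: regular_sum => s; apply: regularM; first exact: regular_cst.
exact: regular_prod.
Qed.

Lemma unitmx_near Z a (F : T -> 'M[K]_a) z : Z z -> regular_mx Z F z ->
  F z \in unitmx -> locally Z z (fun y => F y \in unitmx).
Proof.
move=> Zz Fz; rewrite unitmxE unitfE => /(regular_neq0 Zz (regular_det Fz)).
by move=> /locally_impl; apply=> y _; rewrite unitmxE unitfE.
Qed.

(** Cramer's rule: near [z] the inverse is the adjugate divided by a nonvanishing determinant. *)
Lemma regular_invmx Z a (F : T -> 'M[K]_a) z : Z z -> regular_mx Z F z ->
  F z \in unitmx -> regular_mx Z (fun y => invmx (F y)) z.
Proof.
move=> Zz Fz Fu; apply: (@regular_mx_ext _ _ _ (fun y => (\det (F y))^-1 *: \adj (F y))).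
  by apply: locally_impl (unitmx_near Zz Fz Fu) _ => y _; rewrite /invmx => ->.
apply: regular_mxZ.
  apply: regularV => //; first exact: regular_det.
  by rewrite -unitfE -unitmxE.
move=> i j; rewrite (_ : (fun y => _) = (fun y => cofactor (F y) j i)); last first.
  by apply/funext => y; rewrite mxE.
apply: regularM; first exact: regular_cst.
apply: regular_det => i' j'.
rewrite (_ : (fun y => _) = (fun y => F y (lift j i') (lift i j'))) //.
by apply/funext => y; rewrite !mxE.
Qed.

End Regular.
End Topology.

(** * Tangent spaces in a chart *)

Section Tangent.
Variables (K : closedFieldType) (T : Defs.space K).
Hypothesis Tc : charted T.
Variables (Z : set T) (z : T).
Hypothesis Zz : Z z.

Section Derivation.
Variable D : (T -> K) -> K^o.
Hypothesis Dt : tangent Z z D.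

Let Dlin := tangent_linear Dt.

Lemma tangent_cst c : D (fun=> c) = 0.
Proof.
have r c' := regular_cst Tc Z c' z.
have D1 : D (fun=> 1) = 0.
  have := tangent_leibniz Dt (r 1) (r 1).
  by rewrite !mul1r => /eqP; rewrite -subr_eq0 opprD addrA subrr sub0r oppr_eq0 => /eqP.
have D0 : D (fun=> 0) = 0.
  have := Dlin (-1) (r 1) (r 1).
  by rewrite mulr1 addNr D1 mulr0 addr0.
have := Dlin c (r 1) (r 0).
by rewrite mulr1 addr0 D1 D0 mulr0 addr0.
Qed.

Lemma tangentD f g : regular_at Z f z -> regular_at Z g z ->
  D (fun y => f y + g y) = D f + D g.
Proof.
move=> fz gz; rewrite -[D f]mul1r -Dlin //; congr D.
by apply/funext => y; rewrite mul1r.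
Qed.

Lemma tangent_sum (I : Type) (r : seq I) (F : I -> T -> K) :
  (forall i, regular_at Z (F i) z) ->
  D (fun y => \sum_(i <- r) F i y) = \sum_(i <- r) D (F i).
Proof.
move=> Fz; elim: r => [|i r IH].
  rewrite big_nil -[RHS](tangent_cst 0); congr D.
  by apply/funext => y; rewrite big_nil.
rewrite big_cons -IH -tangentD //; last exact: regular_sum.
by congr D; apply/funext => y; rewrite big_cons.
Qed.

Lemma tangent_poly n (p : {mpoly K[n]}) (F : T -> 'rV[K]_n) : regular_mx Z F z ->
  D (fun y => p.@[F y ord0]) = grad p (F z) (\row_i D (fun y => F y ord0 i)).
Proof.
move=> Fz; have rp q := regular_poly Tc q (Fz ord0).
elim/mpoly_ring_ind: p => [c|i|p q pz qz|p q pz qz].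
- rewrite gradC -[RHS](tangent_cst c); congr D.
  by apply/funext => y; rewrite mevalC.
- by rewrite gradX mxE; congr D; apply/funext => y; rewrite mevalXU.
- rewrite gradD -pz -qz -tangentD //; congr D.
  by apply/funext => y; rewrite mevalD.
rewrite gradM -pz -qz -(tangent_leibniz Dt) //; congr D.
by apply/funext => y; rewrite mevalM.
Qed.

Definition dmx a b (F : T -> 'M[K]_(a, b)) : 'M[K]_(a, b) :=
  \matrix_(i, j) (D (fun y => F y i j) : K).

Lemma dmx_ext a b (F G : T -> 'M[K]_(a, b)) : regular_mx Z F z -> regular_mx Z G z ->
  locally Z z (fun y => F y = G y) -> dmx F = dmx G.
Proof.
move=> Fz Gz FG; apply/matrixP => i j; rewrite !mxE; apply: (tangent_germ Dt) => //.
by apply: locally_impl FG _ => y _ ->.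
Qed.

Lemma dmx_cst a b (M : 'M[K]_(a, b)) : dmx (fun=> M) = 0.
Proof. by apply/matrixP => i j; rewrite !mxE tangent_cst. Qed.

Lemma dmxM a b c (F : T -> 'M[K]_(a, b)) (G : T -> 'M[K]_(b, c)) :
  regular_mx Z F z -> regular_mx Z G z ->
  dmx (fun y => F y *m G y) = dmx F *m G z + F z *m dmx G.
Proof.
move=> Fz Gz; apply/matrixP => i j; rewrite !mxE -big_split /=.
under [RHS]eq_bigr => k _ do rewrite !mxE addrC [X in _ + X]mulrC
  -(tangent_leibniz Dt) //.
rewrite -tangent_sum => [|k]; last exact: regularM.
by congr D; apply/funext => y; rewrite mxE.
Qed.

End Derivation.

Lemma tangent0 : tangent Z z (fun=> 0).
Proof. by split=> // [a f g _ _|f g _ _]; rewrite ?mulr0 addr0. Qed.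

Lemma tangent_comb a D D' : tangent Z z D -> tangent Z z D' -> tangent Z z (a *: D + D').
Proof.
move=> Dt Dt'; split.
- move=> f nf; change (a * D f + D' f = 0).
  by rewrite (tangent_out Dt nf) (tangent_out Dt' nf) mulr0 addr0.
- move=> f g fz gz fg; change (a * D f + D' f = a * D g + D' g).
  by rewrite (tangent_germ Dt fz gz fg) (tangent_germ Dt' fz gz fg).
- move=> b f g fz gz.
  change (a * D (fun y => b * f y + g y) + D' (fun y => b * f y + g y) =
          b * (a * D f + D' f) + (a * D g + D' g)).
  by rewrite (tangent_linear Dt) // (tangent_linear Dt') //; ring.
- move=> f g fz gz.
  change (a * D (fun y => f y * g y) + D' (fun y => f y * g y) =
          f z * (a * D g + D' g) + g z * (a * D f + D' f)).
  by rewrite (tangent_leibniz Dt) // (tangent_leibniz Dt') //; ring.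
Qed.

Lemma dmx_comb c D D' a b (F : T -> 'M[K]_(a, b)) :
  dmx (c *: D + D') F = c *: dmx D F + dmx D' F.
Proof. by apply/matrixP => i j; rewrite !mxE. Qed.

Section Chart.
Variables (nu : T -> 'rV[K]_(ncoord T)) (Q : {mpoly K[ncoord T]}).
Hypotheses (nuQ : chart nu Q) (zQ : chart_dom Q z).

(** The tangent space of the affine slice [nu] of [Z], as the common kernel of the gradients of its
    equations. *)
Definition chart_tangent : set 'rV[K]_(ncoord T) :=
  [set w | forall p : {mpoly K[ncoord T]},
     (forall y, Z y -> chart_dom Q y -> p.@[nu y ord0] = 0) -> grad p (nu z) w = 0].

Lemma chart_tangent_comb a w w' : chart_tangent w -> chart_tangent w' ->
  chart_tangent (a *: w + w').
Proof. by move=> ww ww' p p0; rewrite grad_comb ww // ww' // mulr0 addr0. Qed.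

Lemma regular_chart : regular_mx Z nu z.
Proof.
move=> i j; rewrite (ord1 i); apply/(regular_nu Tc _ _ nuQ zQ).
exists 'X_j, 1; split; first by rewrite meval1 oner_eq0.
apply: locally_impl (locally_open Z (zopen_chart_dom nuQ) zQ) _ => y _ yQ.
by split=> //; rewrite meval1 ?oner_eq0 // mevalXU divr1.
Qed.

Lemma tangent_chart D : tangent Z z D -> chart_tangent (dmx D nu).
Proof.
move=> Dt p p0.
rewrite (_ : dmx D nu = \row_i D (fun y => nu y ord0 i)); last first.
  by apply/rowP => i; rewrite !mxE.
rewrite -(tangent_poly Dt _ regular_chart) -[RHS](tangent_cst Dt 0).
apply: (tangent_germ Dt); first exact: (regular_poly Tc p (regular_chart ord0)).
  exact: regular_cst.
by apply: locally_impl (locally_open Z (zopen_chart_dom nuQ) zQ) _ => y Zy yQ; apply: p0.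
Qed.

Let frac_repr f (pq : {mpoly K[ncoord T]} * {mpoly K[ncoord T]}) :=
  pq.2.@[nu z ord0] != 0 /\
  locally Z z (fun y => [/\ chart_dom Q y, pq.2.@[nu y ord0] != 0
                          & f y = pq.1.@[nu y ord0] / pq.2.@[nu y ord0]]).

(** The quotient rule for [p / q] at [u] in direction [w]. *)
Definition frac_grad (p q : {mpoly K[ncoord T]}) (u w : 'rV[K]_(ncoord T)) : K :=
  (q.@[u ord0] * grad p u w - p.@[u ord0] * grad q u w) / q.@[u ord0] ^+ 2.

(** Leibniz applied to [f q = p]. A derivation is therefore determined by its values on the chart
    coordinates. *)
Lemma tangent_fraction D f (p q : {mpoly K[ncoord T]}) : tangent Z z D ->
  q.@[nu z ord0] != 0 ->
  locally Z z (fun y => [/\ chart_dom Q y, q.@[nu y ord0] != 0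
                          & f y = p.@[nu y ord0] / q.@[nu y ord0]]) ->
  D f = frac_grad p q (nu z) (dmx D nu).
Proof.
move=> Dt qz loc.
have fz : regular_at Z f z by apply/(regular_nu Tc _ _ nuQ zQ); exists p, q.
have rp r := regular_poly Tc r (regular_chart ord0).
have gE r : D (fun y => r.@[nu y ord0]) = grad r (nu z) (dmx D nu).
  rewrite (tangent_poly Dt _ regular_chart); congr grad.
  by apply/rowP => i; rewrite !mxE.
have e : D (fun y => f y * q.@[nu y ord0]) = D (fun y => p.@[nu y ord0]).
  apply: (tangent_germ Dt) => //; first exact: regularM.
  by apply: locally_impl loc _ => y Zy [_ qy ->]; rewrite divfK.
have [_ _ fzE] := locally_at loc Zz.
move: e; rewrite (tangent_leibniz Dt) // !gE fzE => e.
rewrite /frac_grad -e; field; exact: qz.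
Qed.

Lemma frac_grad_uniq w (p q p' q' : {mpoly K[ncoord T]}) f : chart_tangent w ->
  frac_repr f (p, q) -> frac_repr f (p', q') ->
  frac_grad p q (nu z) w = frac_grad p' q' (nu z) w.
Proof.
move=> ww [/= qz loc] [/= qz' loc'].
have [U [Uo Uz UP]] := locally_and loc loc'.
have [r [rz rU]] := zopen_nbhd Uo Uz (chart_coords nuQ zQ).
(* Two fractions for [f] agree only near [z]; the factor [r], zero outside that neighbourhood and
   nonzero at [z], makes the cross difference an equation of all of [Z] in the chart. *)
have := ww ((p * q' - p' * q) * r).
rewrite gradM mevalB !mevalM => /(_ _)/wrap[].
  move=> y Zy yQ; rewrite mevalM; apply/eqP; rewrite mulf_eq0.
  have [//|ry] := eqVneq r.@[nu y ord0] 0; first by rewrite orbT.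
  have [[_ qy fy] [_ qy' fy']] := UP y (rU _ _ (chart_coords nuQ yQ) ry) Zy.
  move: fy'; rewrite fy => /eqP; rewrite eqr_div // => /eqP e.
  by rewrite mevalB !mevalM e subrr eqxx.
have [_ _ fz] := locally_at loc Zz; have [_ _ fz'] := locally_at loc' Zz.
have e : p.@[nu z ord0] * q'.@[nu z ord0] = p'.@[nu z ord0] * q.@[nu z ord0].
  by apply/eqP; rewrite -eqr_div // -fz -fz'.
rewrite e subrr mul0r add0r => /eqP; rewrite mulf_eq0 (negPf rz) /=.
rewrite gradD gradN !gradM => /eqP e'; rewrite /frac_grad.
apply/eqP; rewrite eqr_div ?expf_neq0 //; apply/eqP.
move: e e' qz qz'.
move: (grad p _ _) (grad q _ _) (grad p' _ _) (grad q' _ _) (p.@[_]) (q.@[_]) (p'.@[_]) (q'.@[_]).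
move=> dp dq dp' dq' a b a' b' e e' b0 b0'.
have e2 : a * dq' + b' * dp = a' * dq + b * dp' by apply/eqP; rewrite -subr_eq0 e'.
transitivity (b * b' * (b' * dp) - (a * b') * dq * b'); first by ring.
have -> : b' * dp = a' * dq + b * dp' - a * dq' by rewrite -e2; ring.
transitivity (b * b' * (a' * dq + b * dp') - b * dq' * (a * b') - (a * b') * dq * b'); first by ring.
by rewrite e; ring.
Qed.

(** The derivation is the quotient rule in direction [w] on any local fraction, independent of the
    fraction by [frac_grad_uniq]; functions not regular at [z] are sent to 0, as the encoding
    demands. *)
Lemma tangent_exists w : chart_tangent w ->
  exists2 D, tangent Z z D & dmx D nu = w.
Proof.
move=> ww.
pose rp f := xget (0, 1) [set pq | frac_repr f pq].
have rpE f : regular_at Z f z -> frac_repr f (rp f).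
  move=> /(regular_nu Tc _ _ nuQ zQ) [p [q pq]].
  by apply: (xgetPex (0, 1) (P := [set pq | frac_repr f pq])); exists (p, q).
pose D f := if `[< regular_at Z f z >] then frac_grad (rp f).1 (rp f).2 (nu z) w else 0.
have DE f p q : frac_repr f (p, q) -> D f = frac_grad p q (nu z) w.
  move=> fpq; have fz : regular_at Z f z by apply/(regular_nu Tc _ _ nuQ zQ); exists p, q.
  rewrite /D asboolT //; apply: frac_grad_uniq fpq => //.
  by rewrite -surjective_pairing; apply: rpE.
have reg f : regular_at Z f z -> exists p q, frac_repr f (p, q).
  by move=> /rpE; case: (rp f) => p q; exists p, q.
have val f p q : frac_repr f (p, q) -> f z = p.@[nu z ord0] / q.@[nu z ord0].
  by move=> [_ /locally_at /(_ Zz)] [].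
exists D; last first.
  apply/rowP => i; rewrite mxE (DE _ 'X_i 1).
    rewrite /frac_grad -mpolyC1 gradC gradX mevalC !mevalXU.
    by rewrite mulr0 subr0 mul1r expr1n divr1.
  split=> /=; first by rewrite meval1 oner_eq0.
  apply: locally_impl (locally_open Z (zopen_chart_dom nuQ) zQ) _ => y _ yQ.
  by split=> //; rewrite meval1 ?oner_eq0 // mevalXU divr1.
split.
- by move=> f nf; rewrite /D asboolF.
- move=> f g /reg [p [q fpq]] gz fg; rewrite (DE _ _ _ fpq) (DE g p q) //.
  case: fpq => qz loc; split=> //.
  by apply: locally_impl (locally_and loc fg) _ => y _ [[yQ qy fy] <-].
- move=> a f g /reg [p [q fpq]] /reg [p' [q' gpq]].
  rewrite (DE _ _ _ fpq) (DE _ _ _ gpq) (DE _ (a *: (p * q') + p' * q) (q * q')).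
    have [qz _] := fpq; have [qz' _] := gpq.
    rewrite /frac_grad gradD gradZ !gradM mevalD mevalZ !mevalM; field.
    by rewrite qz qz'.
  case: fpq => qz loc; case: gpq => qz' loc'.
  split=> /=; first by rewrite mevalM mulf_neq0.
  apply: locally_impl (locally_and loc loc') _ => y _ [[yQ qy ->] [_ qy' ->]].
  split=> //; rewrite ?mevalD ?mevalZ !mevalM ?mulf_neq0 //.
  by field; rewrite qy qy'.
move=> f g /reg [p [q fpq]] /reg [p' [q' gpq]].
rewrite (DE _ _ _ fpq) (DE _ _ _ gpq) (DE _ (p * p') (q * q')).
  have [qz _] := fpq; have [qz' _] := gpq.
  rewrite (val _ _ _ fpq) (val _ _ _ gpq).
  rewrite /frac_grad !gradM !mevalM; field.
  by rewrite qz qz'.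
case: fpq => qz loc; case: gpq => qz' loc'.
split=> /=; first by rewrite mevalM mulf_neq0.
apply: locally_impl (locally_and loc loc') _ => y _ [[yQ qy ->] [_ qy' ->]].
split=> //; rewrite !mevalM ?mulf_neq0 //.
by field; rewrite qy qy'.
Qed.

Lemma sum_tangent k (e : 'I_k -> (T -> K) -> K^o) (c : 'I_k -> K) :
  (forall i, tangent Z z (e i)) ->
  tangent Z z (\sum_i c i *: e i) /\
  dmx (\sum_i c i *: e i) nu = \sum_i c i *: dmx (e i) nu.
Proof.
elim: k e c => [|k IH] e c et.
  rewrite !big_ord0; split; first exact: tangent0.
  by apply/matrixP => i j; rewrite !mxE.
rewrite !big_ord_recl; have [|t1 t2] := IH (fun i => e (lift ord0 i)) (fun i => c (lift ord0 i)).
  by move=> i; apply: et.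
by split; [apply: tangent_comb | rewrite dmx_comb t2].
Qed.

Lemma tangent_eq0 D : tangent Z z D -> dmx D nu = 0 -> D = 0.
Proof.
move=> Dt D0; apply/funext => f; have [fz|nf] := pselect (regular_at Z f z); last first.
  by rewrite (tangent_out Dt nf).
have [p [q [qz loc]]] := (regular_nu Tc _ _ nuQ zQ).1 fz.
rewrite (tangent_fraction Dt qz loc) D0 /frac_grad /grad.
by rewrite !big1 ?mulr0 ?subrr ?mul0r // => i _; rewrite mxE mulr0.
Qed.

(** Chart coordinates detect all linear relations between derivations, which is the input required
    by [rk_mirror]. *)
Lemma tangent_mirror k (e : 'I_k -> (T -> K) -> K^o) (c : 'I_k -> K) :
  (forall i, tangent Z z (e i)) ->
  \sum_i c i *: dmx (e i) nu = 0 <-> \sum_i c i *: e i = 0.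
Proof.
move=> /(sum_tangent c) [t1 t2]; rewrite -t2; split; first exact: tangent_eq0.
by move=> ->; apply/matrixP => i j; rewrite !mxE.
Qed.

Lemma chart_tangent_mx : exists k (S : 'M[K]_(k, ncoord T)),
  forall w, chart_tangent w <-> (w <= S)%MS.
Proof.
have [r [M [_ MB BM]]] := finite_span chart_tangent.
exists r, M => w; split; first exact: BM.
move=> /sub_combP [c ->]; elim/big_ind: _ => [p _|a b ta tb|i _].
- by rewrite /grad big1 // => i _; rewrite mxE mulr0.
- by rewrite -[a]scale1r; apply: chart_tangent_comb.
rewrite -[X in chart_tangent X]addr0; apply: chart_tangent_comb => // p _.
by rewrite /grad big1 // => j _; rewrite mxE mulr0.
Qed.

Lemma rk_tangent k (S : 'M[K]_(k, ncoord T)) :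
  (forall w, chart_tangent w <-> (w <= S)%MS) -> rk (tangent Z z) id = \rank S.
Proof.
move=> SE; rewrite (@rk_mirror _ _ _ _ _ (fun D => dmx D nu) id).
  apply: rk_rV => [D /tangent_chart /SE //|w /SE /tangent_exists [D Dt <-]].
  by exists D.
by move=> l e c et; apply: tangent_mirror.
Qed.

End Chart.
End Tangent.

(** * Morphisms and products *)

Section Morphisms.
Variables (K : closedFieldType) (T T' : Defs.space K).
Hypotheses (Tc : charted T) (Tc' : charted T').

Definition morphism_at (Z : set T) (Z' : set T') (f : T -> T') (z : T) :=
  [/\ locally Z z (fun y => Z' (f y)),
      forall U, zopen U -> U (f z) -> locally Z z (fun y => U (f y))
    & forall g, regular_at Z' g (f z) -> regular_at Z (g \o f) z].

(** Open sets and regular functions of the target are given by polynomials in coordinate vectors, so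
    a regular lift of [f] to coordinate vectors controls both. *)
Lemma morphism_lift Z Z' f z (c : T -> 'rV[K]_(ncoord T')) :
  Z z -> regular_mx Z c z -> locally Z z (fun y => coords (c y) (f y) /\ Z' (f y)) ->
  morphism_at Z Z' f z.
Proof.
move=> Zz cz loc; have [cfz Zfz] := locally_at loc Zz.
have near r : r.@[c z ord0] != 0 -> locally Z z (fun y => r.@[c y ord0] != 0).
  by move=> rz; apply: (regular_neq0 Tc Zz) => //; apply: (regular_poly Tc r (cz ord0)).
split=> [|U Uo Uz|g gz].
- by apply: locally_impl loc _ => y _ [].
- have [r [rz rU]] := zopen_nbhd Uo Uz cfz.
  apply: locally_impl (locally_and loc (near r rz)) _ => y Zy [[cfy _] ry].
  exact: rU cfy ry.
have [p [q [qz gE]]] := regular_coord Tc' gz cfz.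
apply: (@regular_ext _ _ Tc _ (fun y => p.@[c y ord0] * (q.@[c y ord0])^-1)).
  apply: locally_impl (locally_and loc (near q qz)) _ => y Zy [[cfy Zfy] qy] /=.
  by rewrite (gE _ _ cfy).
apply: (regularM Tc); first exact: (regular_poly Tc p (cz ord0)).
by apply: (regularV Tc) => //; apply: (regular_poly Tc q (cz ord0)).
Qed.

Lemma locally_pull Z Z' f z P : morphism_at Z Z' f z -> locally Z' (f z) P ->
  locally Z z (fun y => P (f y)).
Proof.
move=> [fZ fo _] [U [Uo Uz UP]].
by apply: locally_impl (locally_and fZ (fo U Uo Uz)) _ => y _ [Zfy Ufy]; apply: UP.
Qed.

Lemma regular_mx_pull Z Z' f z a b (F : T' -> 'M[K]_(a, b)) : morphism_at Z Z' f z ->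
  regular_mx Z' F (f z) -> regular_mx Z (fun y => F (f y)) z.
Proof. by move=> [_ _ fr] Fz i j; apply: fr (Fz i j). Qed.

Lemma tangent_differential Z Z' f z D : morphism_at Z Z' f z -> tangent Z z D ->
  tangent Z' (f z) (differential Z' f z D).
Proof.
move=> fm Dt; have [fZ fo fr] := fm; split.
- by move=> g ng; rewrite /differential asboolF.
- move=> g h gz hz gh; rewrite /differential !asboolT //.
  apply: (tangent_germ Dt); try exact: fr.
  exact: (locally_pull fm gh).
- move=> a g h gz hz; rewrite /differential !asboolT //.
    by rewrite -(tangent_linear Dt) //; exact: fr.
  apply: (regularD Tc') => //; apply: (regularM Tc') => //; exact: regular_cst.
move=> g h gz hz; rewrite /differential !asboolT //; last exact: (regularM Tc').
by rewrite -(tangent_leibniz Dt) //; exact: fr.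
Qed.

Lemma differentialE (Z' : set T') (f : T -> T') z (D : (T -> K) -> K^o) (g : T' -> K) : regular_at Z' g (f z) ->
  differential Z' f z D g = D (g \o f).
Proof. by move=> gz; rewrite /differential asboolT. Qed.

Lemma dmx_differential (Z' : set T') (f : T -> T') z (D : (T -> K) -> K^o) a b (F : T' -> 'M[K]_(a, b)) : regular_mx Z' F (f z) ->
  dmx (differential Z' f z D) F = dmx D (fun y => F (f y)).
Proof. by move=> Fz; apply/matrixP => i j; rewrite !mxE differentialE. Qed.

Lemma rk_differential Z Z' f z nu Q : chart nu Q -> chart_dom Q (f z) ->
  Z z -> Z' (f z) -> morphism_at Z Z' f z ->
  rk (tangent Z z) (differential Z' f z) = rk (tangent Z z) (fun D => dmx D (fun y => nu (f y))).
Proof.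
move=> nuQ zQ Zz Zfz fm; apply: rk_mirror => k e c et.
have et' i : tangent Z' (f z) (differential Z' f z (e i)) by exact: tangent_differential fm (et i).
rewrite -(tangent_mirror Tc' Zfz nuQ zQ c et').
rewrite (eq_bigr (fun i => c i *: dmx (differential Z' f z (e i)) nu)) // => i _.
by rewrite dmx_differential //; apply: regular_chart nuQ zQ.
Qed.

End Morphisms.

(** * Charts and projections of a product *)

Section Products.
Variables (K : closedFieldType) (T T' : Defs.space K).
Hypotheses (Tc : charted T) (Tc' : charted T').
Let n := ncoord T.
Let n' := ncoord T'.

Definition lpoly (p : {mpoly K[n]}) : {mpoly K[n + n']} := p \mPo [tuple 'X_(lshift n' i) | i < n].
Definition rpoly (p : {mpoly K[n']}) : {mpoly K[n + n']} := p \mPo [tuple 'X_(rshift n i) | i < n'].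

Lemma meval_lpoly p (u : 'rV[K]_(n + n')) : (lpoly p).@[u ord0] = p.@[lsubmx u ord0].
Proof.
rewrite /lpoly comp_mpoly_meval; apply: meval_eq => i.
by rewrite tnth_mktuple mevalXU mxE.
Qed.

Lemma meval_rpoly p (u : 'rV[K]_(n + n')) : (rpoly p).@[u ord0] = p.@[rsubmx u ord0].
Proof.
rewrite /rpoly comp_mpoly_meval; apply: meval_eq => i.
by rewrite tnth_mktuple mevalXU mxE.
Qed.

Section ProdChart.
Variables (nu : T -> 'rV[K]_n) (Q : {mpoly K[n]}) (nu' : T' -> 'rV[K]_n') (Q' : {mpoly K[n']}).
Hypotheses (nuQ : chart nu Q) (nuQ' : chart nu' Q').

Definition prod_nu (v : prod_space T T') : 'rV[K]_(ncoord (prod_space T T')) :=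
  row_mx (nu v.1) (nu' v.2).
Definition prod_Q : {mpoly K[ncoord (prod_space T T')]} := lpoly Q * rpoly Q'.

Lemma prod_QE (u : 'rV[K]_(n + n')) :
  (prod_Q.@[u ord0] != 0) = (Q.@[lsubmx u ord0] != 0) && (Q'.@[rsubmx u ord0] != 0).
Proof. by rewrite /prod_Q mevalM meval_lpoly meval_rpoly mulf_eq0 negb_or. Qed.

Lemma prod_chart : chart prod_nu prod_Q.
Proof.
case: nuQ => [nc [P PE] ns]; case: nuQ' => [nc' [P' PE'] ns']; split.
- move=> u v [uv uv']; rewrite prod_QE => /andP[Qu Qu'] /=.
  by rewrite row_mxKl row_mxKr; split; [apply: nc Qu | apply: nc' Qu'].
- exists (fun i : 'I_(n + n') => match fintype.split i with
      inl j => lpoly (P j) * rpoly Q' | inr j => lpoly Q * rpoly (P' j) end).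
  move=> u v [uv uv']; rewrite prod_QE => /andP[Qu Qu'].
  apply/rowP => i; rewrite !mxE; case: fintype.split => j.
    rewrite (PE _ _ uv Qu) mxE /prod_Q !mevalM !meval_lpoly meval_rpoly; field.
    by rewrite Qu Qu'.
  rewrite (PE' _ _ uv' Qu') mxE /prod_Q !mevalM meval_lpoly !meval_rpoly; field.
  by rewrite Qu Qu'.
move=> u u' v [uv uv'] [wv wv']; rewrite !prod_QE => /andP[Qu Qu'].
by apply/andP; split; [apply: ns uv wv Qu | apply: ns' uv' wv' Qu'].
Qed.

Lemma prod_chart_dom v : chart_dom prod_Q v <-> chart_dom Q v.1 /\ chart_dom Q' v.2.
Proof.
split=> [[u [uv uv']]|[[u uv Qu] [u' uv' Qu']]].
  by rewrite prod_QE => /andP[Qu Qu']; split; [exists (lsubmx u) | exists (rsubmx u)].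
exists (row_mx u u'); first by rewrite /= row_mxKl row_mxKr.
by rewrite prod_QE row_mxKl row_mxKr Qu Qu'.
Qed.

End ProdChart.

Lemma prod_charted : charted (prod_space T T').
Proof.
split=> [v|u v [uv uv']].
  have [u uv] := Tc.1 v.1; have [u' uv'] := Tc'.1 v.2.
  by exists (row_mx u u'); rewrite /= row_mxKl row_mxKr.
have [nu [Q [nuQ Qu nuv]]] := Tc.2 _ _ uv; have [nu' [Q' [nuQ' Qu' nuv']]] := Tc'.2 _ _ uv'.
exists (prod_nu nu nu'), (prod_Q Q Q'); split; first exact: prod_chart.
  by rewrite prod_QE Qu Qu'.
by rewrite /prod_nu nuv nuv' hsubmxK.
Qed.

Lemma morphism_fst (Z : set (prod_space T T')) (X : set T) v :
  Z v -> (forall y, Z y -> X y.1) -> morphism_at Z X (fun y => y.1) v.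
Proof.
move=> Zv ZX; have [u uv] := Tc.1 v.1; have [u' uv'] := Tc'.1 v.2.
have [nu [Q [nuQ Qu _]]] := Tc.2 _ _ uv; have [nu' [Q' [nuQ' Qu' _]]] := Tc'.2 _ _ uv'.
have vQ : chart_dom (prod_Q Q Q') v by apply/prod_chart_dom; split; [exists u | exists u'].
have pQ := prod_chart nuQ nuQ'.
apply: (@morphism_lift _ _ _ prod_charted Tc _ _ _ _ (fun y => nu y.1)) => //.
  move=> i j; have := regular_chart prod_charted Z pQ vQ ord0 (lshift n' j).
  by congr regular_at; apply/funext => y; rewrite row_mxEl (ord1 i).
apply: locally_impl (locally_open Z (zopen_chart_dom pQ) vQ) _ => y Zy /prod_chart_dom [yQ _].
by split; [apply: chart_coords yQ | apply: ZX].
Qed.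

Lemma morphism_snd (Z : set (prod_space T T')) (X : set T') v :
  Z v -> (forall y, Z y -> X y.2) -> morphism_at Z X (fun y => y.2) v.
Proof.
move=> Zv ZX; have [u uv] := Tc.1 v.1; have [u' uv'] := Tc'.1 v.2.
have [nu [Q [nuQ Qu _]]] := Tc.2 _ _ uv; have [nu' [Q' [nuQ' Qu' _]]] := Tc'.2 _ _ uv'.
have vQ : chart_dom (prod_Q Q Q') v by apply/prod_chart_dom; split; [exists u | exists u'].
have pQ := prod_chart nuQ nuQ'.
apply: (@morphism_lift _ _ _ prod_charted Tc' _ _ _ _ (fun y => nu' y.2)) => //.
  move=> i j; have := regular_chart prod_charted Z pQ vQ ord0 (rshift n j).
  by congr regular_at; apply/funext => y; rewrite row_mxEr (ord1 i).
apply: locally_impl (locally_open Z (zopen_chart_dom pQ) vQ) _ => y Zy /prod_chart_dom [_ yQ].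
by split; [apply: chart_coords yQ | apply: ZX].
Qed.

Lemma zclosed_fst X : zclosed X -> zclosed [set v : prod_space T T' | X v.1].
Proof.
move=> [F FX]; exists [set lpoly p | p in F] => u v [uv _]; split.
  by move=> /(FX _ _ uv) F0 _ [p /F0 p0 <-]; rewrite meval_lpoly.
by move=> F0; apply/(FX _ _ uv) => p Fp; rewrite -meval_lpoly; apply: F0; exists p.
Qed.

Lemma zopen_fst U : zopen U -> zopen [set v : prod_space T T' | U v.1].
Proof. exact: zclosed_fst. Qed.

End Products.

(** * Grassmannians and linear equations *)

Section Equations.
Variables (K : closedFieldType) (N : nat).
Implicit Types (E : {vspace 'cV[K]_N.+1}).

Lemma vspace_mx E : exists B : 'M[K]_(\dim E, N.+1),
  row_free B /\ forall p, (p \in E) = (p^T <= B)%MS.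
Proof.
pose B : 'M[K]_(\dim E, N.+1) := \matrix_(i, j) (vbasis E)`_i j ord0; exists B.
have rE i : row i B = ((vbasis E)`_i)^T.
  by apply/rowP => j; rewrite !mxE.
split.
  apply/row_free_combP => k k0; apply: (elimT vector.freeP (basis_free (vbasisP E)) k).
  apply: trmx_inj; rewrite trmx0 -[RHS]k0 raddf_sum; apply: eq_bigr => i _ /=.
  by rewrite linearZ /= rE.
move=> p; apply/idP/idP => [pE|/sub_combP [k pk]].
  apply/sub_combP; exists (fun i => coord (vbasis E) i p).
  rewrite {1}(coord_vbasis pE) raddf_sum; apply: eq_bigr => i _ /=.
  by rewrite linearZ /= rE.
have -> : p = \sum_i k i *: (vbasis E)`_i.
  apply: trmx_inj; rewrite pk raddf_sum; apply: eq_bigr => i _ /=.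
  by rewrite linearZ /= rE.
apply: memv_suml => i _; apply: memvZ; apply: vbasis_mem.
by apply: mem_nth; rewrite size_tuple.
Qed.

Lemma cut_out_rank c (M : 'M[K]_(c, N.+1)) E : cut_out_by M E ->
  (\dim E + \rank M)%N = N.+1.
Proof.
move=> ME; have [B [/eqP Bf BE]] := vspace_mx E.
have rB : \rank B = \rank (kermx M^T).
  apply: eqmx_rank.
  apply/andP; split; apply/row_subP => i.
    apply/sub_kermxP; rewrite -[row i B]trmxK -trmx_mul.
    by apply/eqP; rewrite trmx_eq0 -ME BE trmxK row_sub.
  rewrite -[row i _]trmxK -BE ME -trmx_eq0 trmx_mul trmxK.
  by apply/eqP/sub_kermxP; rewrite row_sub.
move: rB; rewrite Bf mxrank_ker mxrank_tr => ->; rewrite subnK //.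
exact: rank_leq_col.
Qed.

Lemma cut_out_exists c E : (\dim E + c)%N = N.+1 ->
  exists M : 'M[K]_(c, N.+1), cut_out_by M E.
Proof.
move=> Ec; have [B [/eqP Bf BE]] := vspace_mx E.
pose M0 := (cokermx B)^T.
have rM0 : \rank M0 = c by rewrite mxrank_tr mxrank_coker Bf; move: Ec; move: (\dim E) => d <-; rewrite addKn.
have [M MM0] : exists M : 'M[K]_(c, N.+1), (M :=: M0)%MS.
  by case: _ / rM0; exists (row_base M0); apply: eq_row_base.
exists M => p; rewrite BE submxE -[_ *m _]trmxK trmx_mul trmxK trmx_eq0 -/M0.
apply/eqP/eqP => e.
  have /submxP [D ->] : (M <= M0)%MS by rewrite MM0.
  by rewrite -mulmxA e mulmx0.
have /submxP [D ->] : (M0 <= M)%MS by rewrite MM0.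
by rewrite -mulmxA e mulmx0.
Qed.

(** Double annihilator: the columns of the cokernel of [M] lie in [E], so a form vanishing on [E] is
    killed by this cokernel. *)
Lemma vanishing_sub c (M : 'M[K]_(c, N.+1)) E s : cut_out_by M E ->
  vanishing E s <-> (s <= M)%MS.
Proof.
move=> ME; split=> [sE|/submxP [D ->] p].
  rewrite submxE; apply/eqP/matrixP => i j.
  have cE : col j (cokermx M) \in E by rewrite ME colE mulmxA mulmx_coker mul0mx.
  have /matrixP/(_ i 0) := sE _ cE; rewrite colE mulmxA -colE !mxE.
  by move=> ->.
by rewrite ME => /eqP e; rewrite -mulmxA e mulmx0.
Qed.

Lemma cut_out_sub c c' (M : 'M[K]_(c, N.+1)) (M' : 'M[K]_(c', N.+1)) E :
  cut_out_by M E -> cut_out_by M' E -> (M' <= M)%MS.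
Proof.
move=> ME M'E; apply/row_subP => i; apply/(vanishing_sub _ ME) => p pE.
by rewrite -row_mul; have := pE; rewrite M'E => /eqP ->; rewrite row0.
Qed.

Lemma cut_out_eqmx c c' (M : 'M[K]_(c, N.+1)) (M' : 'M[K]_(c', N.+1)) E :
  cut_out_by M E -> (M' :=: M)%MS -> cut_out_by M' E.
Proof.
move=> ME MM p; rewrite ME; apply/eqP/eqP => e.
  have /submxP [D ->] : (M' <= M)%MS by rewrite MM.
  by rewrite -mulmxA e mulmx0.
have /submxP [D ->] : (M <= M')%MS by rewrite MM.
by rewrite -mulmxA e mulmx0.
Qed.

Lemma subv_cut_out c c' (M : 'M[K]_(c, N.+1)) (M' : 'M[K]_(c', N.+1)) E E' :
  cut_out_by M E -> cut_out_by M' E' -> (E <= E')%VS = (M' <= M)%MS.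
Proof.
move=> ME ME'; apply/subvP/idP => [EE'|/submxP [D e] p].
  apply/row_subP => i; apply/(vanishing_sub _ ME) => p /EE'.
  by rewrite ME' => /eqP e; rewrite -row_mul e row0.
by rewrite ME ME' e => /eqP e'; rewrite -mulmxA e' mulmx0.
Qed.

Lemma form_kernel (s : 'rV[K]_N.+1) : s != 0 ->
  exists H : dualP K N, coords (s := dualP K N) s H.
Proof.
move=> s0; pose E := lker (linfun (mulmx s : 'cV[K]_N.+1 -> 'M[K]_1)).
have sE : cut_out_by s E by move=> p; rewrite memv_ker lfunE.
have dE : \dim E == N by have := cut_out_rank sE; rewrite rank_rV s0 addn1 => -[->].
by exists (exist _ E dE).
Qed.

End Equations.

(** * Affine charts by normalized linear equations *)

Section LinearSystems.
Variables (K : closedFieldType) (N c : nat) (T : Defs.space K).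
Variables (E : T -> {vspace 'cV[K]_N.+1}).
Variables (mat : 'rV[K]_(ncoord T) -> 'M[K]_(c, N.+1)).
Variables (vec : 'M[K]_(c, N.+1) -> 'rV[K]_(ncoord T)).
Variables (X : 'M[{mpoly K[ncoord T]}]_(c, N.+1)).
Hypotheses (matK : cancel mat vec) (vecK : cancel vec mat).
Hypothesis matX : forall u : 'rV[K]_(ncoord T), mat u = map_mx (meval (u ord0)) X.
Hypothesis vecX : forall j, exists i k, forall M, vec M ord0 j = M i k.
Hypothesis coordsE : forall u z, coords u z <-> cut_out_by (mat u) (E z).
Hypothesis dimE : forall z, (\dim (E z) + c)%N = N.+1.

Lemma linear_row_free u z : coords u z -> row_free (mat u).
Proof.
move=> /coordsE /cut_out_rank; rewrite -[in RHS](dimE z) => /addnI e.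
by rewrite /row_free e.
Qed.

Section Normal.
Variable A : 'M[K]_(N.+1, c).

(** The standard affine chart attached to [A]: where the product of equations with [A] is
    invertible, exactly one system of equations satisfies [M A = 1]. Elsewhere the value is the
    default 0. *)
Definition normal_form (z : T) : 'M[K]_(c, N.+1) :=
  xget 0 [set M | cut_out_by M (E z) /\ M *m A = 1%:M].

Definition normal_nu z := vec (normal_form z).

Definition normal_Q : {mpoly K[ncoord T]} := \det (X *m map_mx (@mpolyC _ K) A).

Lemma normal_QE (u : 'rV[K]_(ncoord T)) : normal_Q.@[u ord0] = \det (mat u *m A).
Proof.
rewrite /normal_Q -det_map_mx map_mxM matX -map_mx_comp; congr (\det (_ *m _)).
by apply/matrixP => i j; rewrite !mxE /= mevalC.
Qed.

Lemma normal_form_uniq z M : cut_out_by M (E z) -> M *m A = 1%:M -> normal_form z = M.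
Proof.
move=> ME MA; have [] : [set M | cut_out_by M (E z) /\ M *m A = 1%:M] (normal_form z).
  by apply: xgetPex; exists M.
move: (normal_form z) => M' M'E M'A.
have /submxP [D eM] := cut_out_sub ME M'E.
by move: M'A; rewrite eM -mulmxA MA mulmx1 => ->; rewrite mul1mx.
Qed.

Lemma normal_formE u z : coords u z -> normal_Q.@[u ord0] != 0 ->
  [/\ cut_out_by (normal_form z) (E z), normal_form z *m A = 1%:M
    & normal_form z = invmx (mat u *m A) *m mat u].
Proof.
move=> /coordsE uz; rewrite normal_QE -unitfE -unitmxE => uA.
have e1 : cut_out_by (invmx (mat u *m A) *m mat u) (E z).
  by apply: cut_out_eqmx uz _; apply: eqmxMfull; rewrite row_full_unit unitmx_inv.
have e2 : invmx (mat u *m A) *m mat u *m A = 1%:M by rewrite -mulmxA mulVmx.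
by rewrite (normal_form_uniq e1 e2); split.
Qed.

Lemma normal_chart : chart normal_nu normal_Q.
Proof.
split=> [u z uz Qu||u u' z uz uz' Qu].
- by apply/coordsE; rewrite vecK; case: (normal_formE uz Qu).
- pose Y := \adj (X *m map_mx (@mpolyC _ K) A) *m X.
  have /choice [P PE] : forall j, exists p : {mpoly K[ncoord T]}, forall u : 'rV_(ncoord T),
      p.@[u ord0] = vec (map_mx (meval (u ord0)) Y) ord0 j.
    by move=> j; have [i [k ik]] := vecX j; exists (Y i k) => u; rewrite ik [RHS]mxE.
  exists P => u z uz Qu; apply/rowP => j; rewrite mxE PE.
  have [i [k ik]] := vecX j; rewrite !ik; have [_ _ ->] := normal_formE uz Qu.
  have uA : mat u *m A \in unitmx by rewrite unitmxE unitfE -normal_QE.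
  rewrite /invmx uA -scalemxAl mxE normal_QE mulrC; congr (_ * _).
  rewrite map_mxM map_mx_adj map_mxM -matX -map_mx_comp /=.
  rewrite (_ : map_mx _ A = A) //.
  by apply/matrixP => a b; rewrite mxE /= mevalC.
have [z1 z2 _] := normal_formE uz Qu; move/coordsE: uz' => uz'.
have /submxP [D e] := cut_out_sub uz' z1.
rewrite normal_QE -unitfE -unitmxE; move: z2; rewrite e -mulmxA.
by case/mulmx1_unit.
Qed.

Lemma normal_dom z : chart_dom normal_Q z ->
  cut_out_by (normal_form z) (E z) /\ normal_form z *m A = 1%:M.
Proof. by case=> u uz Qu; case: (normal_formE uz Qu). Qed.

Lemma normal_dom_intro z M : cut_out_by M (E z) -> M *m A \in unitmx -> chart_dom normal_Q z.
Proof.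
move=> ME MA; exists (vec M); first by apply/coordsE; rewrite vecK.
by rewrite normal_QE vecK -unitfE -unitmxE.
Qed.

End Normal.

(** Equations of the right number have independent rows, so the matrix of any [u] has a right
    inverse [A]; in the chart of this [A] the normalized equations are [u] itself. *)
Lemma linear_charted : charted T.
Proof.
split=> [z|u z uz].
  have [M ME] := cut_out_exists (dimE z).
  by exists (vec M); apply/coordsE; rewrite vecK.
have /row_freeP [A uA] := linear_row_free uz.
exists (normal_nu A), (normal_Q A); split; first exact: normal_chart.
  by rewrite normal_QE uA det1 oner_eq0.
rewrite /normal_nu (normal_form_uniq _ uA) ?matK //.
exact/coordsE.
Qed.

End LinearSystems.

(** * The Grassmannian and the dual projective space *)

Section Instances.
Variables (K : closedFieldType) (N : nat).

Section Gr.
Variable m : nat.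
Let T := Gr K N m.
Let E (z : T) : {vspace 'cV[K]_N.+1} := val z.
Let X : 'M[{mpoly K[(N - m) * N.+1]}]_(N - m, N.+1) := \matrix_(i, j) 'X_(mxvec_index i j).

Let Gr_dimE (z : T) : (\dim (E z) + (N - m))%N = N.+1.
Proof.
have mN : (\dim (E z) <= N.+1)%N.
  have [B [/eqP Bf _]] := vspace_mx (E z).
  by rewrite -[X in (X <= _)%N]Bf rank_leq_col.
by move: mN; rewrite (eqP (valP z)) ltnS => mN; rewrite addSn subnKC.
Qed.

Let Gr_matX (u : 'rV[K]_(ncoord T)) : vec_mx u = map_mx (meval (u ord0)) X.
Proof. by apply/matrixP => i j; rewrite !mxE mevalXU. Qed.

Let Gr_vecX (j : 'I_(ncoord T)) :
  exists i k, forall M : 'M[K]_(N - m, N.+1), mxvec M ord0 j = M i k.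
Proof. by case/mxvec_indexP: j => i k; exists i, k => M; rewrite mxvecE. Qed.

Let Gr_coordsE (u : 'rV[K]_(ncoord T)) z : coords u z <-> cut_out_by (vec_mx u) (E z).
Proof. by []. Qed.

Definition Gr_form (A : 'M[K]_(N.+1, N - m)) (z : T) : 'M[K]_(N - m, N.+1) :=
  normal_form E A z.
Definition Gr_nu (A : 'M[K]_(N.+1, N - m)) (z : T) : 'rV[K]_(ncoord T) :=
  normal_nu E (fun M => mxvec M) A z.
Definition Gr_Q (A : 'M[K]_(N.+1, N - m)) : {mpoly K[ncoord T]} := @normal_Q K N _ T X A.

Lemma Gr_nuE A z : vec_mx (Gr_nu A z) = Gr_form A z.
Proof. exact: mxvecK. Qed.

Lemma Gr_charted : charted T.
Proof.
pose P := @linear_charted _ _ _ T E (fun u => vec_mx u) (fun M => mxvec M) X.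
by apply: P; [apply: vec_mxK|apply: mxvecK|..].
Qed.

Lemma Gr_chart A : chart (Gr_nu A) (Gr_Q A).
Proof.
pose P := @normal_chart _ _ _ T E (fun u => vec_mx u) (fun M => mxvec M) X.
by apply: P => //; apply: mxvecK.
Qed.

Lemma Gr_dom A z : chart_dom (Gr_Q A) z ->
  cut_out_by (Gr_form A z) (val z) /\ Gr_form A z *m A = 1%:M.
Proof. exact: (@normal_dom _ _ _ T E (fun u => vec_mx u) X). Qed.

Lemma Gr_dom_intro A (z : T) M : cut_out_by M (val z) -> M *m A \in unitmx ->
  chart_dom (Gr_Q A) z.
Proof.
pose P := @normal_dom_intro _ _ _ T E (fun u => vec_mx u) (fun M => mxvec M) X.
by apply: P => //; apply: mxvecK.
Qed.

Lemma Gr_equations (z : T) : exists (M : 'M[K]_(N - m, N.+1)) A,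
  cut_out_by M (val z) /\ M *m A = 1%:M.
Proof.
have [M ME] := cut_out_exists (Gr_dimE z).
have /row_freeP [A MA] : row_free M.
  have := cut_out_rank ME; rewrite -[in RHS](Gr_dimE z) => /addnI e.
  by rewrite /row_free e.
by exists M, A.
Qed.

Lemma Gr_rank (z : T) c (M : 'M[K]_(c, N.+1)) : cut_out_by M (val z) -> \rank M = (N - m)%N.
Proof. by move=> /cut_out_rank; rewrite -[in RHS](Gr_dimE z) => /addnI. Qed.

End Gr.

Section DualSpace.
Let T := dualP K N.
Let E (z : T) : {vspace 'cV[K]_N.+1} := val z.
Let X : 'M[{mpoly K[N.+1]}]_(1, N.+1) := \matrix_(i, j) 'X_j.

Let dual_dimE (z : T) : (\dim (E z) + 1)%N = N.+1.
Proof. by rewrite (eqP (valP z)) addn1. Qed.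

Let dual_matX (u : 'rV[K]_(ncoord T)) : u = map_mx (meval (u ord0)) X.
Proof. by apply/matrixP => i j; rewrite !mxE mevalXU (ord1 i). Qed.

Let dual_vecX (j : 'I_(ncoord T)) :
  exists i k, forall M : 'M[K]_(1, N.+1), M ord0 j = M i k.
Proof. by exists ord0, j. Qed.

Let dual_coordsE (u : 'rV[K]_(ncoord T)) z : coords u z <-> cut_out_by u (E z).
Proof. by []. Qed.

Definition dual_nu (a : 'cV[K]_N.+1) (z : T) : 'rV[K]_N.+1 := normal_form E a z.
Definition dual_Q (a : 'cV[K]_N.+1) : {mpoly K[ncoord T]} := @normal_Q K N _ T X a.

Lemma dual_charted : charted T.
Proof.
by apply: (@linear_charted _ _ _ T E id id X) => //; apply: dual_dimE.
Qed.

Lemma dual_chart a : chart (T := T) (dual_nu a) (dual_Q a).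
Proof. by apply: (@normal_chart _ _ _ T E id id X). Qed.

Lemma dual_dom a z : chart_dom (dual_Q a) z ->
  cut_out_by (dual_nu a z) (val z) /\ dual_nu a z *m a = 1%:M.
Proof. exact: (@normal_dom _ _ _ T E id X). Qed.

Lemma dual_dom_intro a (z : T) h : cut_out_by h (val z) -> h *m a \in unitmx ->
  chart_dom (dual_Q a) z.
Proof. exact: (@normal_dom_intro _ _ _ T E id id X). Qed.

Lemma dual_nu_uniq a (z : T) h : cut_out_by h (val z) -> h *m a = 1%:M -> dual_nu a z = h.
Proof. exact: normal_form_uniq. Qed.

Lemma dual_equation (z : T) : exists (h : 'rV[K]_N.+1) a, cut_out_by h (val z) /\ h *m a = 1%:M.
Proof.
have [h hE] := cut_out_exists (dual_dimE z).
have /row_freeP [a ha] : row_free h.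
  have := cut_out_rank hE; rewrite -[in RHS](dual_dimE z) => /addnI e.
  by rewrite /row_free e.
by exists h, a.
Qed.

End DualSpace.
End Instances.

(** * Local frames *)

Section Frames.
Variables (K : closedFieldType) (T : Defs.space K).
Hypothesis Tc : charted T.
Variables (Z : set T) (z0 : T).
Hypothesis Zz0 : Z z0.

Lemma rank_factor a b (M : 'M[K]_(a, b)) :
  exists (E : 'M[K]_(\rank M, a)) (F : 'M[K]_(b, \rank M)), E *m M *m F = 1%:M.
Proof.
have /row_fullP [E Ec] := col_base_full M; have /row_freeP [F rF] := row_base_free M.
exists E, F; have : E *m (col_base M *m row_base M) *m F = 1%:M by rewrite mulmxA Ec mul1mx.
by rewrite mulmx_base.
Qed.

(** Semicontinuity: [E F G] is the identity at [z0] for constant [E] and [G], and stays invertible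
    nearby. *)
Lemma rank_near a b (F : T -> 'M[K]_(a, b)) : regular_mx Z F z0 ->
  locally Z z0 (fun z => (\rank (F z0) <= \rank (F z))%N).
Proof.
move=> Fr; have [E [G EG]] := rank_factor (F z0).
have r1 : regular_mx Z (fun z => E *m F z *m G) z0.
  by apply: regular_mxM => //; [apply: regular_mxM => // |]; apply: regular_mx_cst.
have := unitmx_near Tc Zz0 r1; rewrite EG unitmx1 => /(_ isT)/locally_impl; apply=> z _ u.
have := mxrank_unit u => <-.
exact: leq_trans (mxrankM_maxl _ _) (mxrankM_maxr _ _).
Qed.

(* Near [z0], [1 - F G (E F G)^-1 E] projects onto the left kernel of [F]. *)
Lemma kernel_frame a b (F : T -> 'M[K]_(a, b)) : regular_mx Z F z0 ->
  locally Z z0 (fun z => (\rank (F z) <= \rank (F z0))%N) ->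
  exists P : T -> 'M[K]_a, regular_mx Z P z0 /\
    locally Z z0 (fun z => P z *m F z = 0 /\
      forall c (w : 'M[K]_(c, a)), w *m F z = 0 -> w *m P z = w).
Proof.
move=> Fr Frk; have [E [G EG]] := rank_factor (F z0).
have r1 : regular_mx Z (fun z => E *m F z *m G) z0.
  by apply: regular_mxM => //; [apply: regular_mxM => // |]; apply: regular_mx_cst.
have u1 : E *m F z0 *m G \in unitmx by rewrite EG unitmx1.
exists (fun z => 1%:M - F z *m G *m invmx (E *m F z *m G) *m E); split.
  apply: regular_mxB => //; first exact: regular_mx_cst.
  apply: regular_mxM => //; last exact: regular_mx_cst.
  apply: regular_mxM => //; last exact: regular_invmx.
  by apply: regular_mxM => //; apply: regular_mx_cst.
apply: locally_impl (locally_and Frk (unitmx_near Tc Zz0 r1 u1)) _ => z _ [rk u]; split.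
  have EF : (F z <= E *m F z)%MS.
    have := mxrank_leqif_sup (submxMl E (F z)) => /geq_leqif <-.
    apply: leq_trans rk _; have := mxrankM_maxl (E *m F z) G.
    by rewrite (mxrank_unit u).
  have /submxP [Y YE] := EF.
  have FG : F z *m G = Y *m (E *m F z *m G) by rewrite [X in X *m G]YE !mulmxA.
  by rewrite mulmxBl mul1mx FG mulmxK // -mulmxA -YE subrr.
by move=> c w wF; rewrite mulmxBr mulmx1 !mulmxA wF !mul0mx subr0.
Qed.

Variables (nu : T -> 'rV[K]_(ncoord T)) (Q : {mpoly K[ncoord T]}).
Hypotheses (nuQ : chart nu Q) (zQ0 : chart_dom Q z0).

Definition grad_mx r (p : 'I_r -> {mpoly K[ncoord T]}) (z : T) : 'M[K]_(ncoord T, r) :=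
  \matrix_(i, a) (p a)^`M(i).@[nu z ord0].

Lemma grad_mxE r (p : 'I_r -> {mpoly K[ncoord T]}) z w :
  w *m grad_mx p z = \row_a grad (p a) (nu z) w.
Proof.
apply/rowP => a; rewrite !mxE; apply: eq_bigr => i _.
by rewrite !mxE mulrC.
Qed.

Lemma regular_grad_mx r (p : 'I_r -> {mpoly K[ncoord T]}) : regular_mx Z (grad_mx p) z0.
Proof.
move=> i a; rewrite (_ : (fun y => _) = (fun y => (p a)^`M(i).@[nu y ord0])).
  exact: (regular_poly Tc _ (regular_chart Tc Z nuQ zQ0 ord0)).
by apply/funext => y; rewrite mxE.
Qed.

(* Near [z0] the rank of finitely many gradients cannot drop, so those defining the tangent space *)
(* at [z0] cut out the nearby tangent spaces as soon as these have the same dimension. *)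
Lemma tangent_equations d : locally Z z0 (fun z => rk (tangent Z z) id = d) ->
  exists r (p : 'I_r -> {mpoly K[ncoord T]}),
    [/\ forall a z, Z z -> chart_dom Q z -> (p a).@[nu z ord0] = 0,
        locally Z z0 (fun z => forall w, chart_tangent Z z nu Q w <-> w *m grad_mx p z = 0)
      & locally Z z0 (fun z => \rank (grad_mx p z) = \rank (grad_mx p z0))].
Proof.
move=> dE.
pose I p := forall y, Z y -> chart_dom Q y -> p.@[nu y ord0] = 0.
pose g (p : {mpoly K[ncoord T]}) := \row_i p^`M(i).@[nu z0 ord0].
have [r [M [_ MI IM]]] := finite_span (g @` [set p | I p]).
have /choice [p pE] : forall a, exists p, I p /\ g p = row a M.
  by move=> a; have [p Ip pa] := MI a; exists p.
have sub z w : chart_tangent Z z nu Q w -> w *m grad_mx p z = 0.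
  move=> ww; rewrite grad_mxE; apply/rowP => a; rewrite !mxE.
  by apply: ww => y; apply: (pE a).1.
have Mt : grad_mx p z0 = M^T.
  apply/matrixP => i a; rewrite !mxE; have /rowP/(_ i) := (pE a).2.
  by rewrite !mxE.
have at0 w : chart_tangent Z z0 nu Q w <-> w *m grad_mx p z0 = 0.
  split; first exact: sub.
  rewrite Mt => w0 q Iq.
  have /IM/submxP [c gq] : (g @` [set p | I p]) (g q) by exists q.
  have : w *m (g q)^T = 0 by rewrite gq trmx_mul mulmxA w0 mul0mx.
  move/matrixP/(_ ord0 ord0); rewrite !mxE => <-; apply: eq_bigr => i _.
  by rewrite !mxE mulrC.
have dim z : chart_dom Q z -> Z z -> rk (tangent Z z) id = d ->
    exists k (S : 'M[K]_(k, ncoord T)), [/\ forall w, chart_tangent Z z nu Q w <-> (w <= S)%MS,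
      \rank S = d & (S <= kermx (grad_mx p z))%MS].
  move=> zQ Zz dz; have [k [S SE]] := chart_tangent_mx Z z nu Q.
  exists k, S; split=> //; first by rewrite -(rk_tangent Tc Zz nuQ zQ SE).
  by apply/row_subP => i; apply/sub_kermxP/sub/SE; apply: row_sub.
have [k0 [S0 [S0E S0d S0k]]] := dim z0 zQ0 Zz0 (locally_at dE Zz0).
have d0 : d = (ncoord T - \rank (grad_mx p z0))%N.
  rewrite -S0d -mxrank_ker; apply/eqP; rewrite eqn_leq mxrankS //=.
  apply: mxrankS; apply/row_subP => i; apply/S0E/at0.
  by apply/sub_kermxP; apply: row_sub.
have near : locally Z z0 (fun z => (forall w, chart_tangent Z z nu Q w <-> w *m grad_mx p z = 0) /\
    \rank (grad_mx p z) = \rank (grad_mx p z0)).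
  have zl := locally_open Z (zopen_chart_dom nuQ) zQ0.
  apply: locally_impl (locally_and (locally_and dE zl) (rank_near (regular_grad_mx p))) _.
  move=> z Zz [[dz zQ] rz]; have [k [S [SE Sd Sk]]] := dim z zQ Zz dz.
  have rS : \rank S = \rank (kermx (grad_mx p z)).
    apply/eqP; rewrite eqn_leq mxrankS //= Sd d0 mxrank_ker.
    exact: leq_sub2l.
  split; last first.
    move: rS; rewrite Sd d0 mxrank_ker => /(congr1 (subn (ncoord T))).
    by rewrite !subKn ?rank_leq_row.
  move=> w; split; first exact: sub.
  move=> /sub_kermxP wk; apply/SE; apply: submx_trans wk _.
  have := mxrank_leqif_sup Sk => /geq_leqif <-.
  by rewrite rS.
exists r, p; split.
- by move=> a; apply: (pE a).1.
- by apply: locally_impl near _ => z _ [].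
- by apply: locally_impl near _ => z _ [].
Qed.

(** The nearby tangent spaces are kernels of a gradient matrix of constant rank, so [kernel_frame]
    gives a regular matrix with these spaces as row spaces. *)
Lemma tangent_frame d : locally Z z0 (fun z => rk (tangent Z z) id = d) ->
  exists P : T -> 'M[K]_(ncoord T), regular_mx Z P z0 /\
    locally Z z0 (fun z => forall w, chart_tangent Z z nu Q w <-> (w <= P z)%MS).
Proof.
move=> /tangent_equations [r [p [_ pt pr]]].
have [|P [Pr PE]] := kernel_frame (regular_grad_mx p).
  by apply: locally_impl pr _ => z _ ->.
exists P; split=> //; apply: locally_impl (locally_and pt PE) _ => z _ [tE [P0 P1]] w.
rewrite tE; split=> [/P1 <-|/submxP [D ->]]; first exact: submxMl.
by rewrite -mulmxA P0 mulmx0.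
Qed.

End Frames.

(** * The expanding map is a morphism *)

(** Since [M A = 1], [A M] is idempotent with the forms vanishing on [E] as row space. Right
    multiplication by [1 - A M] is accordingly a normal form for classes of linear forms modulo
    these, that is, for elements of the fibre of Q. *)
Lemma vanishing_proj (K : closedFieldType) N c (M : 'M[K]_(c, N.+1)) A
    (E : {vspace 'cV[K]_N.+1}) s :
  cut_out_by M E -> M *m A = 1%:M -> vanishing E s <-> s *m A *m M = s.
Proof.
move=> ME MA; rewrite (vanishing_sub _ ME); split=> [/submxP [D ->]|<-].
  by rewrite -(mulmxA D) MA mulmx1.
exact: submxMl.
Qed.

Lemma mem_proj (K : closedFieldType) N c (M : 'M[K]_(c, N.+1)) A
    (E : {vspace 'cV[K]_N.+1}) p :
  cut_out_by M E -> p \in E -> (1%:M - A *m M) *m p = p.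
Proof. by move=> ->/eqP Mp; rewrite mulmxBl mul1mx -mulmxA Mp mulmx0 subr0. Qed.

(** * Tangent vectors of the Grassmannian as homomorphisms *)

Section GrLocal.
Variables (K : closedFieldType) (N m : nat) (Z : set (Gr K N m)) (z : Gr K N m).
Variable A : 'M[K]_(N.+1, N - m).
Hypotheses (Zz : Z z) (zA : chart_dom (Gr_Q A) z).

Let Tc : charted (Gr K N m) := @Gr_charted K N m.
Let M := Gr_form A.

Lemma regular_Gr_form : regular_mx Z M z.
Proof.
move=> i j; have := regular_chart Tc Z (Gr_chart A) zA ord0 (mxvec_index i j).
congr regular_at; apply/funext => y.
by have /matrixP/(_ i j) := Gr_nuE A y; rewrite !mxE.
Qed.

Lemma dmx_Gr_form D : dmx D M = vec_mx (dmx D (Gr_nu A)).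
Proof.
apply/matrixP => i j; rewrite !mxE; congr (D _); apply/funext => y.
by have /matrixP/(_ i j) := Gr_nuE A y; rewrite !mxE.
Qed.

(** A section of S satisfies [sigma = sigma A M]; differentiating, the derivative of [sigma A]
    contributes a multiple of [M], which the projection removes. The right side involves [sigma]
    only through its value at [z], so the class in Q does not depend on the extension. *)
Lemma section_derivative D sigma : tangent Z z D -> local_section Z z sigma ->
  dmx D sigma *m (1%:M - A *m M z) = sigma z *m A *m dmx D M.
Proof.
move=> Dt [sr sv].
have sr' : regular_mx Z sigma z by move=> i j; rewrite (ord1 i); apply: sr.
have rA : regular_mx Z (fun y => sigma y *m A) z.
  by apply: regular_mxM => //; apply: regular_mx_cst.
have rM := regular_Gr_form.
have e : dmx D sigma = dmx D (fun y => sigma y *m A *m M y).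
  apply: (dmx_ext Dt) => //; first exact: regular_mxM.
  have zl := locally_open Z (zopen_chart_dom (Gr_chart A)) zA.
  apply: locally_impl (locally_and sv zl) _ => y _ [sy /Gr_dom [ME MA]].
  by rewrite ((vanishing_proj _ ME MA).1 sy).
have e2 : dmx D (fun y => sigma y *m A) = dmx D sigma *m A.
  rewrite (dmxM Tc Dt) //; last exact: regular_mx_cst.
  by rewrite (dmx_cst Tc Dt) mulmx0 addr0.
rewrite mulmxBr mulmx1 mulmxA {1}e (dmxM Tc Dt) // e2.
by rewrite addrC addKr.
Qed.

Lemma local_section_exists s : vanishing (val z) s ->
  exists sigma, local_section Z z sigma /\ sigma z = s.
Proof.
move=> sz; have [ME MA] := Gr_dom zA.
exists (fun y => s *m A *m M y); split; last exact: (vanishing_proj _ ME MA).1.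
split=> [i|].
  have := regular_mxM Tc (regular_mx_cst Tc Z (s *m A) z) regular_Gr_form.
  by move/(_ ord0 i).
apply: locally_impl (locally_open Z (zopen_chart_dom (Gr_chart A)) zA) _.
move=> y _ /Gr_dom [MyE MyA]; apply/(vanishing_proj _ MyE MyA).
by rewrite -(mulmxA (s *m A)) MyA mulmx1.
Qed.

Lemma hom_of_tangent_proj D s : tangent Z z D -> vanishing (val z) s ->
  hom_of_tangent Z z D s *m (1%:M - A *m M z) = s *m A *m dmx D M.
Proof.
move=> Dt sz; rewrite /hom_of_tangent.
have [] : [set sigma | local_section Z z sigma /\ sigma z = s]
    (xget (fun=> 0) [set sigma | local_section Z z sigma /\ sigma z = s]).
  by apply: xgetPex; apply: local_section_exists.
move: (xget _ _) => sigma ls <-.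
rewrite -(section_derivative Dt ls); congr (_ *m _).
by apply/rowP => i; rewrite !mxE.
Qed.

Lemma ker_phiP s : ker_phi Z z s <-> vanishing (val z) s /\
  forall D, tangent Z z D -> s *m A *m dmx D M = 0.
Proof.
have [ME MA] := Gr_dom zA.
have vP k : vanishing (val z) k <-> k *m (1%:M - A *m M z) = 0.
  rewrite (vanishing_proj _ ME MA) mulmxBr mulmx1 mulmxA; split=> [->|/eqP].
    by rewrite subrr.
  by rewrite subr_eq0 => /eqP <-.
split=> -[sz h]; split=> // D Dt.
  by rewrite -hom_of_tangent_proj //; apply/vP/h.
by apply/vP; rewrite hom_of_tangent_proj //; apply: h.
Qed.

Lemma ker_phi_chart s : ker_phi Z z s <-> vanishing (val z) s /\
  forall w, chart_tangent Z z (Gr_nu A) (Gr_Q A) w -> s *m A *m vec_mx w = 0.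
Proof.
rewrite ker_phiP; split=> -[sz h]; split=> //.
  move=> w ww; have [D Dt <-] := tangent_exists Tc Zz (Gr_chart A) zA ww.
  by rewrite -dmx_Gr_form; apply: h.
move=> D Dt; rewrite dmx_Gr_form; apply: h.
exact: (tangent_chart Tc (Gr_chart A) zA Dt).
Qed.

End GrLocal.

Section Expanding.
Variables (K : closedFieldType) (N m mp : nat).
Variables (X Xo : set (Gr K N m)) (gamma : Gr K N m -> Gr K N mp).
Hypothesis em : expanding_map X Xo gamma.

Let Tc : charted (Gr K N m) := @Gr_charted K N m.
Let Tc' : charted (Gr K N mp) := @Gr_charted K N mp.

Lemma Xo_sub x : Xo x -> X x.
Proof. by case: em => -[U _ ->] _ _ _ []. Qed.

Lemma Xo_near x : Xo x -> locally X x Xo.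
Proof.
case: em => -[U Uo XU] _ _ _; rewrite XU => -[Xx Ux].
by exists U; split=> // y Uy Xy; split.
Qed.

(** Smoothness makes the tangent dimension equal to the dimension of [X] at every point of [Xo], and
    [has_dim] determines that number. *)
Lemma Xo_tangent_dim : exists d, forall x, Xo x -> rk (tangent X x) id = d.
Proof.
case: em => _ [x0 Xx0] sm _; exists (rk (tangent X x0) id) => x Xx.
exact: has_dim_uniq (sm x Xx) (sm x0 Xx0).
Qed.

Lemma Xo_frame x0 A : Xo x0 -> chart_dom (Gr_Q A) x0 ->
  exists P : Gr K N m -> 'M[K]_(ncoord (Gr K N m)), regular_mx X P x0 /\
    locally X x0 (fun x => forall w, chart_tangent X x (Gr_nu A) (Gr_Q A) w <-> (w <= P x)%MS).
Proof.
move=> Xx0 x0A; have [d dE] := Xo_tangent_dim.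
apply: (@tangent_frame _ _ Tc _ _ _ _ _ (Gr_chart A) x0A d); first exact: Xo_sub.
by apply: locally_impl (Xo_near Xx0) _ => y _; apply: dE.
Qed.

Lemma Xo_equations x0 A : Xo x0 -> chart_dom (Gr_Q A) x0 ->
  exists r (p : 'I_r -> {mpoly K[ncoord (Gr K N m)]}),
    (forall a x, X x -> chart_dom (Gr_Q A) x -> (p a).@[Gr_nu A x ord0] = 0) /\
    locally X x0 (fun x => forall w, chart_tangent X x (Gr_nu A) (Gr_Q A) w <->
                     forall a, grad (p a) (Gr_nu A x) w = 0).
Proof.
move=> Xx0 x0A; have [d dE] := Xo_tangent_dim.
have [||r [p [p0 pt _]]] := @tangent_equations _ _ Tc X x0 _ _ _ (Gr_chart A) x0A d.
- exact: Xo_sub.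
- by apply: locally_impl (Xo_near Xx0) _ => y _; apply: dE.
exists r, p; split=> //; apply: locally_impl pt _ => x _ tE w.
rewrite tE grad_mxE; split=> [/rowP e a|e]; first by have := e a; rewrite !mxE.
by apply/rowP => a; rewrite !mxE.
Qed.

Lemma gamma_vanishing x A s : Xo x -> chart_dom (Gr_Q A) x ->
  vanishing (val (gamma x)) s <-> vanishing (val x) s /\
    forall w, chart_tangent X x (Gr_nu A) (Gr_Q A) w -> s *m A *m vec_mx w = 0.
Proof.
move=> Xx xA; case: em => _ _ _ /(_ x Xx) ->.
by apply: ker_phi_chart => //; apply: Xo_sub.
Qed.

(** By [gamma_vanishing] the forms in the kernel of phi are [c M] with [c] killed by finitely many
    regular vectors. That system has constant rank because its kernel has dimension [N - mp]
    throughout [Xo], so its kernel has a regular projector, which spreads equations of [gamma x0] to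
    nearby points. *)
Lemma gamma_lift x0 : Xo x0 -> exists G : Gr K N m -> 'M[K]_(N - mp, N.+1),
  regular_mx X G x0 /\ locally X x0 (fun x => cut_out_by (G x) (val (gamma x))).
Proof.
move=> Xx0; have [M0 [A [M0E M0A]]] := Gr_equations x0.
have x0A : chart_dom (Gr_Q A) x0 by apply: Gr_dom_intro M0E _; rewrite M0A unitmx1.
have [P [Pr PE]] := Xo_frame Xx0 x0A.
pose n := ncoord (Gr K N m).
pose J : finType := ('I_n * 'I_N.+1)%type.
(* All frame vectors, read as matrices and placed side by side, so that one left kernel expresses
   the conditions for every tangent vector. *)
pose F x : 'M[K]_(N - m, #|J|) :=
  \matrix_(i, j) (vec_mx (row (enum_val j).1 (P x)) : 'M[K]_(N - m, N.+1)) i (enum_val j).2.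
have Fr : regular_mx X F x0.
  move=> i j; have := Pr (enum_val j).1 (mxvec_index i (enum_val j).2).
  by congr regular_at; apply/funext => y; rewrite !mxE.
have FE x c (w : 'M[K]_(c, N - m)) : w *m F x = 0 <->
    forall k, w *m vec_mx (row k (P x)) = 0.
  split=> [/matrixP w0 k|w0].
    apply/matrixP => i j; have := w0 i (enum_rank (k, j)).
    rewrite !mxE => e; rewrite -[RHS]e; apply: eq_bigr => l _.
    by rewrite [F _ _ _]mxE enum_rankK.
  apply/matrixP => i j; have /matrixP/(_ i (enum_val j).2) := w0 (enum_val j).1.
  rewrite !mxE => e; rewrite -[RHS]e; apply: eq_bigr => l _.
  by rewrite [F _ _ _]mxE.
pose good x := [/\ Xo x, chart_dom (Gr_Q A) x &
  forall w, chart_tangent X x (Gr_nu A) (Gr_Q A) w <-> (w <= P x)%MS].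
have goodl : locally X x0 good.
  have zl := locally_open X (zopen_chart_dom (Gr_chart A)) x0A.
  by apply: locally_impl (locally_and (Xo_near Xx0) (locally_and zl PE)) _ => y _ [? [? ?]].
have vE x : good x -> forall s, vanishing (val (gamma x)) s <->
    vanishing (val x) s /\ s *m A *m F x = 0.
  move=> [Xx xA xP] s; rewrite (gamma_vanishing _ Xx xA) FE.
  split=> -[sx h]; split=> //.
    by move=> k; apply: h; apply/xP; apply: row_sub.
  move=> w /xP /sub_combP [c ->]; rewrite linear_sum mulmx_sumr big1 // => k _.
  by rewrite linearZ -scalemxAr h scaler0.
(* The left kernel of [F x] is carried isomorphically by the independent rows of [Gr_form A x] onto
   the forms vanishing on the mp-plane [gamma x]. *)
have rkF x : good x -> \rank (F x) = (N - m - (N - mp))%N.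
  move=> gx; have [Xx xA xP] := gx; have [ME MA] := Gr_dom xA.
  have [G [A' [GE GA]]] := Gr_equations (gamma x).
  have Mf : row_free (Gr_form A x) by apply/row_freeP; exists A.
  have : \rank (kermx (F x) *m Gr_form A x) = \rank G.
    apply/eqP; rewrite eqn_leq !mxrankS //; last first.
      apply/row_subP => i; apply/(vanishing_sub _ GE)/(vE x gx); split.
        by apply/(vanishing_sub _ ME); rewrite row_mul; apply: submxMl.
      rewrite row_mul -(mulmxA _ _ A) MA mulmx1; apply/sub_kermxP.
      exact: row_sub.
    apply/row_subP => i; have : vanishing (val (gamma x)) (row i G).
      by apply/(vanishing_sub _ GE); apply: row_sub.
    move=> /(vE x gx) [/(vanishing_proj _ ME MA) sx /sub_kermxP k0].
    by rewrite -sx; apply: submxMr.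
  rewrite mxrankMfree // (Gr_rank GE) mxrank_ker => <-.
  by rewrite subKn // rank_leq_row.
have g0 := locally_at goodl (Xo_sub Xx0).
have [|P' [P'r P'E]] := kernel_frame Tc (Xo_sub Xx0) Fr.
  by apply: locally_impl goodl _ => x _ /rkF ->; rewrite rkF.
have [G0 [A' [G0E G0A]]] := Gr_equations (gamma x0).
(* Keep the coordinates of the equations at [x0], project them to the kernel at [x], and turn them
   back into forms; at [x0] nothing changes, so the rows stay independent nearby. *)
pose G x := G0 *m A *m P' x *m Gr_form A x.
have Gr' : regular_mx X G x0.
  apply: regular_mxM => //; last exact: regular_Gr_form.
  by apply: regular_mxM => //; apply: regular_mx_cst.
have rG0 i : vanishing (val (gamma x0)) (row i G0).
  by apply/(vanishing_sub _ G0E); apply: row_sub.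
have G00 : G x0 = G0.
  have [_ P1] := locally_at P'E (Xo_sub Xx0).
  have [ME MA] := Gr_dom x0A.
  rewrite /G P1; last first.
    by apply/row_matrixP => i; rewrite row0 !row_mul; have [_ ->] := (vE _ g0 _).1 (rG0 i).
  apply/row_matrixP => i; rewrite !row_mul.
  by have [/(vanishing_proj _ ME MA)] := (vE _ g0 _).1 (rG0 i).
have rGA : regular_mx X (fun x => G x *m A') x0.
  by apply: regular_mxM => //; apply: regular_mx_cst.
have uG : G x0 *m A' \in unitmx by rewrite G00 G0A unitmx1.
exists G; split=> //.
apply: locally_impl (locally_and (unitmx_near Tc (Xo_sub Xx0) rGA uG) (locally_and goodl P'E)) _.
move=> x _ [uGx [gx [P0 _]]]; have [Xx xA xP] := gx; have [ME MA] := Gr_dom xA.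
have [G1 [A1 [G1E G1A]]] := Gr_equations (gamma x).
have GG1 : (G x <= G1)%MS.
  apply/row_subP => i; apply/(vanishing_sub _ G1E)/(vE x gx); split.
    by apply/(vanishing_sub _ ME); rewrite row_mul; apply: submxMl.
  rewrite /G row_mul -(mulmxA _ _ A) MA mulmx1 -row_mul.
  by rewrite -mulmxA P0 mulmx0 row0.
apply: (cut_out_eqmx G1E); apply/eqmxP; rewrite GG1 /=.
have := mxrank_leqif_sup GG1 => /geq_leqif <-.
by rewrite (Gr_rank G1E); have := mxrankM_maxl (G x) A'; rewrite (mxrank_unit uGx).
Qed.

Lemma gamma_morphism x0 : Xo x0 -> morphism_at X (expanded_image Xo gamma) gamma x0.
Proof.
move=> Xx0; have [G [Gr' GE]] := gamma_lift Xx0.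
apply: (@morphism_lift _ _ _ Tc Tc' _ _ _ _ (fun x => mxvec (G x))).
- exact: Xo_sub.
- move=> i j; rewrite (ord1 i); case/mxvec_indexP: j => a b.
  have := Gr' a b; congr regular_at; apply/funext => y.
  by rewrite mxvecE.
apply: locally_impl (locally_and (Xo_near Xx0) GE) _ => x _ [Xx Gx]; split.
  by rewrite /= mxvecK.
by apply: zclosure_sub; exists x.
Qed.

End Expanding.

(** * The generalized conormal variety *)

Lemma dual_coords_uniq (K : closedFieldType) N (s : 'rV[K]_N.+1) (H H' : dualP K N) :
  coords (s := dualP K N) s H -> coords (s := dualP K N) s H' -> H = H'.
Proof.
by move=> sH sH'; apply: val_inj; apply/vspaceP => p; rewrite sH sH'.
Qed.

Lemma dual_coords_neq0 (K : closedFieldType) N (s : 'rV[K]_N.+1) (H : dualP K N) :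
  coords (s := dualP K N) s H -> s != 0.
Proof.
move=> /cut_out_rank; rewrite (eqP (valP H)) -[RHS]addn1 => /addnI.
by apply: contra_eqN => /eqP ->; rewrite mxrank0.
Qed.

Lemma regular_dual_nu (K : closedFieldType) N (Z : set (dualP K N)) a H :
  chart_dom (dual_Q a) H -> regular_mx Z (dual_nu a) H.
Proof. by move=> Ha; apply: regular_chart (dual_chart a) Ha; apply: dual_charted. Qed.

Section GenericConormal.
Variables (K : closedFieldType) (N m mp : nat).
Variables (X Xo : set (Gr K N m)) (gamma : Gr K N m -> Gr K N mp).
Hypothesis em : expanding_map X Xo gamma.
Hypotheses (Xc : zclosed X) (Xi : zirreducible X).

Let Tc : charted (Gr K N m) := @Gr_charted K N m.
Let Dc : charted (dualP K N) := @dual_charted K N.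
Let Pc : charted (prod_space (Gr K N m) (dualP K N)) := prod_charted Tc Dc.

Local Notation V := (gen_conormal Xo gamma).

(** The part of the generalized conormal variety over [Xo], dense in it and described by incidence
    alone. *)
Definition open_conormal : set (prod_space (Gr K N m) (dualP K N)) :=
  [set v | Xo v.1 /\ (val (gamma v.1) <= val v.2)%VS].
Local Notation V0 := open_conormal.

Lemma open_conormal_sub v : V0 v -> V v.
Proof.
move=> [Xv gv]; apply: zclosure_sub; split=> //; split=> //=.
by apply: zclosure_sub; exists v.1.
Qed.

Lemma gen_conormal_meets v U : V v -> zopen U -> U v -> exists2 w, V0 w & U w.
Proof.
move=> Vv Uo Uv; have [w [Xw [_ gw]] Uw] := zclosure_meets Vv Uo Uv.
by exists w.
Qed.

Lemma gen_conormal_fst v : V v -> X v.1.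
Proof.
move=> Vv; apply: (Vv [set v : prod_space _ _ | X v.1]); first exact: zclosed_fst.
by move=> w [Xw _]; apply: (Xo_sub em).
Qed.

Lemma regular_gamma_form x A : Xo x -> chart_dom (Gr_Q A) (gamma x) ->
  regular_mx X (fun y => Gr_form A (gamma y)) x.
Proof.
move=> Xx xA; apply: regular_mx_pull (gamma_morphism em Xx) _.
exact: regular_Gr_form.
Qed.

Lemma gamma_near x A : Xo x -> chart_dom (Gr_Q A) (gamma x) ->
  locally X x (fun y => Xo y /\ chart_dom (Gr_Q A) (gamma y)).
Proof.
move=> Xx xA; apply: locally_and; first exact: (Xo_near em Xx).
have [_ go _] := gamma_morphism em Xx; apply: go => //.
exact: (zopen_chart_dom (Gr_chart A)).
Qed.

Section Pull.
Variables (Z : set (prod_space (Gr K N m) (dualP K N))) (v : prod_space (Gr K N m) (dualP K N)).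
Hypotheses (ZX : forall w, Z w -> X w.1) (Zv : Z v).

Lemma regular_fst b c (F : Gr K N m -> 'M[K]_(b, c)) : regular_mx X F v.1 ->
  regular_mx Z (fun w : prod_space (Gr K N m) (dualP K N) => F w.1) v.
Proof. exact: regular_mx_pull (morphism_fst Tc Dc Zv ZX). Qed.

Lemma locally_fst P : locally X v.1 P ->
  locally Z v (fun w : prod_space (Gr K N m) (dualP K N) => P w.1).
Proof. exact: locally_pull (morphism_fst Tc Dc Zv ZX). Qed.

Lemma regular_snd b c (F : dualP K N -> 'M[K]_(b, c)) : regular_mx setT F v.2 ->
  regular_mx Z (fun w : prod_space (Gr K N m) (dualP K N) => F w.2) v.
Proof. by apply: regular_mx_pull (morphism_snd Tc Dc (X := setT) Zv _). Qed.

Lemma locally_snd P : locally [set: dualP K N] v.2 P ->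
  locally Z v (fun w : prod_space (Gr K N m) (dualP K N) => P w.2).
Proof. by apply: locally_pull (morphism_snd Tc Dc (X := setT) Zv _). Qed.

End Pull.

(** Near [v] the incidence is the vanishing of the regular row [f], the equation of the hyperplane
    projected by [1 - A G]. A nonzero entry at [v] would stay nonzero on a neighbourhood, which
    meets [open_conormal], where [f] is zero. Taking the closure thus adds no points over [Xo]. *)
Lemma gen_conormal_star v : V v -> Xo v.1 -> (val (gamma v.1) <= val v.2)%VS.
Proof.
move=> Vv Xv; have [G0 [A [G0E G0A]]] := Gr_equations (gamma v.1).
have [h0 [a [h0E h0a]]] := dual_equation v.2.
have gA : chart_dom (Gr_Q A) (gamma v.1) by apply: Gr_dom_intro G0E _; rewrite G0A unitmx1.
have ha : chart_dom (dual_Q a) v.2 by apply: dual_dom_intro h0E _; rewrite h0a unitmx1.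
pose Z := [set w : prod_space (Gr K N m) (dualP K N) | X w.1].
have ZX w : Z w -> X w.1 by [].
have Zv : Z v by apply: gen_conormal_fst.
pose f (w : prod_space (Gr K N m) (dualP K N)) :=
  dual_nu a w.2 *m (1%:M - A *m Gr_form A (gamma w.1)).
have fr : regular_mx Z f v.
  apply: (regular_mxM Pc).
    by apply: (regular_snd Zv); apply: regular_dual_nu.
  apply: (regular_mxB Pc); first exact: regular_mx_cst.
  apply: (regular_mxM Pc); first exact: regular_mx_cst.
  by apply: (regular_fst ZX Zv (F := fun y => Gr_form A (gamma y))); apply: regular_gamma_form.
have loc : locally Z v (fun w => (Xo w.1 /\ chart_dom (Gr_Q A) (gamma w.1)) /\ chart_dom (dual_Q a) w.2).
  apply: locally_and; first exact: (locally_fst ZX Zv (gamma_near Xv gA)).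
  by apply: (locally_snd Zv); apply: locally_open => //; apply: (zopen_chart_dom (dual_chart a)).
have fE w : Z w -> (Xo w.1 /\ chart_dom (Gr_Q A) (gamma w.1)) /\ chart_dom (dual_Q a) w.2 ->
    (val (gamma w.1) <= val w.2)%VS <-> f w = 0.
  move=> _ [[_ /Gr_dom [GE GA]] /dual_dom [hE _]].
  rewrite (subv_cut_out GE hE) -(vanishing_sub _ GE) (vanishing_proj _ GE GA) /f.
  rewrite mulmxBr mulmx1 mulmxA; split=> [->|/eqP]; first by rewrite subrr.
  by rewrite subr_eq0 => /eqP <-.
apply/(fE v Zv (locally_at loc Zv)).
apply/rowP => j; apply: contrapT => /eqP; rewrite [X in _ != X]mxE => fj.
have [U [Uo Uv UE]] := locally_and loc (regular_neq0 Pc Zv (fr ord0 j) fj).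
have [w [Xw gw] Uw] := gen_conormal_meets Vv Uo Uv.
have Zw : Z w by apply: (Xo_sub em).
have [lw fw] := UE w Uw Zw; move: fw.
by rewrite ((fE w Zw lw).1 gw) mxE eqxx.
Qed.

Lemma open_conormalE v : V v -> Xo v.1 -> V0 v.
Proof. by move=> Vv Xv; split=> //; apply: gen_conormal_star. Qed.

Lemma open_conormal_near v : V0 v -> locally V v V0.
Proof.
move=> V0v; have Vv := open_conormal_sub V0v; have [Xv _] := V0v.
have := locally_fst gen_conormal_fst Vv (Xo_near em Xv).
by move=> /locally_impl; apply=> w Vw Xw; apply: open_conormalE.
Qed.

(** A local section through [v], obtained by freezing the coordinates [s A] of the hyperplane
    equation with respect to the equations of [gamma x]. *)
Lemma section_morphism v A : V0 v -> chart_dom (Gr_Q A) (gamma v.1) ->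
  exists psi : Gr K N m -> prod_space (Gr K N m) (dualP K N),
    [/\ psi v.1 = v, forall x, (psi x).1 = x, morphism_at X V psi v.1
      & locally X v.1 (fun x => V0 (psi x))].
Proof.
move=> [Xv gv] vA; have [s [a [sE sa]]] := dual_equation v.2.
have [GE GA] := Gr_dom vA.
have sv : vanishing (val (gamma v.1)) s.
  by apply/(vanishing_sub _ GE); rewrite -(subv_cut_out GE sE).
pose sig y := s *m A *m Gr_form A (gamma y).
have sig0 : sig v.1 = s by apply: (vanishing_proj _ GE GA).1.
pose hyp y := xget v.2 [set H : dualP K N | coords (s := dualP K N) (sig y) H].
pose psi y : prod_space (Gr K N m) (dualP K N) := (y, hyp y).
have hypE y : sig y != 0 -> coords (s := dualP K N) (sig y) (hyp y).
  by move=> /form_kernel [H HE]; apply: (xgetPex v.2 (P := [set H | coords (s := dualP K N) (sig y) H])); exists H.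
have psi0 : psi v.1 = v.
  rewrite [RHS]surjective_pairing; congr (_, _); apply: (@dual_coords_uniq _ _ s) => //.
  by rewrite -sig0; apply: hypE; rewrite sig0; apply: dual_coords_neq0 sE.
have Xxv := Xo_sub em Xv.
have sigr : regular_mx X sig v.1.
  by apply: (regular_mxM Tc); [apply: regular_mx_cst | apply: regular_gamma_form].
have loc : locally X v.1 (fun x => V0 (psi x) /\ sig x != 0).
  have [j sj] : exists j, s ord0 j != 0.
    apply: contrapT => ns; have /eqP := dual_coords_neq0 sE; apply.
    by apply/rowP => j; rewrite mxE; apply: contrapT => /eqP sj; apply: ns; exists j.
  have n0 := regular_neq0 Tc Xxv (sigr ord0 j); rewrite sig0 in n0.
  apply: locally_impl (locally_and (n0 sj) (gamma_near Xv vA)) _ => y Xy [sy [Xoy yA]].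
  have sy0 : sig y != 0 by apply: contraNneq sy => ->; rewrite mxE.
  split=> //; split=> //=; have [GyE _] := Gr_dom yA.
  by rewrite (subv_cut_out GyE (hypE y sy0)); apply: submxMl.
exists psi; split=> //; last by apply: locally_impl loc _ => y _ [].
have [M0 [B [M0E M0B]]] := Gr_equations v.1.
have vB : chart_dom (Gr_Q B) v.1 by apply: Gr_dom_intro M0E _; rewrite M0B unitmx1.
apply: (@morphism_lift _ _ _ Tc Pc _ _ _ _ (fun y => row_mx (Gr_nu B y) (sig y))) => //.
  move=> i j; case: (splitP j) => k jk.
    have -> : j = lshift (N.+1) k by apply: val_inj.
    have := regular_chart Tc X (Gr_chart B) vB i k.
    by congr regular_at; apply/funext => y; rewrite row_mxEl.
  have -> : j = rshift (ncoord (Gr K N m)) k by apply: val_inj.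
  have := sigr i k.
  by congr regular_at; apply/funext => y; rewrite row_mxEr.
have zl := locally_open X (zopen_chart_dom (Gr_chart B)) vB.
apply: locally_impl (locally_and loc zl) _ => y _ [[V0y sy] yB]; split.
  rewrite /= row_mxKl row_mxKr; split; first exact: (chart_coords (Gr_chart B) yB).
  exact: hypE.
exact: open_conormal_sub.
Qed.

Lemma open_conormal_spread v (U : set (prod_space (Gr K N m) (dualP K N))) : V0 v -> zopen U -> U v ->
  locally X v.1 (fun x => exists2 H, V0 (x, H) & U (x, H)).
Proof.
move=> V0v Uo Uv; have [G0 [A [G0E G0A]]] := Gr_equations (gamma v.1).
have vA : chart_dom (Gr_Q A) (gamma v.1) by apply: Gr_dom_intro G0E _; rewrite G0A unitmx1.
have [psi [psi0 psi1 [_ psio _] psiV]] := section_morphism V0v vA.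
have Upsi : locally X v.1 (fun x => U (psi x)) by apply: psio => //; rewrite psi0.
apply: locally_impl (locally_and psiV Upsi) _ => x _ [Vx Ux].
by exists (psi x).2; rewrite -[x in (x, _)]psi1 -surjective_pairing.
Qed.

(** The fibre over [x] is a projective space: the pencil spanned by the two hyperplanes stays in it,
    and two nonempty open subsets of a line meet. *)
Lemma fibre_meets x H1 H2 (U1 U2 : set (prod_space (Gr K N m) (dualP K N))) : V0 (x, H1) -> V0 (x, H2) -> zopen U1 -> zopen U2 ->
  U1 (x, H1) -> U2 (x, H2) -> exists H, [/\ V0 (x, H), U1 (x, H) & U2 (x, H)].
Proof.
move=> [/= Xx gH1] [/= _ gH2] U1o U2o UH1 UH2.
have [s [_ [sE _]]] := dual_equation H1; have [s' [_ [sE' _]]] := dual_equation H2.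
have [u ux] := Tc.1 x.
have c1 : coords (s := prod_space (Gr K N m) (dualP K N)) (row_mx u s) (x, H1).
  by rewrite /= row_mxKl row_mxKr.
have c2 : coords (s := prod_space (Gr K N m) (dualP K N)) (row_mx u s') (x, H2).
  by rewrite /= row_mxKl row_mxKr.
have [r1 [r1n r1U]] := zopen_nbhd U1o UH1 c1; have [r2 [r2n r2U]] := zopen_nbhd U2o UH2 c2.
have [j sj] : exists j, s ord0 j != 0.
  apply: contrapT => ns; have /eqP := dual_coords_neq0 sE; apply.
  by apply/rowP => j; rewrite mxE; apply: contrapT => /eqP sj; apply: ns; exists j.
(* The extra coordinate factor excludes parameters for which the combination of the two equations is
   zero and defines no hyperplane. *)
have r1n' : (r1 * 'X_(rshift _ j)).@[(row_mx u s) ord0] != 0.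
  by rewrite mevalM mulf_neq0 // mevalXU row_mxEr.
have [c [pc qc]] := segment_neq0 r1n' r2n.
have e : (1 - c) *: row_mx u s + c *: row_mx u s' = row_mx u ((1 - c) *: s + c *: s').
  by rewrite !scale_row_mx add_row_mx -scalerDl subrK scale1r.
move: pc qc; rewrite e mevalM mulf_eq0 negb_or mevalXU row_mxEr => /andP[pc sc] qc.
have [|H HE] := form_kernel (s := (1 - c) *: s + c *: s').
  by apply: contraNneq sc => ->; rewrite mxE.
have cH : coords (s := prod_space (Gr K N m) (dualP K N)) (row_mx u ((1 - c) *: s + c *: s')) (x, H).
  by rewrite /= row_mxKl row_mxKr.
exists H; split; [|exact: r1U cH pc|exact: r2U cH qc].
split=> //=; have [G [_ [GE _]]] := Gr_equations (gamma x).
rewrite (subv_cut_out GE HE); apply: addmx_sub; apply: scalemx_sub.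
  by rewrite -(subv_cut_out GE sE).
by rewrite -(subv_cut_out GE sE').
Qed.

(** Irreducible base, irreducible fibres, local sections: two open sets meeting [V] project onto
    neighbourhoods in [X], hence share a fibre, in which they meet. *)
Lemma gen_conormal_irreducible : V !=set0 -> zirreducible V.
Proof.
move=> V0ne; split=> // A B Ac Bc VAB; apply: contrapT => /not_orP [nA nB].
have ex C : ~ (V `<=` C) -> exists2 v, V v & (~` C) v.
  by move=> nC; apply: contrapT => h; apply: nC => v Vv; apply: contrapT => nCv; apply: h; exists v.
have [a Va nAa] := ex A nA; have [b Vb nBb] := ex B nB.
have Ao := zclosed_setC Ac; have Bo := zclosed_setC Bc.
have [v1 V1 A1] := gen_conormal_meets Va Ao nAa; have [v2 V2 B2] := gen_conormal_meets Vb Bo nBb.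
have g1 := irreducible_generally Xi (Xo_sub em V1.1) (open_conormal_spread V1 Ao A1).
have g2 := irreducible_generally Xi (Xo_sub em V2.1) (open_conormal_spread V2 Bo B2).
have [|x Xx [[H1 VH1 AH1] [H2 VH2 BH2]]] := generally_ex _ (generally_and g1 g2).
  by exists v1.1; apply: (Xo_sub em V1.1).
have [H [VH AH BH]] := fibre_meets VH1 VH2 Ao Bo AH1 BH2.
by have [] := VAB _ (open_conormal_sub VH).
Qed.

End GenericConormal.

(** * Ranks of the differentials *)

Lemma locally_locally (K : closedFieldType) (T : Defs.space K) (Z : set T) z P :
  locally Z z P -> locally Z z (fun y => locally Z y P).
Proof. by move=> [U [Uo Uz UP]]; exists U; split=> // y Uy Zy; exists U; split. Qed.

Section TangentRanks.
Variables (K : closedFieldType) (N m mp : nat).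
Variables (X Xo : set (Gr K N m)) (gamma : Gr K N m -> Gr K N mp).
Hypothesis em : expanding_map X Xo gamma.
Hypothesis Xc : zclosed X.

Let Tc : charted (Gr K N m) := @Gr_charted K N m.
Let Tc' : charted (Gr K N mp) := @Gr_charted K N mp.
Let Dc : charted (dualP K N) := @dual_charted K N.
Let Pc : charted (prod_space (Gr K N m) (dualP K N)) := prod_charted Tc Dc.

Local Notation P := (prod_space (Gr K N m) (dualP K N)).
Local Notation V := (gen_conormal Xo gamma).
Local Notation V0 := (open_conormal Xo gamma).

Section AtPoint.
Variables (v : P) (A : 'M[K]_(N.+1, N - mp)) (a : 'cV[K]_N.+1).
Hypotheses (V0v : V0 v) (vA : chart_dom (Gr_Q A) (gamma v.1)) (va : chart_dom (dual_Q a) v.2).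

Let x := v.1.
Let G y := Gr_form A (gamma y).
Let h (w : P) := dual_nu a w.2.
Let Vv : V v := open_conormal_sub V0v.
Let Xx : X x := Xo_sub em V0v.1.
Let Xox : Xo x := V0v.1.
Let VX := gen_conormal_fst em Xc.
Let Gr' : regular_mx X G x. Proof. exact: (regular_gamma_form em V0v.1 vA). Qed.
Let hr : regular_mx V h v.
Proof. by apply: (regular_snd Vv); apply: regular_dual_nu. Qed.
Let GE : cut_out_by (G x) (val (gamma x)). Proof. by case: (Gr_dom vA). Qed.
Let GA : G x *m A = 1%:M. Proof. by case: (Gr_dom vA). Qed.
Let hE : cut_out_by (h v) (val v.2). Proof. by case: (dual_dom va). Qed.
Let ha : h v *m a = 1%:M. Proof. by case: (dual_dom va). Qed.

Lemma conormal_form_sub : (h v <= G x)%MS.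
Proof. by rewrite -(subv_cut_out GE hE); case: V0v. Qed.

(* The pairing of [dgamma(t)] with the equation of the hyperplane, as an element of Q. *)
Definition conormal_pairing (t : (Gr K N m -> K) -> K^o) : 'rV[K]_N.+1 :=
  dual_nu a v.2 *m A *m dmx t (fun y => Gr_form A (gamma y)).
Local Notation beta := conormal_pairing.

Lemma conormal_pairing_comb c t t' : beta (c *: t + t') = c *: beta t + beta t'.
Proof. by rewrite /beta dmx_comb mulmxDr -scalemxAr. Qed.

Lemma dmx_gamma_proj t : tangent X x t -> dmx t G *m A = 0.
Proof.
move=> tt; have rc := regular_mx_cst Tc X A x.
have := dmxM Tc tt Gr' rc; rewrite (dmx_cst Tc tt) mulmx0 addr0 => <-.
rewrite -(dmx_cst Tc tt (1%:M : 'M_(N - mp))); apply: (dmx_ext tt).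
- exact: regular_mxM.
- exact: regular_mx_cst.
by apply: locally_impl (gamma_near em Xox vA) _ => y _ [_ /Gr_dom []].
Qed.

(** Differentiating [G A = 1] gives [dG A = 0], so the pairing is already in normal form modulo the
    equations of [gamma x]. *)
Lemma conormal_pairing_proj t : tangent X x t -> beta t *m (1%:M - A *m G x) = beta t.
Proof.
move=> tt; rewrite mulmxBr mulmx1 mulmxA -(mulmxA _ _ A) dmx_gamma_proj //.
by rewrite mulmx0 mul0mx subr0.
Qed.

Let fst_m : morphism_at V X (fun w : P => w.1) v.
Proof. exact: morphism_fst. Qed.

(** The two conditions are the derivatives of [h a = 1] and [h = h A G], which hold along [V] near
    [v]. *)
Lemma tangent_conormal D : tangent V v D ->
  dmx D h *m a = 0 /\
  dmx D h *m (1%:M - A *m G x) = beta (differential X (fun w : P => w.1) v D).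
Proof.
move=> Dt; have rc b c (M : 'M[K]_(b, c)) := regular_mx_cst Pc V M v.
split.
  have := dmxM Pc Dt hr (rc _ _ a); rewrite (dmx_cst Pc Dt) mulmx0 addr0 => <-.
  rewrite -(dmx_cst Pc Dt (1%:M : 'M_1)); apply: (dmx_ext Dt) => //.
    exact: regular_mxM.
  have := locally_snd Vv (locally_open setT (zopen_chart_dom (dual_chart a)) va).
  by move/locally_impl; apply => w _ /dual_dom [].
have rG : regular_mx V (fun w : P => G w.1) v by apply: (regular_fst VX Vv).
have rhA : regular_mx V (fun w => h w *m A) v by apply: regular_mxM.
have e : dmx D h = dmx D (fun w => h w *m A *m G w.1).
  apply: (dmx_ext Dt) => //; first exact: regular_mxM.
  have l1 := open_conormal_near em Xc V0v.
  have l2 := locally_fst VX Vv (gamma_near em Xox vA).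
  have l3 := locally_snd Vv (locally_open setT (zopen_chart_dom (dual_chart a)) va).
  apply: locally_impl (locally_and l1 (locally_and l2 l3)) _.
  move=> w _ [[_ gw] [[_ /Gr_dom [GwE GwA]] /dual_dom [hwE _]]].
  rewrite ((vanishing_proj _ GwE GwA).1 _) //; apply/(vanishing_sub _ GwE).
  by rewrite -(subv_cut_out GwE hwE).
have e2 : dmx D (fun w => h w *m A) = dmx D h *m A.
  by rewrite (dmxM Pc Dt) // (dmx_cst Pc Dt) mulmx0 addr0.
rewrite /beta dmx_differential; last exact: Gr'.
by rewrite mulmxBr mulmx1 mulmxA {1}e (dmxM Pc Dt) // e2 addrC addKr.
Qed.

(** With [x] fixed, the line of equations [h + c k] remains normalized and vanishes on [gamma x]. It
    therefore lies in the chart image of [V], and its direction [(0, k)] is killed by the gradients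
    of all equations. *)
Lemma vertical_tangent k : vanishing (val (gamma x)) k -> k *m a = 0 ->
  exists2 D, tangent V v D & dmx D h = k.
Proof.
move=> kv ka; have [M0 [B [M0E M0B]]] := Gr_equations x.
have xB : chart_dom (Gr_Q B) x by apply: Gr_dom_intro M0E _; rewrite M0B unitmx1.
have pQ := prod_chart (Gr_chart B) (dual_chart a).
have vQ : chart_dom (prod_Q (Gr_Q B) (dual_Q a)) v by apply/prod_chart_dom.
pose w : 'rV[K]_(ncoord P) := row_mx (0 : 'rV_(ncoord (Gr K N m))) k.
have ww : chart_tangent V v (prod_nu (Gr_nu B) (dual_nu a)) (prod_Q (Gr_Q B) (dual_Q a)) w.
  move=> p p0; apply: grad_line0 => c.
  have e : (h v + c *: k) *m a = 1%:M by rewrite mulmxDl ha -scalemxAl ka scaler0 addr0.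
  have [|H HE] := form_kernel (s := h v + c *: k).
    apply/eqP => e0; move: e; rewrite e0 mul0mx => /matrixP/(_ ord0 ord0).
    by rewrite !mxE => /eqP; rewrite eq_sym oner_eq0.
  have Va : chart_dom (dual_Q a) H by apply: dual_dom_intro HE _; rewrite e unitmx1.
  have V0H : V0 (x, H).
    split=> //=; rewrite (subv_cut_out GE HE); apply: addmx_sub; first exact: conormal_form_sub.
    by apply: scalemx_sub; apply/(vanishing_sub _ GE).
  have dQ : chart_dom (prod_Q (Gr_Q B) (dual_Q a)) ((x, H) : P) by apply/prod_chart_dom.
  have := p0 (x, H) (open_conormal_sub V0H) dQ.
  rewrite /prod_nu /= (dual_nu_uniq HE e) => <-; congr meval.
  by rewrite scale_row_mx add_row_mx scaler0 addr0.
have [D Dt Dw] := tangent_exists Pc Vv pQ vQ ww.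
exists D => //; apply/rowP => j.
have /rowP/(_ (rshift (ncoord (Gr K N m)) j)) := Dw.
rewrite row_mxEr mxE => <-; rewrite mxE; congr (D _); apply/funext => y.
by rewrite row_mxEr.
Qed.

Lemma lift_tangent t : tangent X x t ->
  exists2 D, tangent V v D & dmx D h *m (1%:M - A *m G x) = beta t.
Proof.
move=> tt; have [psi [psi0 psi1 psim psiV]] := section_morphism em V0v vA.
have Dt := tangent_differential Pc psim tt; rewrite psi0 in Dt.
exists (differential V psi x t) => //.
have [_ ->] := tangent_conormal Dt.
rewrite /beta dmx_differential; last exact: Gr'.
rewrite dmx_differential; last first.
  by rewrite psi0; apply: (regular_fst VX Vv (F := G)).
by congr (_ *m dmx t _); apply/funext => y; rewrite psi1.
Qed.

Lemma conormal_pairing_mx : exists r (B : 'M[K]_(r, N.+1)),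
  [/\ row_free B, forall i, exists2 t, tangent X x t & beta t = row i B,
      forall t, tangent X x t -> (beta t <= B)%MS
    & forall w, (w <= B)%MS -> exists2 t, tangent X x t & beta t = w].
Proof.
have [r [B [Bf BT TB]]] := finite_span (beta @` tangent X x).
have Bt i : exists2 t, tangent X x t & beta t = row i B.
  by have [t tt tE] := BT i; exists t.
exists r, B; split=> // [t tt|w /sub_combP [c ->]]; first by apply: TB; exists t.
elim/big_ind: _ => [|w1 w2 [t1 tt1 <-] [t2 tt2 <-]|i _].
- exists (fun=> 0); first exact: tangent0.
  by apply/rowP => i; rewrite !mxE big1 // => j _; rewrite !mxE mulr0.
- exists (1 *: t1 + t2); first exact: tangent_comb.
  by rewrite conormal_pairing_comb scale1r.
have [t tt <-] := Bt i; exists (c i *: t + (fun=> 0)).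
  by apply: tangent_comb => //; apply: tangent0.
rewrite conormal_pairing_comb; apply/rowP => j; rewrite !mxE [X in _ + X]big1 ?addr0 // => k _.
by rewrite !mxE mulr0.
Qed.

(** In the chart the image of the differential is [(G + B) :&: kermx a], where the rows of [B] are a
    basis of the values of the pairing. The sum is direct, of dimension [N - mp + r], and the
    condition [k a = 0] lowers it by one since [h a = 1] for a row [h] of the sum. *)
Lemma rk_conormal : (0 < N - mp)%N /\
  rk (tangent V v) (differential [set: dualP K N] (@pibar K N m) v) =
    (N - mp - 1 + rk (tangent X x) beta)%N.
Proof.
have [r [B [Bf Bt TB BT]]] := conormal_pairing_mx.
have -> : rk (tangent X x) beta = r by rewrite (rk_rV TB BT); apply/eqP.
have rG := Gr_rank GE.
have snd_m : morphism_at V [set: dualP K N] (@pibar K N m) v by apply: morphism_snd.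
rewrite (rk_differential Dc (dual_chart a) va Vv _ snd_m) //.
have BP : B *m (1%:M - A *m G x) = B.
  by apply/row_matrixP => i; rewrite row_mul; have [t tt <-] := Bt i; apply: conormal_pairing_proj.
have GP : G x *m (1%:M - A *m G x) = 0 by rewrite mulmxBr mulmx1 mulmxA GA mul1mx subrr.
(* [1 - A G] kills the rows of [G] and fixes those of [B]. *)
have GB0 : (G x :&: B)%MS = 0.
  apply/eqP/rowV0P => w; rewrite sub_capmx => /andP[/submxP [c wG] /submxP [d wB]].
  have : w *m (1%:M - A *m G x) = 0 by rewrite wG -mulmxA GP mulmx0.
  by rewrite wB -mulmxA BP => ->.
have rGB : \rank (G x + B)%MS = (N - mp + r)%N.
  by have := mxrank_sum_cap (G x) B; rewrite GB0 mxrank0 addn0 rG (eqP Bf).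
have ra : \rank ((G x + B)%MS *m a) = 1%N.
  apply/eqP; rewrite eqn_leq rank_leq_col lt0n mxrank_eq0; apply/eqP => e.
  have /submxP [d hd] : (h v <= G x + B)%MS.
    by apply: submx_trans conormal_form_sub _; apply: addsmxSl.
  move: ha; rewrite hd -mulmxA e mulmx0 => /matrixP/(_ ord0 ord0).
  by rewrite !mxE => /eqP; rewrite eq_sym oner_eq0.
have N1 : (0 < N - mp)%N.
  rewrite -rG lt0n mxrank_eq0; apply/eqP => G0; have := conormal_form_sub.
  rewrite G0 => /submxP [d]; rewrite mulmx0 => h0.
  move: ha; rewrite h0 mul0mx => /matrixP/(_ ord0 ord0).
  by rewrite !mxE => /eqP; rewrite eq_sym oner_eq0.
split=> //; rewrite (@rk_rV _ _ _ _ _ _ ((G x + B)%MS :&: kermx a)%MS).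
- have := mxrank_mul_ker (G x + B)%MS a; rewrite ra rGB => e.
  by apply/eqP; rewrite -(eqn_add2l 1) e addnA subnKC.
- move=> D Dt; have [e1 e2] := tangent_conormal Dt; rewrite sub_capmx; apply/andP; split; last first.
    exact/sub_kermxP.
  have -> : dmx D (fun y => dual_nu a (pibar y)) = dmx D h by [].
  have -> : dmx D h = dmx D h *m A *m G x + dmx D h *m (1%:M - A *m G x).
    by rewrite mulmxBr mulmx1 mulmxA addrC subrK.
  apply: addmx_sub_adds; first exact: submxMl.
  by rewrite e2; apply: TB; apply: (tangent_differential Tc fst_m Dt).
move=> w; rewrite sub_capmx => /andP[wGB /sub_kermxP wa].
have wP : (w *m (1%:M - A *m G x) <= B)%MS.
  have /sub_addsmxP [[c d] /= ->] := wGB.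
  by rewrite mulmxDl -!mulmxA GP BP mulmx0 add0r submxMl.
have [t tt tw] := BT _ wP; have [D1 D1t D1w] := lift_tangent tt.
have [D1a _] := tangent_conormal D1t.
(* The lift [D1] has the right class modulo [G]; the remaining difference is vertical. *)
have [||D2 D2t D2w] := @vertical_tangent (w - dmx D1 h).
- apply/(vanishing_proj _ GE GA).
  have : (w - dmx D1 h) *m (1%:M - A *m G x) = 0 by rewrite mulmxBl D1w tw subrr.
  by rewrite mulmxBr mulmx1 mulmxA => /eqP; rewrite subr_eq0 => /eqP <-.
- by rewrite mulmxBl wa D1a subrr.
exists (1 *: D1 + D2); first exact: tangent_comb.
have -> : dmx (1 *: D1 + D2) (fun y => dual_nu a (pibar y)) = dmx (1 *: D1 + D2) h by [].
by rewrite dmx_comb scale1r D2w addrC subrK.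
Qed.

Let dgamma_m : morphism_at X (expanded_image Xo gamma) gamma x.
Proof. exact: gamma_morphism. Qed.

Let dgammaE : rk (tangent X x) (dgamma Xo gamma x) =
  rk (tangent X x) (fun t => dmx t (fun y => Gr_nu A (gamma y))).
Proof.
apply: (rk_differential Tc' (Gr_chart A) vA Xx _ dgamma_m).
by apply: zclosure_sub; exists x.
Qed.

Let dmx_formE (t : (Gr K N m -> K) -> K^o) : dmx t G = vec_mx (dmx t (fun y => Gr_nu A (gamma y))).
Proof.
apply/matrixP => i j; rewrite !mxE; congr (t _); apply/funext => y.
by have /matrixP/(_ i j) := Gr_nuE A (gamma y); rewrite !mxE.
Qed.

Lemma rk_pairing_dgamma : (rk (tangent X x) beta <= rk (tangent X x) (dgamma Xo gamma x))%N.
Proof.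
rewrite dgammaE; apply: rk_leq; first exact: has_rank_rV.
move=> k e [et ei]; exists e; split=> // c c0; apply: ei; rewrite /beta.
under eq_bigr => i _ do rewrite scalemxAr.
rewrite -mulmx_sumr (_ : \sum_i _ = 0) ?mulmx0 //.
rewrite -[RHS](linear0 (@vec_mx K (N - mp) N.+1)) -c0 linear_sum.
by apply: eq_bigr => i _; rewrite linearZ /= -dmx_formE.
Qed.

Lemma rk_dgamma_eq0 : (forall t, tangent X x t -> dmx t G = 0) ->
  rk (tangent X x) (dgamma Xo gamma x) = 0%N.
Proof.
move=> G0; rewrite dgammaE; rewrite (@rk_rV _ _ _ 1 _ _ 0) ?mxrank0 // => [t tt|w].
  have := G0 t tt; rewrite dmx_formE => e.
  by rewrite -[dmx t _]vec_mxK e linear0 sub0mx.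
move=> /submxP [d ->]; exists (fun=> 0); first exact: tangent0.
by rewrite mulmx0; apply/rowP => i; rewrite !mxE.
Qed.

Lemma PsiE q t (tt : tangent X x t) (s : {s | vanishing (val (gamma x)) s}) :
  q \in val (gamma x) ->
  @Psi K N m mp X Xo gamma x q (exist _ t tt) s = (proj1_sig s *m A *m dmx t G *m q) ord0 ord0.
Proof.
case: s => s sv qv; rewrite /Psi /=.
have dt : tangent (expanded_image Xo gamma) (gamma x) (dgamma Xo gamma x t).
  exact: (tangent_differential Tc' dgamma_m tt).
rewrite -{1}(mem_proj A GE qv) mulmxA (hom_of_tangent_proj vA dt sv).
rewrite dmx_differential //; exact: regular_Gr_form.
Qed.

(** Vectors of the plane [gamma x] dual to a basis of values of the pairing have independent images
    under [Psi], tested at the one form [h]. *)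
Lemma rk_pairing_Psi : (rk (tangent X x) beta <=
  rk [set q | q \in val (gamma x)] (@Psi K N m mp X Xo gamma x))%N.
Proof.
have [r [B [Bf Bt TB BT]]] := conormal_pairing_mx.
have -> : rk (tangent X x) beta = r by rewrite (rk_rV TB BT); apply/eqP.
have Psi_sum k (e : 'I_k -> 'cV[K]_N.+1) (c : 'I_k -> K) t s :
    (\sum_i c i *: @Psi K N m mp X Xo gamma x (e i)) t s = @Psi K N m mp X Xo gamma x (\sum_i c i *: e i) t s.
  rewrite /Psi mulmx_sumr summxE fct_sumE fct_sumE; apply: eq_bigr => i _.
  by rewrite -scalemxAr mxE.
have Pr : has_rank [set q | q \in val (gamma x)] (@Psi K N m mp X Xo gamma x)
    (rk [set q | q \in val (gamma x)] (@Psi K N m mp X Xo gamma x)).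
  (* [Psi] is linear in [q], so independent images come from independent columns; this shows that
     its [rk] is not the default value. *)
  apply: (@has_rank_bounded _ _ _ _ _ N.+1) => k e [_ ei].
  suff /eqP rM : row_free (\matrix_i (e i)^T).
    by have := rank_leq_col (\matrix_i (e i)^T); rewrite rM.
  apply/row_free_combP => c c0; apply: ei; apply/funext => t; apply/funext => s.
  rewrite Psi_sum (_ : \sum_i _ = 0); first by rewrite /Psi mulmx0 mxE.
  apply: trmx_inj; rewrite trmx0 -c0 raddf_sum; apply: eq_bigr => i _ /=.
  by rewrite linearZ rowK.
have /row_freeP [Y BY] := Bf.
(* Columns of a right inverse of [B], projected into the plane [gamma x]; as the pairing is
   invariant under the projection, [beta t_i] takes the value 1 on [q i] and 0 on the other
   [q j]. *)
pose q (j : 'I_r) := (1%:M - A *m G x) *m col j Y.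
have qv j : q j \in val (gamma x).
  by rewrite GE /q mulmxA mulmxBr mulmx1 mulmxA GA mul1mx subrr mul0mx.
apply: (indep_leq_rank Pr (e := q)); split=> // c c0 i.
have [t tt ti] := Bt i.
have hv : vanishing (val (gamma x)) (h v) by apply/(vanishing_sub _ GE); apply: conormal_form_sub.
have := congr1 (fun f => f (exist _ t tt) (exist _ (h v) hv)) c0.
rewrite Psi_sum PsiE; last by apply: memv_suml => j _; apply: memvZ.
rewrite /= -/(beta t) mulmx_sumr summxE => e; rewrite -[RHS]e.
rewrite (bigD1 i) //= big1 ?addr0 => [|j ji].
  rewrite -scalemxAr mulmxA conormal_pairing_proj // ti mxE colE mulmxA -row_mul BY.
  by rewrite -colE !mxE eqxx mulr1.
rewrite -scalemxAr mulmxA conormal_pairing_proj // ti mxE colE mulmxA -row_mul BY.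
by rewrite -colE !mxE eq_sym (negPf ji) mulr0.
Qed.

End AtPoint.
End TangentRanks.

(** * Generic behaviour of the ranks *)

Section FracGrad.
Variables (K : closedFieldType) (T : Defs.space K).
Hypothesis Tc : charted T.
Implicit Types p q : {mpoly K[ncoord T]}.

Lemma frac_grad_comb p q u c w w' :
  frac_grad p q u (c *: w + w') = c * frac_grad p q u w + frac_grad p q u w'.
Proof. by rewrite /frac_grad !grad_comb; ring. Qed.

Lemma regular_frac_grad Z z (nu w : T -> 'rV[K]_(ncoord T)) p q : Z z ->
  regular_mx Z nu z -> regular_mx Z w z -> q.@[nu z ord0] != 0 ->
  regular_at Z (fun y => frac_grad p q (nu y) (w y)) z.
Proof.
move=> Zz nur wr qz.
have rp r : regular_at Z (fun y => r.@[nu y ord0]) z by apply: (regular_poly Tc r (nur ord0)).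
have rg r : regular_at Z (fun y => grad r (nu y) (w y)) z.
  by apply: (regular_sum Tc) => i; apply: (regularM Tc).
apply: (regularM Tc).
  apply: (regularD Tc); first exact: (regularM Tc).
  rewrite (_ : (fun y => _) = (fun y => -1 * (p.@[nu y ord0] * grad q (nu y) (w y)))).
    by apply: (regularM Tc); [exact: regular_cst | exact: (regularM Tc)].
  by apply/funext => y; rewrite mulN1r.
apply: (regularV Tc) => //; last by rewrite expf_neq0.
exact: (regularM Tc).
Qed.

End FracGrad.

Section Generic.
Variables (K : closedFieldType) (N m mp : nat).
Variables (X Xo : set (Gr K N m)) (gamma : Gr K N m -> Gr K N mp).
Hypothesis em : expanding_map X Xo gamma.
Hypotheses (Xc : zclosed X) (Xi : zirreducible X).

Let Tc : charted (Gr K N m) := @Gr_charted K N m.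
Let Dc : charted (dualP K N) := @dual_charted K N.
Let Pc : charted (prod_space (Gr K N m) (dualP K N)) := prod_charted Tc Dc.

Local Notation P := (prod_space (Gr K N m) (dualP K N)).
Local Notation V := (gen_conormal Xo gamma).
Local Notation V0 := (open_conormal Xo gamma).
Local Notation beta := (conormal_pairing gamma).

(** Along a regular tangent frame of [X] the pairing is a regular function on [V], so being nonzero
    on some frame vector persists near [v]. *)
Lemma pairing_near v (A : 'M[K]_(N.+1, N - mp)) a t0 : V0 v -> chart_dom (Gr_Q A) (gamma v.1) ->
  chart_dom (dual_Q a) v.2 -> tangent X v.1 t0 -> beta v A a t0 != 0 ->
  locally V v (fun w => [/\ V0 w, chart_dom (Gr_Q A) (gamma w.1), chart_dom (dual_Q a) w.2
    & exists2 t, tangent X w.1 t & beta w A a t != 0]).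
Proof.
move=> V0v vA va tt0 bt0; have Xv := Xo_sub em V0v.1; have Vv := open_conormal_sub V0v.
have VX := gen_conormal_fst em Xc.
have [M0 [B [M0E M0B]]] := Gr_equations v.1.
have vB : chart_dom (Gr_Q B) v.1 by apply: Gr_dom_intro M0E _; rewrite M0B unitmx1.
have [F [Fr FE]] := Xo_frame em V0v.1 vB.
pose nu := Gr_nu B; pose G y := Gr_form A (gamma y).
have Gr' : regular_mx X G v.1 by apply: (regular_gamma_form em V0v.1 vA).
have /choice [p pE] : forall i, exists p : 'I_N.+1 -> {mpoly K[ncoord (Gr K N m)]}, exists q,
    forall j, (q j).@[nu v.1 ord0] != 0 /\ locally X v.1 (fun y =>
      [/\ chart_dom (Gr_Q B) y, (q j).@[nu y ord0] != 0
        & G y i j = (p j).@[nu y ord0] / (q j).@[nu y ord0]]).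
  move=> i; have /choice [pq pqE] : forall j, exists pq : {mpoly K[ncoord (Gr K N m)]} * {mpoly K[ncoord (Gr K N m)]},
      pq.2.@[nu v.1 ord0] != 0 /\ locally X v.1 (fun y =>
      [/\ chart_dom (Gr_Q B) y, pq.2.@[nu y ord0] != 0
        & G y i j = pq.1.@[nu y ord0] / pq.2.@[nu y ord0]]).
    move=> j; have [p [q pq]] := (regular_nu Tc _ _ (Gr_chart B) vB).1 (Gr' i j).
    by exists (p, q).
  by exists (fun j => (pq j).1), (fun j => (pq j).2).
have {pE}/choice [q pqE] := pE.
(* The derivative of [G] as an explicit function of the point and of a coordinate direction, linear
   in the direction, by the quotient rule on fixed fractions for its entries. *)
pose dG y w : 'M[K]_(N - mp, N.+1) := \matrix_(i, j) frac_grad (p i j) (q i j) (nu y) w.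
have dG_comb y c w w' : dG y (c *: w + w') = c *: dG y w + dG y w'.
  by apply/matrixP => i j; rewrite !mxE frac_grad_comb.
have dG0 y : dG y 0 = 0.
  by have := dG_comb y (-1) 0 0; rewrite scaler0 addr0 scaleN1r addNr.
have dGE : locally X v.1 (fun y => forall t, tangent X y t -> dmx t G = dG y (dmx t nu)).
  have loc : locally X v.1 (fun y => forall i j, [/\ chart_dom (Gr_Q B) y, (q i j).@[nu y ord0] != 0
        & G y i j = (p i j).@[nu y ord0] / (q i j).@[nu y ord0]]).
    by apply: locally_fin => i; apply: locally_fin => j; case: (pqE i j).
  have zl := locally_open X (zopen_chart_dom (Gr_chart B)) vB.
  apply: locally_impl (locally_and zl (locally_locally loc)) _ => y Xy [yB ly] t tt.
  apply/matrixP => i j; rewrite !mxE.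
  have lij : locally X y (fun y => [/\ chart_dom (Gr_Q B) y, (q i j).@[nu y ord0] != 0
        & G y i j = (p i j).@[nu y ord0] / (q i j).@[nu y ord0]]).
    by apply: locally_impl ly _ => z _; apply.
  have [_ qy _] := locally_at lij Xy.
  exact: (tangent_fraction Tc Xy (Gr_chart B) yB tt qy lij).
pose f k (w : P) := dual_nu a w.2 *m A *m dG w.1 (row k (F w.1)).
have fr k : regular_mx V (f k) v.
  apply: (regular_mxM Pc).
    apply: (regular_mxM Pc); last exact: regular_mx_cst.
    by apply: (regular_snd Vv); apply: regular_dual_nu.
  apply: (regular_fst VX Vv (F := fun y => dG y (row k (F y)))) => i j.
  rewrite (_ : (fun y => _) = (fun y => frac_grad (p i j) (q i j) (nu y) (row k (F y)))); last first.
    by apply/funext => y; rewrite mxE.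
  apply: (regular_frac_grad Tc) => //.
  - exact: (regular_chart Tc X (Gr_chart B) vB).
  - move=> i' j'; have := Fr k j'; congr regular_at; apply/funext => y.
    by rewrite mxE.
  - by case: (pqE i j).
(* Otherwise linearity in the direction would make the pairing vanish on the whole span of the
   frame, including [t0]. *)
have [k [j fkj]] : exists k j, f k v ord0 j != 0.
  apply: contrapT => nf; have f0 k : f k v = 0.
    apply/rowP => j; rewrite [RHS]mxE; apply: contrapT => /eqP fk.
    by apply: nf; exists k, j.
  move/eqP: bt0; apply; rewrite /beta (locally_at dGE Xv _ tt0).
  have /sub_combP [c ->] := (locally_at FE Xv _).1 (tangent_chart Tc (Gr_chart B) vB tt0).
  elim/big_ind: _ => [|w1 w2 e1 e2|k _]; first by rewrite dG0 mulmx0.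
    by rewrite -[w1]scale1r dG_comb scale1r mulmxDr e1 e2 addr0.
  by rewrite -[_ *: _]addr0 dG_comb dG0 addr0 -scalemxAr -/(f k v) f0 scaler0.
have l1 := open_conormal_near em Xc V0v.
have l2 := locally_fst VX Vv (gamma_near em V0v.1 vA).
have l3 := locally_snd Vv (locally_open setT (zopen_chart_dom (dual_chart a)) va).
have zl := locally_open X (zopen_chart_dom (Gr_chart B)) vB.
have l4 := locally_fst VX Vv (locally_and zl (locally_and FE dGE)).
have l5 := regular_neq0 Pc Vv (fr k ord0 j) fkj.
apply: locally_impl (locally_and (locally_and l1 l2) (locally_and l3 (locally_and l4 l5))) _.
move=> w Vw [[V0w [_ wA]] [wa [[wB [wF wG]] fw]]]; split=> //.
have [t tt te] := tangent_exists Tc (VX _ Vw) (Gr_chart B) wB ((wF _).2 (row_sub k (F w.1))).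
exists t => //; apply: contraNneq fw; rewrite /beta (wG t tt) te -/(f k w) => ->.
by rewrite mxE.
Qed.

Lemma point_charts (v : P) : exists (A : 'M[K]_(N.+1, N - mp)) a,
  chart_dom (Gr_Q A) (gamma v.1) /\ chart_dom (dual_Q a) v.2.
Proof.
have [G0 [A [G0E G0A]]] := Gr_equations (gamma v.1).
have [h0 [a [h0E h0a]]] := dual_equation v.2.
exists A, a; split; first by apply: Gr_dom_intro G0E _; rewrite G0A unitmx1.
by apply: dual_dom_intro h0E _; rewrite h0a unitmx1.
Qed.

Lemma open_conormal_generally : generally V V0.
Proof.
have [[U Uo XU] _ _ _] := em.
exists [set w : P | U w.1]; split; first exact: zopen_fst.
  move=> W Wo [w [Ww Vw]]; have [w' V0w' Ww'] := gen_conormal_meets Vw Wo Ww.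
  exists w'; split; last exact: open_conormal_sub.
  by split=> //; have := V0w'.1; rewrite XU => -[].
move=> w Uw Vw; apply: (open_conormalE em Xc Vw); rewrite XU; split=> //.
exact: (gen_conormal_fst em Xc Vw).
Qed.

Lemma rank_inequalities v : V0 v ->
  (rk (tangent V v) (differential [set: dualP K N] (@pibar K N m) v) - (N - mp - 1) <=
     rk (tangent X v.1) (dgamma Xo gamma v.1))%N /\
  (rk (tangent V v) (differential [set: dualP K N] (@pibar K N m) v) - (N - mp - 1) <=
     rk [set q | q \in val (gamma v.1)] (@Psi K N m mp X Xo gamma v.1))%N.
Proof.
move=> V0v; have [A [a [vA va]]] := point_charts v.
have [_ ->] := rk_conormal em Xc V0v vA va; rewrite addKn.
by split; [exact: rk_pairing_dgamma | exact: (rk_pairing_Psi em V0v vA va)].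
Qed.

Lemma rank_minimal : generally V (fun v =>
  rk (tangent V v) (differential [set: dualP K N] (@pibar K N m) v) = (N - mp - 1)%N ->
  rk (tangent X v.1) (dgamma Xo gamma v.1) = 0%N).
Proof.
(* If the pairing is nonzero somewhere it is nonzero at general points, where the rank exceeds
   [N - mp - 1]. If it is zero at every point over [Xo], [dgamma] itself will be shown to vanish. *)
have [[v1 [A [a [t [V0v vA va tt bt]]]]]|noneg] := pselect (exists v A a t,
    [/\ V0 v, chart_dom (Gr_Q A) (gamma v.1), chart_dom (dual_Q a) v.2, tangent X v.1 t
      & beta v A a t != 0]).
  have Vv := open_conormal_sub V0v.
  have Vi : zirreducible V by apply: (gen_conormal_irreducible em Xi); exists v1.
  have := irreducible_generally Vi Vv (pairing_near V0v vA va tt bt).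
  move=> /generally_impl; apply=> w Vw [V0w wA wa [t' tt' bt']] e.
  have [_] := rk_conormal em Xc V0w wA wa; rewrite e -[LHS]addn0 => /addnI r0.
  have := @indep_leq_rank _ _ _ (tangent X w.1) (beta w A a) _ 1 (fun=> t') (has_rank_rV _ _).
  rewrite -r0 ltn0; have /[swap] /[apply] // : indep (tangent X w.1) (beta w A a) (fun _ : 'I_1 => t').
  split=> // c; rewrite big_ord1 => /eqP; rewrite scaler_eq0 (negPf bt') orbF => /eqP c0 i.
  by rewrite (ord1 i).
apply: generally_impl open_conormal_generally _ => v Vv V0v _.
have [A [a [vA va]]] := point_charts v; have [GE GA] := Gr_dom vA.
apply: (rk_dgamma_eq0 em V0v vA) => t tt.
apply/row_matrixP => i; rewrite row0.
(* The hyperplane with equation the i-th row of [G] contains [gamma x], and pairing it with [t]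
   returns the i-th row of [dG(t)], because [G A = 1]. *)
pose s := row i (Gr_form A (gamma v.1)).
have s0 : s != 0.
  apply/eqP => s0; have := congr1 (fun M => row i M) GA.
  rewrite row_mul -/s s0 mul0mx => /rowP/(_ i); rewrite !mxE eqxx => /eqP.
  by rewrite eq_sym oner_eq0.
have [H HE] := form_kernel s0.
have [h0 [b [h0E h0b]]] := dual_equation H.
have sb : s *m b \in unitmx.
  have /submxP [d hd] := cut_out_sub HE h0E.
  by move: h0b; rewrite hd -mulmxA => /mulmx1_unit [].
have Hb : chart_dom (dual_Q b) H by apply: dual_dom_intro HE sb.
have VH : V0 (v.1, H) by split; [exact: V0v.1 | rewrite /= (subv_cut_out GE HE) row_sub].
have b0 : beta (v.1, H) A b t = 0.
  by apply: contrapT => /eqP bt; apply: noneg; exists (v.1, H), A, b, t.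
have [hE _] := dual_dom Hb.
have /submxP [d sd] := cut_out_sub hE HE.
have -> : row i (dmx t (fun y => Gr_form A (gamma y))) = s *m A *m dmx t (fun y => Gr_form A (gamma y)).
  by rewrite /s -!row_mul GA mul1mx.
by rewrite sd -!mulmxA (mulmxA _ A) -[X in d *m X]/(beta (v.1, H) A b t) b0 mulmx0.
Qed.

End Generic.

(** * Homogenization and function fields *)

Section Homogenization.
Variables (K : fieldType) (n : nat) (a : 'I_n -> K).

Definition linear_form : {mpoly K[n]} := \sum_i a i *: 'X_i.

Lemma meval_linear_form u : linear_form.@[u] = \sum_i a i * u i.
Proof.
rewrite /linear_form raddf_sum; apply: eq_bigr => i _ /=.
by rewrite mevalZ mevalXU.
Qed.

Lemma mderiv_linear_form i u : linear_form^`M(i).@[u] = a i.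
Proof.
have -> : linear_form^`M(i) = \sum_j a j *: ('X_j)^`M(i).
  rewrite /linear_form (big_morph _ (mderivD i) (mderiv0 K i)).
  by apply: eq_bigr => j _; rewrite mderivZ.
rewrite raddf_sum [LHS](bigD1 i) //= [X in _ + X]big1 => [|j ji]; rewrite mevalZ mderivX mnm1E.
  have -> : (U_(i) - U_(i) = 0)%MM by apply/mnmP => k; rewrite mnmBE mnm0E subnn.
  by rewrite eqxx scale1r mpolyX0 meval1 mulr1 addr0.
by rewrite (negPf ji) scale0r meval0 mulr0.
Qed.

Let ell := linear_form.

Lemma linear_form_homog : ell \is 1.-homog.
Proof.
apply: rpred_sum => i _; apply: dhomogZ.
by rewrite dhomogX /= mdeg1.
Qed.

(** [Ph] is a homogenization of [P] with respect to the form [ell]. The last clause records that on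
    [ell = 1] the two gradients differ by a multiple of the gradient of [ell], hence agree on
    directions that [ell] kills. *)
Definition homogenizes (P Ph S : {mpoly K[n]}) k :=
  [/\ Ph \is k.-homog,
      forall u, ell.@[u] != 0 -> Ph.@[u] = ell.@[u] ^+ k * P.@[fun i => u i / ell.@[u]]
    & forall i u, ell.@[u] = 1 -> Ph^`M(i).@[u] = P^`M(i).@[u] + a i * S.@[u]].

Lemma homogenizes_val P Ph S k u : homogenizes P Ph S k -> ell.@[u] = 1 -> Ph.@[u] = P.@[u].
Proof.
move=> [_ h _] u1; rewrite h u1 ?oner_eq0 // expr1n mul1r.
by apply: meval_eq => i; rewrite divr1.
Qed.

(** Raising the degree by a factor [ell] allows polynomials homogenized in different degrees to be
    added. *)
Lemma homogenizes_mul P Ph S k : homogenizes P Ph S k ->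
  homogenizes P (ell * Ph) (S + P) k.+1.
Proof.
move=> hP; have [h1 h2 h3] := hP; split.
- by rewrite -add1n; apply: dhomogM => //; apply: linear_form_homog.
- by move=> u u0; rewrite mevalM h2 // exprS mulrA.
move=> i u u1; rewrite mderivM !mevalD !mevalM mderiv_linear_form u1 mul1r h3 //.
by rewrite (homogenizes_val hP u1); ring.
Qed.

Lemma homogenizes_shift P Ph S k e : homogenizes P Ph S k ->
  exists Ph' S', homogenizes P Ph' S' (e + k)%N.
Proof.
elim: e => [|e IH] hP; first by exists Ph, S.
by have [Ph' [S' h]] := IH hP; exists (ell * Ph'), (S' + P); apply: homogenizes_mul.
Qed.

Lemma homogenizesP P : exists k Ph S, homogenizes P Ph S k.
Proof.
elim/mpoly_ring_ind: P => [c|j|P Q [k [Ph [S hP]]] [l [Qh [R hQ]]]|P Q [k [Ph [S hP]]] [l [Qh [R hQ]]]].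
- exists 0%N, c%:MP, 0; split=> [|u u0|i u u1].
  + by rewrite -[c]mulr1 mpolyCM mpolyC1 mul_mpolyC; apply: dhomogZ; apply: dhomog1.
  + by rewrite expr0 mul1r !mevalC.
  + by rewrite meval0 mulr0 addr0.
- exists 1%N, 'X_j, 0; split=> [|u u0|i u u1].
  + by rewrite dhomogX /= mdeg1.
  + by rewrite expr1 !mevalXU mulrC divfK.
  + by rewrite meval0 mulr0 addr0.
- have [Ph' [S' hP']] := homogenizes_shift l hP; have [Qh' [R' hQ']] := homogenizes_shift k hQ.
  exists (l + k)%N, (Ph' + Qh'), (S' + R').
  rewrite addnC in hQ'; have [p1 p2 p3] := hP'; have [q1 q2 q3] := hQ'; split.
  + exact: dhomogD.
  + by move=> u u0; rewrite !mevalD p2 // q2 // mulrDr.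
  + by move=> i u u1; rewrite !mderivD !mevalD p3 // q3 //; ring.
exists (k + l)%N, (Ph * Qh), (S * Q + P * R).
have [p1 p2 p3] := hP; have [q1 q2 q3] := hQ; split.
- exact: dhomogM.
- by move=> u u0; rewrite !mevalM p2 // q2 // exprD; ring.
move=> i u u1; rewrite !mderivM !mevalD !mevalM p3 // q3 //.
by rewrite (homogenizes_val hP u1) (homogenizes_val hQ u1); ring.
Qed.

End Homogenization.

(** * Rational functions, their classes, and derivations of the function field *)

Section FunctionField.
Variables (K : closedFieldType) (T : Defs.space K).
Hypothesis Tc : charted T.
Variables (Z : set T) (L : fieldType) (cl : (T -> K) -> L).
Hypotheses (Zi : zirreducible Z) (ff : function_field Z cl).
Implicit Types (f g : T -> K).

Lemma regular_near f z : Z z -> regular_at Z f z -> locally Z z (regular_at Z f).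
Proof.
move=> Zz fz; have [u uz] := Tc.1 z; have [nu [Q [nuQ Qu _]]] := Tc.2 u z uz.
have zQ : chart_dom Q z by exists u.
have [p [q [qz loc]]] := (regular_nu Tc Z f nuQ zQ).1 fz.
apply: locally_impl (locally_and loc (locally_locally loc)) _ => y Zy [[yQ qy _] ly].
by apply/(regular_nu Tc Z f nuQ yQ); exists p, q.
Qed.

Lemma regular_rational f z : Z z -> regular_at Z f z -> rational Z f.
Proof. by move=> Zz /(regular_near Zz); apply: irreducible_generally. Qed.

Lemma rational_cst c : rational Z (fun=> c).
Proof. by apply: generallyT => z _; apply: regular_cst. Qed.

Lemma rationalD f g : rational Z f -> rational Z g -> rational Z (fun z => f z + g z).
Proof.
move=> fr gr; apply: generally_impl (generally_and fr gr) _ => z _ [fz gz].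
exact: regularD.
Qed.

Lemma rationalM f g : rational Z f -> rational Z g -> rational Z (fun z => f z * g z).
Proof.
move=> fr gr; apply: generally_impl (generally_and fr gr) _ => z _ [fz gz].
exact: regularM.
Qed.

Lemma rationalB f g : rational Z f -> rational Z g -> rational Z (fun z => f z - g z).
Proof.
move=> fr gr; rewrite (_ : (fun z => _) = (fun z => f z + (-1) * g z)); last first.
  by apply/funext => z; rewrite mulN1r.
by apply: rationalD => //; apply: rationalM => //; apply: rational_cst.
Qed.

Lemma rational_sum (I : Type) (r : seq I) (F : I -> T -> K) :
  (forall i, rational Z (F i)) -> rational Z (fun z => \sum_(i <- r) F i z).
Proof.
move=> Fr; elim: r => [|i r IH].
  by rewrite (_ : (fun z => _) = (fun=> 0)); [exact: rational_cst | apply/funext => z; rewrite big_nil].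
rewrite (_ : (fun z => _) = (fun z => F i z + \sum_(j <- r) F j z)); first exact: rationalD.
by apply/funext => z; rewrite big_cons.
Qed.

Lemma rational_poly n (p : {mpoly K[n]}) (F : T -> 'rV[K]_n) :
  (forall i, rational Z (fun z => F z ord0 i)) -> rational Z (fun z => p.@[F z ord0]).
Proof.
move=> Fr; apply: generally_impl (generally_fin Fr) _ => z _ Fz.
exact: (regular_poly Tc).
Qed.

Lemma cl_eq f g : rational Z f -> rational Z g -> generally Z (fun z => f z = g z) -> cl f = cl g.
Proof. by move=> fr gr fg; apply/(ff_eq ff). Qed.

Lemma clB f g : rational Z f -> rational Z g -> cl (fun z => f z - g z) = cl f - cl g.
Proof.
move=> fr gr; apply/eqP; rewrite -subr_eq opprK -(ff_add ff) //; last exact: rationalB.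
by apply/eqP; congr cl; apply/funext => z; rewrite subrK.
Qed.

Lemma cl0 : cl (fun=> 0) = 0.
Proof.
have r1 := rational_cst 1; rewrite -(subrr (cl (fun=> 1))) -clB //; congr cl.
by apply/funext => z; rewrite subrr.
Qed.

Lemma cl_eq0 f : rational Z f -> cl f = 0 <-> generally Z (fun z => f z = 0).
Proof. by move=> fr; rewrite -cl0; apply: (ff_eq ff) => //; apply: rational_cst. Qed.

Lemma cl_sum (I : Type) (r : seq I) (F : I -> T -> K) : (forall i, rational Z (F i)) ->
  cl (fun z => \sum_(i <- r) F i z) = \sum_(i <- r) cl (F i).
Proof.
move=> Fr; elim: r => [|i r IH].
  by rewrite big_nil -cl0; congr cl; apply/funext => z; rewrite big_nil.
rewrite big_cons -IH -(ff_add ff) //; last exact: rational_sum.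
by congr cl; apply/funext => z; rewrite big_cons.
Qed.

(** If [f z] were nonzero, [f] would be nonzero at general points by irreducibility. *)
Lemma generally_eq0 f z : generally Z (fun z => f z = 0) -> Z z -> regular_at Z f z -> f z = 0.
Proof.
move=> f0 Zz fz; apply: contrapT => /eqP fn0.
have := irreducible_generally Zi Zz (regular_neq0 Tc Zz fz fn0).
move=> /(generally_and f0)/(generally_ex (ex_intro _ z Zz)) [y _ [-> ]].
by rewrite eqxx.
Qed.

Definition rational_mx b c (F : T -> 'M[K]_(b, c)) := forall i j, rational Z (fun z => F z i j).

Definition clmx b c (F : T -> 'M[K]_(b, c)) : 'M[L]_(b, c) :=
  \matrix_(i, j) cl (fun z => F z i j).

Lemma regular_rational_mx b c (F : T -> 'M[K]_(b, c)) z : Z z -> regular_mx Z F z -> rational_mx F.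
Proof. by move=> Zz Fz i j; apply: regular_rational (Fz i j). Qed.

Lemma rational_mx_cst b c (M : 'M[K]_(b, c)) : rational_mx (fun=> M).
Proof. by move=> i j; apply: rational_cst. Qed.

Lemma rational_mxM b c d (F : T -> 'M[K]_(b, c)) (G : T -> 'M[K]_(c, d)) :
  rational_mx F -> rational_mx G -> rational_mx (fun z => F z *m G z).
Proof.
move=> Fr Gr i j; rewrite (_ : (fun z => _) = (fun z => \sum_k F z i k * G z k j)); last first.
  by apply/funext => z; rewrite mxE.
by apply: rational_sum => k; apply: rationalM.
Qed.

Lemma rational_mxB b c (F G : T -> 'M[K]_(b, c)) :
  rational_mx F -> rational_mx G -> rational_mx (fun z => F z - G z).
Proof.
move=> Fr Gr i j; rewrite (_ : (fun z => _) = (fun z => F z i j - G z i j)); last first.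
  by apply/funext => z; rewrite !mxE.
exact: rationalB.
Qed.

Lemma clmxM b c d (F : T -> 'M[K]_(b, c)) (G : T -> 'M[K]_(c, d)) :
  rational_mx F -> rational_mx G -> clmx (fun z => F z *m G z) = clmx F *m clmx G.
Proof.
move=> Fr Gr; apply/matrixP => i j; rewrite !mxE.
rewrite (_ : (fun z => _) = (fun z => \sum_k F z i k * G z k j)); last first.
  by apply/funext => z; rewrite mxE.
rewrite cl_sum => [|k]; last exact: rationalM.
by apply: eq_bigr => k _; rewrite !mxE (ff_mul ff).
Qed.

Lemma clmxB b c (F G : T -> 'M[K]_(b, c)) :
  rational_mx F -> rational_mx G -> clmx (fun z => F z - G z) = clmx F - clmx G.
Proof.
move=> Fr Gr; apply/matrixP => i j; rewrite !mxE -clB //; congr cl.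
by apply/funext => z; rewrite !mxE.
Qed.

Lemma clmx1 b : clmx (fun=> 1%:M) = 1%:M :> 'M_b.
Proof.
apply/matrixP => i j; rewrite !mxE.
by case: eqP => _; rewrite ?(ff_one ff) ?cl0.
Qed.

Lemma clmx_eq b c (F G : T -> 'M[K]_(b, c)) : rational_mx F -> rational_mx G ->
  clmx F = clmx G <-> generally Z (fun z => F z = G z).
Proof.
move=> Fr Gr; split=> [/matrixP FG|FG].
  have : generally Z (fun z => forall i j, F z i j = G z i j).
    apply: generally_fin => i; apply: generally_fin => j.
    by apply/(ff_eq ff) => //; have := FG i j; rewrite !mxE.
  by move/generally_impl; apply=> z _ e; apply/matrixP.
apply/matrixP => i j; rewrite !mxE; apply: cl_eq => //.
by apply: generally_impl FG _ => z _ ->.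
Qed.

Lemma clmx_surj b c (M : 'M[L]_(b, c)) : exists2 F : T -> 'M[K]_(b, c), rational_mx F & clmx F = M.
Proof.
have /choice [f fE] : forall i, exists f : 'I_c -> T -> K, forall j, rational Z (f j) /\ cl (f j) = M i j.
  move=> i; have /choice [f fE] : forall j, exists f, rational Z f /\ cl f = M i j.
    by move=> j; have [f fr fM] := ff_surj ff (M i j); exists f.
  by exists f.
exists (fun z => \matrix_(i, j) f i j z) => [i j|].
  rewrite (_ : (fun z => _) = f i j); last by apply/funext => z; rewrite mxE.
  by case: (fE i j).
apply/matrixP => i j; rewrite !mxE (_ : (fun z => _) = f i j); last by apply/funext => z; rewrite mxE.
by case: (fE i j).
Qed.

Section Derivation.
Variables (E : set L) (D : L -> L).
Hypotheses (Er : subring E) (Dd : deriv_on E D).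

Lemma derivation_poly n (p : {mpoly K[n]}) (F : T -> 'rV[K]_n) : rational_mx F ->
  (forall c, E (cl (fun=> c)) /\ D (cl (fun=> c)) = 0) ->
  (forall i, E (cl (fun z => F z ord0 i))) ->
  E (cl (fun z => p.@[F z ord0])) /\
  D (cl (fun z => p.@[F z ord0])) =
    \sum_i cl (fun z => p^`M(i).@[F z ord0]) * D (cl (fun z => F z ord0 i)).
Proof.
move=> Fr EC EF; have rp q : rational Z (fun z => q.@[F z ord0]) by apply: rational_poly.
have [_ _ EM] := Er.
elim/mpoly_ring_ind: p => [c|i|p q [Ep Dp] [Eq Dq]|p q [Ep Dp] [Eq Dq]].
- rewrite (_ : (fun z => _) = (fun=> c)); last by apply/funext => z; rewrite mevalC.
  have [Ec ->] := EC c; split=> //; rewrite big1 // => i _.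
  rewrite (_ : (fun z => _) = (fun=> 0)) ?cl0 ?mul0r //.
  by apply/funext => z; rewrite mderivC meval0.
- rewrite (_ : (fun z => _) = (fun z => F z ord0 i)); last by apply/funext => z; rewrite mevalXU.
  split=> //; rewrite (bigD1 i) //= big1 => [|j ji].
    have -> : (fun z => ('X_i : {mpoly K[n]})^`M(i).@[F z ord0]) = (fun=> 1); last first.
      by rewrite (ff_one ff) mul1r addr0.
    apply/funext => z; rewrite mderivX mnm1E eqxx scale1r.
    have -> : (U_(i) - U_(i) = 0)%MM by apply/mnmP => k; rewrite mnmBE mnm0E subnn.
    by rewrite mpolyX0 meval1.
  rewrite (_ : (fun z => _) = (fun=> 0)) ?cl0 ?mul0r //.
  by apply/funext => z; rewrite mderivX mnm1E eq_sym (negPf ji) scale0r meval0.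
- rewrite (_ : (fun z => _) = (fun z => p.@[F z ord0] + q.@[F z ord0])); last first.
    by apply/funext => z; rewrite mevalD.
  rewrite (ff_add ff) //; split; first exact: subringD.
  rewrite (derD Er Dd) // Dp Dq -big_split; apply: eq_bigr => i _ /=.
  rewrite -mulrDl -(ff_add ff) //; congr (cl _ * _); apply/funext => z.
  by rewrite mderivD mevalD.
rewrite (_ : (fun z => _) = (fun z => p.@[F z ord0] * q.@[F z ord0])); last first.
  by apply/funext => z; rewrite mevalM.
rewrite (ff_mul ff) //; split; first exact: EM.
rewrite (proj2 Dd) // Dp Dq !mulr_sumr -big_split; apply: eq_bigr => i _ /=.
rewrite !mulrA -mulrDl -!(ff_mul ff) // -(ff_add ff); try exact: rationalM.
congr (cl _ * _); apply/funext => z.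
by rewrite mderivM mevalD !mevalM; ring.
Qed.

End Derivation.
End FunctionField.

Lemma derivation_mxM (L : fieldType) (E : set L) D b c d (F : 'M[L]_(b, c)) (G : 'M[L]_(c, d)) :
  subring E -> deriv_on E D -> (forall i j, E (F i j)) -> (forall i j, E (G i j)) ->
  (map_mx D (F *m G) = map_mx D F *m G + F *m map_mx D G) /\ forall i j, E ((F *m G) i j).
Proof.
move=> Er Dd EF EG; have [_ _ EM] := Er; split; last first.
  by move=> i j; rewrite mxE; apply: subring_sum => // k; apply: EM.
apply/matrixP => i j; rewrite !mxE (der_sum _ Er Dd) => [|k]; last exact: EM.
rewrite -big_split; apply: eq_bigr => k _ /=.
by rewrite !mxE (proj2 Dd) //; ring.
Qed.

(** * The separable case *)

Section SeparableCase.
Variables (K : closedFieldType) (N m mp : nat).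
Variables (X Xo : set (Gr K N m)) (gamma : Gr K N m -> Gr K N mp).
Hypothesis em : expanding_map X Xo gamma.
Hypotheses (Xc : zclosed X) (Xi : zirreducible X).

Let Tc : charted (Gr K N m) := @Gr_charted K N m.
Let Dc : charted (dualP K N) := @dual_charted K N.
Let Pc : charted (prod_space (Gr K N m) (dualP K N)) := prod_charted Tc Dc.

Local Notation P := (prod_space (Gr K N m) (dualP K N)).
Local Notation V := (gen_conormal Xo gamma).
Local Notation V0 := (open_conormal Xo gamma).
Local Notation pi := (@pibar K N m).
Local Notation Y := (pi @` V).

Variables (v1 : P) (B : 'M[K]_(N.+1, N - m)) (a : 'cV[K]_N.+1).
Hypotheses (V0v1 : V0 v1) (xB : chart_dom (Gr_Q B) v1.1) (Ha : chart_dom (dual_Q a) v1.2).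
Variables (L : fieldType) (cl : (P -> K) -> L).
Hypothesis ff : function_field V cl.

Let Vv1 : V v1 := open_conormal_sub V0v1.
Let Vi : zirreducible V. Proof. by apply: (gen_conormal_irreducible em Xi); exists v1. Qed.
Let VX := gen_conormal_fst em Xc.
Let Yb := zclosure Y.
Let YbV v : V v -> Yb (pi v). Proof. by move=> Vv; apply: zclosure_sub; exists v. Qed.

Let pi_m v : V v -> morphism_at V Yb pi v.
Proof. by move=> Vv; apply: morphism_snd. Qed.

Let h (v : P) : 'rV[K]_N.+1 := dual_nu a v.2.
Let nu (v : P) := Gr_nu B v.1.
Let M (v : P) := Gr_form B v.1.

Let hr : rational_mx V h.
Proof.
by apply: (regular_rational_mx Pc Vi Vv1); apply: (regular_snd Vv1); apply: regular_dual_nu.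
Qed.
Let nur : rational_mx V nu.
Proof.
apply: (regular_rational_mx Pc Vi Vv1); apply: (regular_fst VX Vv1 (F := Gr_nu B)).
exact: (regular_chart Tc X (Gr_chart B) xB).
Qed.
Let Mr : rational_mx V M.
Proof.
apply: (regular_rational_mx Pc Vi Vv1); apply: (regular_fst VX Vv1 (F := Gr_form B)).
exact: regular_Gr_form.
Qed.
Let cr b c (C : 'M[K]_(b, c)) : rational_mx V (fun=> C). Proof. exact: rational_mx_cst. Qed.

Let good : generally V (fun v =>
  [/\ V0 v, chart_dom (Gr_Q B) v.1 & chart_dom (dual_Q a) v.2]).
Proof.
apply: (irreducible_generally Vi Vv1).
have l1 := open_conormal_near em Xc V0v1.
have l2 := locally_fst VX Vv1 (locally_open X (zopen_chart_dom (Gr_chart B)) xB).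
have l3 := locally_snd Vv1 (locally_open setT (zopen_chart_dom (dual_chart a)) Ha).
by apply: locally_impl (locally_and l1 (locally_and l2 l3)) _ => v _ [? [? ?]].
Qed.

Let ev (p : {mpoly K[N.+1]}) : L := cl (fun v => p.@[h v ord0]).
Let evr (p : {mpoly K[N.+1]}) : rational V (fun v => p.@[h v ord0]).
Proof. exact: (rational_poly Pc _ (hr ord0)). Qed.

Let evB p q : ev (p - q) = ev p - ev q.
Proof. by rewrite /ev -(clB Pc ff) //; congr cl; apply/funext => v; rewrite mevalB. Qed.
Let evD p q : ev (p + q) = ev p + ev q.
Proof. by rewrite /ev -(ff_add ff) //; congr cl; apply/funext => v; rewrite mevalD. Qed.
Let evM p q : ev (p * q) = ev p * ev q.
Proof. by rewrite /ev -(ff_mul ff) //; congr cl; apply/funext => v; rewrite mevalM. Qed.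
Let evC c : ev c%:MP = cl (fun=> c).
Proof. by rewrite /ev; congr cl; apply/funext => v; rewrite mevalC. Qed.
Let evX i : ev 'X_i = cl (fun v => h v ord0 i).
Proof. by rewrite /ev; congr cl; apply/funext => v; rewrite mevalXU. Qed.

(** The coordinate ring of the chart of [Y], embedded in K(V). The field [F] below is K(Y), and lies
    between [R0] and its fractions by [R0_F] and [F_frac]. *)
Let R0 : set L := ev @` setT.

Let R0_subring : subring R0.
Proof.
split.
- by exists 1 => //; rewrite -mpolyC1 evC (ff_one ff).
- by move=> _ _ [p _ <-] [q _ <-]; exists (p - q) => //; rewrite evB.
- by move=> _ _ [p _ <-] [q _ <-]; exists (p * q) => //; rewrite evM.
Qed.

Let F : set L := [set cl (g \o pi) | g in rational Yb].

Let pi_generally U : zopen U -> U `&` Yb !=set0 -> generally V (fun v => U (pi v)).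
Proof.
move=> Uo [y [Uy Yy]]; have [_ [v Vv <-] Uv] := zclosure_meets Yy Uo Uy.
apply: (irreducible_generally Vi Vv).
by apply: locally_pull (pi_m Vv) _; apply: locally_open.
Qed.

Let V_ne : V !=set0. Proof. by exists v1. Qed.

Let pull_rational g : rational Yb g -> rational V (g \o pi) /\ fracset R0 (cl (g \o pi)).
Proof.
move=> [U [Uo Ud Ug]].
have U0 : U `&` Yb !=set0.
  have [|y [[_ Uy] Yy]] := Ud setT (zopenT _).
    by exists (pi v1); split=> //; apply: YbV.
  by exists y.
have [v Vv [Uv [V0v vB va]]] := generally_ex V_ne (generally_and (pi_generally Uo U0) good).
have gv : regular_at Yb g (pi v) by apply: Ug => //; apply: YbV.
have gr : rational V (g \o pi).
  apply: (regular_rational Pc Vi Vv); have [_ _ h'] := pi_m Vv; exact: h'.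
split=> //.
have [p [q [qv loc]]] := (regular_nu Dc Yb g (dual_chart a) va).1 gv.
have ge := irreducible_generally Vi Vv (locally_pull (pi_m Vv) loc).
have q0 : ev q != 0.
  apply/eqP => /(cl_eq0 Pc ff (evr q)) q0.
  have [w Vw [[_ qw _] q0w]] := generally_ex V_ne (generally_and ge q0).
  by move: qw; rewrite -[X in X != _]/(q.@[h w ord0]) q0w eqxx.
exists (ev p), (ev q); split; [by exists p | by exists q | by [] |].
apply: (mulIf q0); rewrite divfK // -(ff_mul ff) //.
apply: (cl_eq ff) => //; first exact: rationalM.
by apply: generally_impl ge _ => w _ [_ qw /= ->]; rewrite divfK.
Qed.

Let h_rational i : rational Yb (fun H => dual_nu a H ord0 i).
Proof.
exists (chart_dom (dual_Q a)); split.
- exact: (zopen_chart_dom (dual_chart a)).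
- move=> W Wo WY; have g1 := pi_generally Wo WY.
  have [v Vv [Wv [_ _ va]]] := generally_ex V_ne (generally_and g1 good).
  by exists (pi v); split; [split | apply: YbV].
- by move=> H HQ _; apply: (regular_chart Dc Yb (dual_chart a) HQ ord0).
Qed.

Let F_subring : subring F.
Proof.
split.
- by exists (fun=> 1); [exact: rational_cst | rewrite -[RHS](ff_one ff)].
- move=> _ _ [f fr <-] [g gr <-]; exists (fun H => f H - g H); first exact: rationalB.
  by rewrite -(clB Pc ff) //; apply: (pull_rational _).1.
- move=> _ _ [f fr <-] [g gr <-]; exists (fun H => f H * g H); first exact: rationalM.
  by rewrite -(ff_mul ff) //; apply: (pull_rational _).1.
Qed.

Let R0_F : R0 `<=` F.
Proof.
move=> _ [p _ <-]; exists (fun H => p.@[dual_nu a H ord0]) => //.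
exact: rational_poly.
Qed.

Let F_frac : F `<=` fracset R0.
Proof. by move=> _ [g gr <-]; case: (pull_rational gr). Qed.

Definition vanishes_on_image (p : {mpoly K[N.+1]}) :=
  forall h' y', coords (s := dualP K N) h' y' -> Y y' -> p.@[h' ord0] = 0.

(** An embedded tangent vector of [Y] at the image of the generic point of [V], with coefficients in
    K(V). *)
Definition tangent_form (k : 'rV[L]_N.+1) := forall d (p : {mpoly K[N.+1]}),
  p \is d.-homog -> vanishes_on_image p -> \sum_i ev p^`M(i) * k ord0 i = 0.

Let eta := clmx cl h.
Let abar := clmx cl (fun=> a : 'cV[K]_N.+1).

Let ha1 : generally V (fun v => h v *m a = 1%:M).
Proof. by apply: generally_impl good _ => v _ [_ _ /dual_dom []]. Qed.

Let eta_a : eta *m abar = 1%:M.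
Proof.
rewrite /eta /abar -(clmxM Pc ff) // -(clmx1 Pc ff); apply/(clmx_eq ff) => //.
exact: rational_mxM.
Qed.

Let dual_scale (u : 'rV[K]_N.+1) y (c : K) : c != 0 ->
  coords (s := dualP K N) u y -> coords (s := dualP K N) (c *: u) y.
Proof. by move=> c0 uy p; rewrite uy -scalemxAl scaler_eq0 (negPf c0). Qed.

(* A polynomial vanishing at the normalized equations of [Y] is homogenized by powers of the *)
(* normalizing form; [w] is tangent to the normalization, so the extra terms do not matter. *)
Let tangent_form_affine k p : tangent_form k -> ev p = 0 ->
  \sum_i ev p^`M(i) * (k - (k *m abar) *m eta) ord0 i = 0.
Proof.
move=> kt p0; set c := k *m abar.
pose al i := a i ord0; pose ell := linear_form al.
have ellE (u : 'rV[K]_N.+1) : ell.@[u ord0] = (u *m a) ord0 ord0.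
  by rewrite meval_linear_form mxE; apply: eq_bigr => i _; rewrite mulrC.
have [e [ph0 [S0 hom0]]] := homogenizesP al p.
(* The additional factor [ell] makes the polynomial vanish also at points of [Y] outside the chart,
   where [ell] is zero. *)
have hom := homogenizes_mul hom0; set ph := _ * ph0 in hom; set S := S0 + p in hom.
have [ph_hom ph_val ph_der] := hom.
have pY v : V v -> chart_dom (dual_Q a) v.2 -> p.@[h v ord0] = 0.
  move=> Vv va; have p0' := (cl_eq0 Pc ff (evr p)).1 p0.
  apply: (generally_eq0 Pc Vi p0' Vv).
  have hv : regular_mx V h v by apply: (regular_snd Vv (F := dual_nu a)); apply: regular_dual_nu.
  exact: (regular_poly Pc p (hv ord0)).
have phY : vanishes_on_image ph.
  move=> u y uy [v Vv vy]; have [u0|u0] := eqVneq (ell.@[u ord0]) 0.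
    by rewrite mevalM u0 mul0r.
  rewrite ph_val //; suff -> : p.@[fun i => u ord0 i / ell.@[u ord0]] = 0 by rewrite mulr0.
  have uQ : u *m a \in unitmx.
    by rewrite unitmxE unitfE det_mx11 -ellE.
  have vQ : chart_dom (dual_Q a) v.2 by move: uy; rewrite -vy => uy; apply: dual_dom_intro uy uQ.
  rewrite -(pY v Vv vQ); apply: meval_eq => i.
  have -> : h v = (ell.@[u ord0])^-1 *: u.
    apply: dual_nu_uniq; first by apply: dual_scale; rewrite ?invr_neq0 // -[v.2]/(pi v) vy.
    apply/matrixP => i' j'; rewrite (ord1 i') (ord1 j') -scalemxAl !mxE.
    have := ellE u; rewrite !mxE => <-.
    by rewrite mulVf.
  by rewrite mxE mulrC.
(* [ph] vanishes on the line through 0 and [h], so its derivative along [h] is zero; this is Euler's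
   relation in a form valid in every characteristic. *)
have ph_line : generally V (fun v => grad ph (h v) (h v) = 0).
  apply: generally_impl good _ => v Vv [_ _ va]; apply: grad_line0 => t.
  have -> : h v + t *: h v = (1 + t) *: h v by rewrite scalerDl scale1r.
  have [->|t0] := eqVneq (1 + t) 0.
    rewrite scale0r mevalM ellE mul0mx [X in X * _]mxE mul0r.
    by [].
  apply: (phY _ (pi v)); last by exists v.
  by apply: dual_scale => //; case: (dual_dom va).
have e_der i : ev ph^`M(i) = ev p^`M(i) + abar i ord0 * ev S.
  rewrite mxE -(ff_mul ff) //; last exact: cr.
  rewrite -(ff_add ff) //; last by apply: (rationalM Pc) => //; apply: cr.
  apply: (cl_eq ff) => //; first by apply: (rationalD Pc) => //; apply: (rationalM Pc) => //; apply: cr.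
  apply: generally_impl ha1 _ => v _ hv; apply: ph_der.
  by rewrite -/ell ellE hv mxE.
set w := k - _; have wa : \sum_i abar i ord0 * w ord0 i = 0.
  have : w *m abar = 0 by rewrite /w mulmxBl -(mulmxA c) eta_a mulmx1 subrr.
  move/matrixP/(_ ord0 ord0); rewrite !mxE => e0; rewrite -[RHS]e0.
  by apply: eq_bigr => i _; rewrite mulrC.
have -> : \sum_i ev p^`M(i) * w ord0 i = \sum_i ev ph^`M(i) * w ord0 i.
  under [RHS]eq_bigr => i _ do rewrite e_der mulrDl mulrAC.
  by rewrite big_split /= -mulr_suml wa mul0r addr0.
have k0 := kt _ _ ph_hom phY.
have eta0 : \sum_i ev ph^`M(i) * eta ord0 i = 0.
  under eq_bigr => i _ do rewrite mxE -(ff_mul ff) //.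
  rewrite -(cl_sum Pc ff) => [|i]; last exact: (rationalM Pc).
  apply/(cl_eq0 Pc ff) => //.
  by apply: (rational_sum Pc) => i; apply: (rationalM Pc).
under eq_bigr => i _ do rewrite /w !mxE mulrBr big_ord1 mulrCA.
rewrite sumrB k0 sub0r -mulr_sumr.
rewrite (_ : \sum_i _ = 0) ?mulr0 ?oppr0 //.
Qed.

Let conormal_BM v : V0 v -> chart_dom (Gr_Q B) v.1 -> chart_dom (dual_Q a) v.2 ->
  h v *m B *m M v = h v.
Proof.
move=> V0v vB va; have [ME MA] := Gr_dom vB; have [hE _] := dual_dom va.
have [G [_ [GE _]]] := Gr_equations (gamma v.1).
apply/(vanishing_proj _ ME MA); apply: ((gamma_vanishing em _ V0v.1 vB).1 _).1.
by apply/(vanishing_sub _ GE); rewrite -(subv_cut_out GE hE); case: V0v.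
Qed.

Hypothesis sg : separably_generated F.

(* The tangent forms are the derivations of K(Y) with values in K(V); by separability they *)
(* extend to K(V), i.e. lift to tangent vectors of V at its generic point. *)
Lemma tangent_form_vanishing k : tangent_form k -> k *m clmx cl (fun=> B) *m clmx cl M = k.
Proof.
(* [k'] is the representative of [k] modulo the generic equation [eta] that is tangent to the
   normalization [h a = 1]. *)
move=> kt; set c := k *m abar; pose k' := k - c *m eta.
pose Bb := clmx cl (fun=> B : 'M[K]_(N.+1, N - m)); pose Mb := clmx cl M.
have hBM : eta *m Bb *m Mb = eta.
  rewrite /eta /Bb /Mb -!(clmxM Pc ff) //; last exact: rational_mxM.
  apply/(clmx_eq ff) => //.
    by apply: (rational_mxM Pc) => //; apply: (rational_mxM Pc).
  by apply: generally_impl good _ => v Vv [V0v vB va]; apply: conormal_BM.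
have [D0 [D0d D0E]] : exists D, deriv_on R0 D /\ forall p, D (ev p) = \sum_i ev p^`M(i) * k' ord0 i.
  have [|||||p _ p0|D [Dd DE]] := @deriv_image _ _ setT ev (fun p => \sum_i ev p^`M(i) * k' ord0 i).
  - by [].
  - by move=> p q _ _; apply: evB.
  - by move=> p q _ _; apply: evM.
  - move=> p q _ _; rewrite -sumrB; apply: eq_bigr => i _.
    by rewrite mderivB evB mulrBl.
  - move=> p q _ _; rewrite !mulr_sumr -big_split; apply: eq_bigr => i _ /=.
    by rewrite mderivM evD !evM; ring.
  - exact: tangent_form_affine.
  by exists D; split=> // p; apply: DE.
have [D1 [D1d D1E]] := deriv_frac R0_subring D0d.
have Fd : deriv_on F D1.
  by split=> x y Fx Fy; [apply: (proj1 D1d) | apply: (proj2 D1d)]; apply: F_frac.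
have [r [b [bind bsep]]] := sg.
(* The chart coordinates of [x]: the elements of K(V) whose derivatives are required beyond K(Y). *)
pose s := [seq cl (fun v => nu v ord0 i) | i <- enum 'I_(ncoord (Gr K N m))].
have [E [D [Er Dd FE Es DE]]] := deriv_extension s F_subring Fd bind bsep.
have R0E x : R0 x -> E x by move=> /R0_F /FE.
have DR0 p : D (ev p) = \sum_i ev p^`M(i) * k' ord0 i.
  have R0p : R0 (ev p) by exists p.
  by rewrite DE ?D1E ?D0E //; apply: R0_F.
have EC t : E (cl (fun=> t)) /\ D (cl (fun=> t)) = 0.
  rewrite -evC; split; first by apply: R0E; exists t%:MP.
  by rewrite DR0 big1 // => i _; rewrite mderivC -mpolyC0 evC (cl0 Pc ff) mul0r.
have Enu i : E (cl (fun v => nu v ord0 i)).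
  by apply: Es; apply/mapP; exists i => //; rewrite mem_enum.
have [om omr omE] := clmx_surj ff (map_mx D (clmx cl nu)).
(* Applying [D] to the equations of [X], which vanish identically at the coordinates of [x], shows
   that the vector of derivatives specializes to a tangent vector of [X] at general points. *)
have om_tangent : generally V (fun v => chart_tangent X v.1 (Gr_nu B) (Gr_Q B) (om v)).
  have [n [q [q0 qE]]] := Xo_equations em V0v1.1 xB.
  have qV : generally V (fun v => forall w, chart_tangent X v.1 (Gr_nu B) (Gr_Q B) w <->
                     forall j, grad (q j) (nu v) w = 0).
    by apply: (irreducible_generally Vi Vv1); apply: (locally_fst VX Vv1 qE).
  have om0 : generally V (fun v => forall j, grad (q j) (nu v) (om v) = 0).
    apply: generally_fin => j.
    have rq i : rational V (fun v => (q j)^`M(i).@[nu v ord0]).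
      exact: (rational_poly Pc _ (nur ord0)).
    apply/(cl_eq0 Pc ff); first by apply: (rational_sum Pc) => i; apply: (rationalM Pc).
    rewrite (cl_sum Pc ff) => [|i]; last exact: (rationalM Pc).
    have [_] := derivation_poly Pc ff Er Dd (q j) nur EC Enu.
    have -> : cl (fun v => (q j).@[nu v ord0]) = 0.
      apply/(cl_eq0 Pc ff); first exact: (rational_poly Pc _ (nur ord0)).
      by apply: generally_impl good _ => v Vv [_ vB _]; apply: q0 => //; apply: VX.
    rewrite (der0 Er Dd) => e0; rewrite [RHS]e0; apply: eq_bigr => i _.
    rewrite (ff_mul ff) //; congr (_ * _).
    by have /matrixP/(_ ord0 i) := omE; rewrite !mxE.
  by apply: generally_impl (generally_and qV om0) _ => v _ [e e0]; apply/e.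
have DM : map_mx D Mb = clmx cl (fun v => vec_mx (om v)).
  apply/matrixP => i j; rewrite !mxE.
  have -> : (fun v => M v i j) = (fun v => nu v ord0 (mxvec_index i j)).
    by apply/funext => v; have /matrixP/(_ i j) := Gr_nuE B v.1; rewrite !mxE.
  have -> : (fun v => vec_mx (om v) i j) = (fun v => om v ord0 (mxvec_index i j)).
    by apply/funext => v; rewrite mxE.
  by have /matrixP/(_ ord0 (mxvec_index i j)) := omE; rewrite !mxE.
have vomr : rational_mx V (fun v => vec_mx (om v)).
  move=> i j; rewrite (_ : (fun v => _) = (fun v => om v ord0 (mxvec_index i j))) //.
  by apply/funext => v; rewrite mxE.
(* At general points [h] vanishes on [gamma x], so it lies in the kernel of phi, which kills
   [h B dM] for every tangent direction. *)
have key : eta *m Bb *m map_mx D Mb = 0.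
  have r1 : rational_mx V (fun v => h v *m B) by apply: (rational_mxM Pc).
  rewrite DM /eta /Bb -(clmxM Pc ff) // -(clmxM Pc ff) //.
  have -> : 0 = clmx cl (fun=> 0) :> 'M_(1, N.+1).
    by apply/matrixP => i j; rewrite !mxE -[LHS](cl0 Pc ff).
  apply/(clmx_eq ff) => //; first exact: (rational_mxM Pc).
  apply: generally_impl (generally_and good om_tangent) _ => v Vv [[V0v vB va] tv].
  have [A [_ [GE _]]] := Gr_equations (gamma v.1); have [hE _] := dual_dom va.
  have hv : vanishing (val (gamma v.1)) (h v).
    by apply/(vanishing_sub _ GE); rewrite -(subv_cut_out GE hE); case: V0v.
  by have [_] := (gamma_vanishing em _ V0v.1 vB).1 hv; apply.
have Eeta i j : E (eta i j).
  by rewrite mxE (ord1 i) -evX; apply: R0E; exists 'X_j.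
have EB i j : E (Bb i j) by rewrite mxE; case: (EC (B i j)).
have EM i j : E (Mb i j).
  rewrite mxE (_ : (fun v => _) = (fun v => nu v ord0 (mxvec_index i j))) //.
  by apply/funext => v; have /matrixP/(_ i j) := Gr_nuE B v.1; rewrite !mxE.
have [d1 E1] := derivation_mxM Er Dd Eeta EB.
have [d2 _] := derivation_mxM Er Dd E1 EM.
have Deta : map_mx D eta = k'.
  apply/rowP => i; rewrite mxE [eta _ _]mxE -evX DR0 (bigD1 i) //= big1 => [|j ji].
    rewrite addr0 (_ : ('X_i)^`M(i) = 1); first by rewrite -mpolyC1 evC (ff_one ff) mul1r.
    rewrite mderivX mnm1E eqxx scale1r.
    have -> : (U_(i) - U_(i) = 0)%MM by apply/mnmP => l; rewrite mnmBE mnm0E subnn.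
    exact: mpolyX0.
  rewrite (_ : ('X_i)^`M(j) = 0); first by rewrite -mpolyC0 evC (cl0 Pc ff) mul0r.
  by rewrite mderivX mnm1E eq_sym (negPf ji) scale0r.
have DB : map_mx D Bb = 0.
  by apply/matrixP => i j; rewrite !mxE; case: (EC (B i j)).
have k'E : k' *m Bb *m Mb = k'.
  by rewrite -[RHS]Deta -[in RHS]hBM d2 key addr0 d1 DB mulmx0 addr0 Deta.
(* The subtracted multiple of [eta] is itself fixed by [B M], so it can be added back. *)
have fixD u : u *m Bb *m Mb = u -> (u + c *m eta) *m Bb *m Mb = u + c *m eta.
  by move=> uE; rewrite !mulmxDl uE -!(mulmxA c) hBM.
by have := fixD _ k'E; rewrite /k' subrK.
Qed.

(** Finitely many homogeneous equations of [Y] have gradients [J] spanning all gradients at the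
    generic point. The rows of [1 - J eps] are tangent forms there, so [tangent_form_vanishing]
    becomes a matrix identity over K(V), valid at general points. At such a point an embedded
    tangent form [k] satisfies [k J = 0], hence [k = k (1 - J eps)] is killed by [1 - B M], which
    means that it vanishes on [x]. *)
Lemma embedded_tangent_star : generally V (fun v => embedded_tangent Y (pi v) `<=` star v.1).
Proof.
have [r [C [Cf CI IC]]] := finite_span
  [set g : 'rV[L]_N.+1 | exists d p, [/\ p \is d.-homog, vanishes_on_image p & g = \row_i ev p^`M(i)]].
have /choice [p pE] : forall j, exists p, exists d,
    [/\ p \is d.-homog, vanishes_on_image p & row j C = \row_i ev p^`M(i)].
  by move=> j; have [d [p pj]] := CI j; exists p, d.
have /row_freeP [Ct CCt] := Cf.
(* [eps] represents a left inverse of the generic gradient matrix, so [1 - J eps] projects onto the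
   forms killed by [J]. *)
have [eps epsr epsE] := clmx_surj ff Ct^T.
pose J v : 'M[K]_(N.+1, r) := \matrix_(i, j) (p j)^`M(i).@[h v ord0].
have Jr : rational_mx V J.
  move=> i j; rewrite (_ : (fun v => _) = (fun v => (p j)^`M(i).@[h v ord0])) //.
  by apply/funext => v; rewrite mxE.
have JE : clmx cl J = C^T.
  apply/matrixP => i j; rewrite !mxE.
  have [d [_ _ /rowP/(_ i)]] := pE j; rewrite !mxE => ->; congr cl.
  by apply/funext => v; rewrite mxE.
have JeB : (1%:M - clmx cl J *m clmx cl eps) *m (1%:M - clmx cl (fun=> B) *m clmx cl M) = 0.
  apply/row_matrixP => i; rewrite row0 row_mul mulmxBr mulmx1 mulmxA.
  apply/eqP; rewrite subr_eq0 eq_sym; apply/eqP; apply: tangent_form_vanishing.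
  move=> d q qh qv; set k := row i _.
  have kC : k *m C^T = 0.
    rewrite /k -row_mul mulmxBl mul1mx -mulmxA epsE JE -trmx_mul CCt trmx1 mulmx1 subrr.
    by rewrite row0.
  have /submxP [D qD] : (\row_i ev q^`M(i) <= C)%MS by apply: IC; exists d, q.
  have : k *m (\row_i ev q^`M(i))^T = 0 by rewrite qD trmx_mul mulmxA kC mul0mx.
  move=> /matrixP/(_ ord0 ord0); rewrite [LHS]mxE [RHS]mxE => e; rewrite -[RHS]e.
  apply: eq_bigr => l _; rewrite mulrC; congr (_ * _).
  by rewrite !mxE.
have gJ : generally V (fun v => (1%:M - J v *m eps v) *m (1%:M - B *m M v) = 0).
  have r1 : rational_mx V (fun v => 1%:M - J v *m eps v).
    by apply: (rational_mxB Pc) => //; apply: (rational_mxM Pc).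
  have r2 : rational_mx V (fun v => 1%:M - B *m M v).
    by apply: (rational_mxB Pc) => //; apply: (rational_mxM Pc).
  apply/(clmx_eq ff) => //; first exact: (rational_mxM Pc).
  rewrite (clmxM Pc ff) // (clmxB Pc ff) //; last exact: (rational_mxM Pc).
  rewrite (clmxB Pc ff) //; last exact: (rational_mxM Pc).
  rewrite !(clmxM Pc ff) // !(clmx1 Pc ff) JeB.
  by apply/matrixP => i j; rewrite !mxE (cl0 Pc ff).
apply: generally_impl (generally_and good gJ) _ => v Vv [[V0v vB va] e] H HT.
have [k [_ [kE _]]] := dual_equation H; have [hE _] := dual_dom va.
have [ME MA] := Gr_dom vB.
have kJ : k *m J v = 0.
  apply/rowP => j; rewrite !mxE; have [d [ph pv _]] := pE j.
  rewrite -[RHS](HT (h v) k hE kE d (p j) ph pv); apply: eq_bigr => i _.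
  by rewrite mxE mulrC.
rewrite /star /= (subv_cut_out ME kE); apply/(vanishing_sub _ ME)/(vanishing_proj _ ME MA).
have : k *m ((1%:M - J v *m eps v) *m (1%:M - B *m M v)) = 0 by rewrite e mulmx0.
have kJe : k *m (1%:M - J v *m eps v) = k by rewrite mulmxBr mulmx1 mulmxA kJ mul0mx subr0.
rewrite mulmxA kJe mulmxBr mulmx1 mulmxA.
by move/eqP; rewrite subr_eq0 => /eqP <-.
Qed.

End SeparableCase.

Theorem proposition3p13 (K : closedFieldType) (N m mp : nat)
    (X Xo : set (Gr K N m)) (gamma : Gr K N m -> Gr K N mp) :
  zclosed X -> zirreducible X -> expanding_map X Xo gamma ->
  let V := gen_conormal Xo gamma in
  let pi := @pibar K N m in
  let Y := pi @` V in
  generally V (fun v =>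
    let x := v.1 in
    let rk_dpi := rk (tangent V v) (differential [set: dualP K N] pi v) in
    let rk_dgamma := rk (tangent X x) (dgamma Xo gamma x) in
    let rk_Psi := rk [set q | q \in val (gamma x)] (@Psi K N m mp X Xo gamma x) in
    [/\ (rk_dpi - (N - mp - 1) <= rk_dgamma)%N /\
        (rk_dpi - (N - mp - 1) <= rk_Psi)%N,
        rk_dpi = (N - mp - 1)%N -> rk_dgamma = 0%N
      & separable_map V pi -> embedded_tangent Y (pi v) `<=` star x]).
Proof.
move=> Xc Xi em V pi Y.
have gc : generally V (fun v => separable_map V pi -> embedded_tangent Y (pi v) `<=` star v.1).
  have [[v Vv]|V0] := pselect (V !=set0); last first.
    by apply: generallyT => v Vv; case: V0; exists v.
  (* Separability does not depend on the point, so it is decided before a general point is chosen;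
     if it fails, the implication is vacuous. *)
  have [[L [cl [ff sg]]]|ns] := pselect (separable_map V pi); last first.
    by apply: generallyT => w _ /ns.
  have [v1 V0v1 _] := gen_conormal_meets Vv (zopenT _) I.
  have [M0 [B [M0E M0B]]] := Gr_equations v1.1.
  have [h0 [a [h0E h0a]]] := dual_equation v1.2.
  have xB : chart_dom (Gr_Q B) v1.1 by apply: Gr_dom_intro M0E _; rewrite M0B unitmx1.
  have Ha : chart_dom (dual_Q a) v1.2 by apply: dual_dom_intro h0E _; rewrite h0a unitmx1.
  apply: generally_impl (embedded_tangent_star em Xc Xi V0v1 xB Ha ff sg) _.
  by move=> w _ wT _.
apply: generally_impl (generally_and (open_conormal_generally em Xc)
  (generally_and (rank_minimal em Xc Xi) gc)) _.
by move=> v _ [V0v [hb hc]]; split=> //; apply: rank_inequalities.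
Qed.
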